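(* Let $T>0$. For any $F\in L^2(\Omega,\mathcal{F}_T^L,P)$, there exist symmetric functions $f_n\in\mathcal{H}^{\otimes n}$, $n\ge1$, such that $$F=E(F)+\sum_{n\ge1}I_n(f_n)\quad\text{in }L^2(\Omega).$$ In particular, $$E|F|^2=|E(F)|^2+\sum_{n\ge1}n!\,\|f_n\|^2_{\mathcal{H}^{\otimes n}}.$$
   Context: Let $\mathbb{R}_0=\mathbb{R}\setminus\{0\}$ and let $\nu$ be a Lévy measure on $\mathbb{R}$: $\int_{\mathbb{R}_0}(1\wedge|z|^2)\,\nu(dz)<\infty$, $\nu(\{0\})=0$, and assume moreover $v:=\int_{\mathbb{R}_0}z^2\,\nu(dz)<\infty$. On a probability space $(\Omega,\mathcal{F},P)$, $N$ is a Poisson random measure on $\mathbb{R}_+\times\mathbb{R}^d\times\mathbb{R}_0$ with intensity $\mu=dt\,dx\,\nu(dz)$, and $\widehat N(A)=N(A)-\mu(A)$ for Borel $A$ with $\mu(A)<\infty$. The Lévy white noise is $L(B)=\int_{B\times\mathbb{R}_0}z\,\widehat N(ds,dx,dz)$ for bounded Borel $B\subset\mathbb{R}_+\times\mathbb{R}^d$ (the $L^2(\Omega)$ integral of a deterministic function with respect to $\widehat N$). Write $L_s(B)=L([0,s]\times B)$ for bounded Borel $B\subset\mathbb{R}^d$, and $\mathcal{F}_T^L=\sigma(\{L_s(B):0\le s\le T,\ B\subset\mathbb{R}^d\text{ bounded Borel}\})$. $L^2(\Omega,\mathcal{F}_T^L,P)$ is the space of square-integrable $\mathcal{F}_T^L$-measurable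 random variables. Let $S=[0,T]\times\mathbb{R}^d\times\mathbb{R}_0$ with its Borel (product) $\sigma$-field $\mathcal{S}$ and measure $\mu=dt\,dx\,\nu(dz)$, $\mathcal{H}=L^2(S,\mathcal{S},\mu)$ and $\mathcal{H}^{\otimes n}=L^2(S^n,\mathcal{S}^n,\mu^n)$. A function on $S^n$ is symmetric if it is invariant under permutations of its $n$ arguments in $S$. For $f\in\mathcal{H}^{\otimes n}$, $I_n(f)$ is the $n$-th multiple integral with respect to $\widehat N$: the continuous linear map $I_n:\mathcal{H}^{\otimes n}\to L^2(\Omega)$ determined by $I_n(1_{A_1\times\cdots\times A_n})=\widehat N(A_1)\cdots\widehat N(A_n)$ for pairwise disjoint $A_1,\dots,A_n\in\mathcal{S}$ of finite $\mu$-measure. It satisfies $E|I_n(f)|^2=n!\,\|f\|^2_{\mathcal{H}^{\otimes n}}$ for symmetric $f$, and $E[I_n(f)I_m(g)]=0$ if $n\ne m$. *)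

(* Defs.v *)
From HB Require Import structures.
From mathcomp Require Import all_boot all_order all_algebra perm.
From mathcomp Require Import all_classical all_reals all_analysis measurable_realfun.

Set Implicit Arguments.
Unset Strict Implicit.
Unset Printing Implicit Defensive.

Import Order.TTheory GRing.Theory Num.Theory.
Import numFieldNormedType.Exports.

Local Open Scope classical_set_scope.
Local Open Scope ring_scope.

Section sigma_finiteness.
Context {R : realType}.
Local Open Scope ereal_scope.

Lemma mrestr_sigma_finite d (T : measurableType d)
    (m : {measure set T -> \bar R}) (D : set T) (mD : measurable D) :
  sigma_finite setT m -> sigma_finite setT (mrestr m mD).
Proof.
move=> [F UF mF]; exists F => // i.
have [mFi Foo] := mF i; split => //.
rewrite /mrestr (le_lt_trans _ Foo)// le_measure ?inE//.
exact: measurableI.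
Qed.

Lemma product_sigma_finite d1 d2 (T1 : measurableType d1)
    (T2 : measurableType d2) (m1 : {measure set T1 -> \bar R})
    (m2 : {sigma_finite_measure set T2 -> \bar R}) :
  sigma_finite setT m1 -> sigma_finite setT (m1 \x m2).
Proof.
move=> /sigma_finiteP[F [UF ndF mF]].
have /sigma_finiteP[G [UG ndG mG]] := sigma_finiteT m2.
exists (fun i => F i `*` G i).
  apply/seteqP; split=> [[x y] _|//] /=.
  have : [set: T1] x by []. rewrite UF => -[i _ Fi].
  have : [set: T2] y by []. rewrite UG => -[j _ Gj].
  exists (maxn i j) => //; split => /=.
    by have /subsetPset := ndF _ _ (leq_maxl i j); exact.
  by have /subsetPset := ndG _ _ (leq_maxr i j); exact.
move=> i; have [mFi Foo] := mF i; have [mGi Goo] := mG i.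
split; first exact: measurableX.
rewrite product_measure1E// lte_mul_pinfty//.
by rewrite ge0_fin_numE.
Qed.

End sigma_finiteness.

(* n-fold product measure on n.-tuple T: the image of m \x m^(n-1) under
   (x, t) |-> x :: t *)
Section power_measure.
Context d (T : measurableType d) (R : realType).

Definition tuple_cons n (p : T * n.-tuple T) : n.+1.-tuple T :=
  [tuple of p.1 :: p.2].

Fixpoint power_measure (m : set T -> \bar R) n : set (n.-tuple T) -> \bar R :=
  match n with
  | 0%N => \d_([tuple] : 0.-tuple T)
  | n'.+1 => pushforward (m \x @power_measure m n')%E (@tuple_cons n')
  end.

Arguments power_measure : clear implicits.

Lemma measurable_tuple_cons n : measurable_fun setT (@tuple_cons n).
Proof. exact: measurable_cons. Qed.

Variable m : {sigma_finite_measure set T -> \bar R}.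

Lemma power_measure_ex n :
  exists M : {sigma_finite_measure set (n.-tuple T) -> \bar R},
    power_measure m n = M :> (set _ -> \bar R).
Proof.
elim: n => [|n [M ME]]; first by exists (\d_([tuple] : 0.-tuple T)).
pose f : {mfun (T * n.-tuple T)%type >-> n.+1.-tuple T} :=
  HB.pack (@tuple_cons n)
    (@isMeasurableFun.Build _ _ _ _ _ (@measurable_tuple_cons n)).
pose p := pushforward (m \x M)%E f.
have sf : sigma_finite setT p.
  have [F UF mF] := product_sigma_finite M (sigma_finiteT m).
  pose g (t : n.+1.-tuple T) : T * n.-tuple T := (thead t, [tuple of behead t]).
  have fK : cancel f g.
    by move=> [x t]; rewrite /g /f /= theadE; congr pair; exact/val_inj.
  have gK : cancel g f by move=> t; rewrite [RHS]tuple_eta; exact/val_inj.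
  have mg : measurable_fun setT g.
    apply: measurable_fun_pair => /=; last exact: measurable_behead.
    exact: measurable_tnth.
  exists (fun i => g @^-1` F i) => [|i].
    by rewrite -preimage_bigcup -UF preimage_setT.
  have [mFi Foo] := mF i; split; first by rewrite -[X in measurable X]setTI; exact: mg.
  rewrite /p /pushforward (_ : f @^-1` _ = F i)//.
  by rewrite -comp_preimage; apply/seteqP; split => x /=; rewrite fK.
pose P : {sigma_finite_measure set (n.+1.-tuple T) -> \bar R} :=
  HB.pack p (Measure_isSigmaFinite.Build _ _ _ p sf).
have mf := @measurable_tuple_cons n.
by exists (P mf mf mf); rewrite /= ME.
Qed.

Lemma power_measure0 n : power_measure m n set0 = 0%E.
Proof. by have [M ->] := power_measure_ex n; rewrite measure0. Qed.

Lemma power_measure_ge0 n A : (0 <= power_measure m n A)%E.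
Proof. by have [M ->] := power_measure_ex n; rewrite measure_ge0. Qed.

Lemma power_measure_sigma_additive n : semi_sigma_additive (power_measure m n).
Proof.
by have [M ->] := power_measure_ex n; exact: measure_semi_sigma_additive.
Qed.

HB.instance Definition _ n := isMeasure.Build _ _ _ (power_measure m n)
  (@power_measure0 n) (@power_measure_ge0 n) (@power_measure_sigma_additive n).

Lemma power_measure_sigma_finite n : sigma_finite setT (power_measure m n).
Proof. by have [M ->] := power_measure_ex n; exact: sigma_finiteT. Qed.

HB.instance Definition _ n :=
  Measure_isSigmaFinite.Build _ _ _ (power_measure m n)
    (@power_measure_sigma_finite n).

End power_measure.
Arguments power_measure {d T R} m n.

Section levy_measure.
Context (R : realType).
Local Open Scope ereal_scope.

Record levyMeasure := LevyMeasure {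
  levy_measure :> {measure set R -> \bar R} ;
  levy_measure_set1 : levy_measure [set 0%R] = 0 ;
  levy_measure_fin :
    \int[levy_measure]_(z in [set~ 0%R]) (Num.min 1 (`|z| ^+ 2))%R%:E < +oo }.

(* a copy of levy_measure carrying the sigma-finite structure, which is
   needed to form product measures *)
Definition levy (nu : levyMeasure) : set R -> \bar R := levy_measure nu.

HB.instance Definition _ nu := Measure.on (levy nu).

Lemma levy_sigma_finite nu : sigma_finite setT (levy nu).
Proof.
pose A n : set R := [set z | (n.+1%:R^-1 <= `|z|)%R].
have mA n : measurable (A n).
  rewrite (_ : A n = Num.norm @^-1` `[(n.+1%:R^-1)%R, +oo[%classic).
    by rewrite -[X in measurable X]setTI; apply: normr_measurable.
  by apply/seteqP; split => z /=; rewrite in_itv/= andbT.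
exists (fun n => if n is k.+1 then A k else [set 0%R]).
  apply/seteqP; split=> // z _; have [->|z0] := eqVneq z 0%R; first by exists 0%N.
  have z1 : (0 < `|z|)%R by rewrite normr_gt0.
  have [k _ Hk] := near_infty_natSinv_lt (PosNum z1).
  by exists k.+1 => //=; apply: ltW; exact: (Hk k (leqnn k)).
case=> [|n]; first by split => //; rewrite /levy levy_measure_set1.
split => //.
pose c : R := (n.+1%:R^-1 ^+ 2)%R.
have c0 : (0 < c)%R by rewrite exprn_gt0.
have c1 : (c <= 1)%R by rewrite exprn_ile1// invf_le1// ler1n.
have : c%:E * levy nu (A n) < +oo.
  apply: le_lt_trans (levy_measure_fin nu).
  rewrite -integral_cst//.
  have mD : measurable ([set~ 0%R] : set R) by exact: measurableC.
  have mf (D : set R) : measurable_fun D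
      (fun z : R => (Num.min 1 (`|z| ^+ 2))%R%:E).
    apply/measurable_EFinP; apply: measurable_minr => //.
    by apply: measurable_funX; exact: measurable_funTS.
  apply: (@le_trans _ _
    (\int[levy_measure nu]_(z in A n) (Num.min 1 (`|z| ^+ 2))%R%:E)).
    apply: ge0_le_integral => //.
    - by move=> z _; rewrite lee_fin ltW.
    - move=> z Az; rewrite lee_fin le_min c1/=.
      by rewrite lerXn2r// ?nnegrE.
  apply: ge0_subset_integral => //.
  move=> z /= Az z0; move: Az; rewrite /A/= z0 normr0.
  by rewrite leNgt invr_gt0 ltr0n.
move=> H; rewrite ltey; apply/eqP => E; move: H.
by rewrite E gt0_muley ?lte_fin// ltxx.
Qed.

HB.instance Definition _ nu :=
  Measure_isSigmaFinite.Build _ _ _ (levy nu) (levy_sigma_finite nu).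

End levy_measure.

(* Time and space coordinates carry the Borel structure measurableTypeR R on
   which lebesgue_measure is defined; it has the same sets as that of R. The
   product sigma-field on d-tuples is the Borel sigma-field of R^d. *)
Notation euclidean R d := (d.-tuple (measurableTypeR R)).
Notation spaceTime R d := (measurableTypeR R * euclidean R d)%type.
Notation jumpSpace R d := (spaceTime R d * R)%type.

Section intensity.
Context (R : realType) (d : nat).

(* I x R^d x R_0, as a subset of the ambient R x R^d x R *)
Definition slab (I : interval R) : set (jumpSpace R d) :=
  ([set` I] `*` setT) `*` [set~ 0].

Lemma measurable_slab I : measurable (slab I).
Proof.
apply: measurableX; last exact: measurableC.
by apply: measurableX => //; exact: measurable_itv.
Qed.

(* dt dx nu(dz) on I x R^d x R_0, extended by zero to the ambient space: the
   L^2 spaces below thus consist of functions on the ambient space (or its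
   powers) whose values outside the slab are irrelevant *)
Definition intensity (nu : levyMeasure R) (I : interval R) :
    set (jumpSpace R d) -> \bar R :=
  mrestr ((lebesgue_measure \x power_measure lebesgue_measure d) \x levy nu)%E
    (measurable_slab I).

HB.instance Definition _ nu I := Measure.on (intensity nu I).

Lemma intensity_sigma_finite nu I : sigma_finite setT (intensity nu I).
Proof.
apply: mrestr_sigma_finite; apply: product_sigma_finite.
by apply: product_sigma_finite; exact: sigma_finiteT.
Qed.

HB.instance Definition _ nu I :=
  Measure_isSigmaFinite.Build _ _ _ (intensity nu I)
    (intensity_sigma_finite nu I).

End intensity.
Arguments slab {R} d I.
Arguments intensity {R} d nu I.

Definition L2cvg d (X : measurableType d) (R : realType)
    (m : {measure set X -> \bar R}) (u : nat -> X -> R) (f : X -> R) : Prop :=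
  ('N[m]_2%:E[EFin \o (u k \- f)%R] @[k --> \oo] --> 0)%E.

(* I, acting on representatives, is a continuous linear map L^2(m) -> L^2(P) *)
Definition L2_continuous_linear d d' (X : measurableType d)
    (Y : measurableType d') (R : realType) (m : {measure set X -> \bar R})
    (P : {measure set Y -> \bar R}) (I : (X -> R) -> Y -> R) : Prop :=
  [/\ forall f, f \in Lfun m 2%:E -> I f \in Lfun P 2%:E,
      forall (a : R) f g, f \in Lfun m 2%:E -> g \in Lfun m 2%:E ->
        I (a \*: f \+ g) = a \*: I f \+ I g %[ae P] &
      forall (u : nat -> X -> R) f, (forall k, u k \in Lfun m 2%:E) ->
        f \in Lfun m 2%:E -> L2cvg m u f ->
        L2cvg P (fun k => I (u k)) (I f) ].

Section poisson.
Context (R : realType) (dO : measure_display) (Omega : measurableType dO)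
  (P : probability Omega R) (dE : measure_display) (E : measurableType dE).
Local Open Scope ereal_scope.

(* poisson_prob ignores its second argument, and is \d_0 at rate 0 *)
Definition poisson_random_measure (mu : {measure set E -> \bar R})
    (N : R.-ker Omega ~> E) : Prop :=
  [/\ forall A, measurable A -> mu A < +oo -> forall k : nat,
        P [set w | N w A = k%:R%:E] = poisson_prob (fine (mu A)) 0 [set k],
      forall A, measurable A -> mu A = +oo -> {ae P, forall w, N w A = +oo} &
      forall (n : nat) (A : 'I_n -> set E) (C : 'I_n -> set (\bar R)),
        (forall i, measurable (A i)) -> trivIset setT A ->
        (forall i, measurable (C i)) ->
        P [set w | forall i, C i (N w (A i))] =
        \prod_(i < n) P [set w | C i (N w (A i))] ].

Definition compensated (mu : set E -> \bar R) (N : R.-ker Omega ~> E)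
  (A : set E) (w : Omega) : R := (fine (N w A) - fine (mu A))%R.

End poisson.

Section white_noise.
Context (R : realType) (d : nat) (dO : measure_display)
  (Omega : measurableType dO) (P : probability Omega R)
  (nu : levyMeasure R) (N : R.-ker Omega ~> (jumpSpace R d)).

(* f |-> \int f d\hat N on L^2(R_+ x R^d x R_0, dt dx nu(dz)) *)
Definition compensated_integral (J : (jumpSpace R d -> R) -> Omega -> R) :
    Prop :=
  let mu := intensity d nu `[0, +oo[ in
  L2_continuous_linear mu P J /\
  forall A, measurable A -> A `<=` slab d `[0, +oo[ -> (mu A < +oo)%E ->
    J \1_A = compensated mu N A %[ae P].

(* the n-th multiple integral on L^2(S^n, mu^n), S = [0, T] x R^d x R_0 *)
Definition multiple_integral (T : R) (n : nat)
    (I : (n.-tuple (jumpSpace R d) -> R) -> Omega -> R) : Prop :=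
  let mu := intensity d nu `[0, T] in
  L2_continuous_linear (power_measure mu n) P I /\
  forall A : 'I_n -> set (jumpSpace R d),
    (forall i, measurable (A i)) -> (forall i, A i `<=` slab d `[0, T]) ->
    (forall i, (mu (A i) < +oo)%E) -> trivIset setT A ->
    I \1_[set t | forall i, A i (tnth t i)] =
      (fun w => \prod_(i < n) compensated mu N (A i) w) %[ae P].

Definition symmetric_fun (T : Type) (n : nat) (f : n.-tuple T -> R) : Prop :=
  forall (s : 'S_n) (t : n.-tuple T), f [tuple tnth t (s i) | i < n] = f t.

Variable J : (jumpSpace R d -> R) -> Omega -> R.

(* z 1_{B x R_0}(t, x, z) = z 1_B(t, x) *)
Definition levy_noise (B : set (spaceTime R d)) : Omega -> R :=
  J (fun e => \1_B e.1 * e.2).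

Definition bounded_borel (B : set (euclidean R d)) : Prop :=
  measurable B /\
  exists M : R, forall x, B x -> forall i, `|tnth x i : R| <= M.

(* the sigma-field generated by the L_s(B), 0 <= s <= T, B bounded Borel *)
Definition noise_field (T : R) : set (set Omega) :=
  <<s [set D | exists (s : R) (B : set (euclidean R d)) (C : set R),
         [/\ 0 <= s <= T, bounded_borel B, measurable C &
             D = levy_noise ([set` `[0, s]] `*` B) @^-1` C] ] >>.

End white_noise.

(* Main.v *)
Require Import Defs.
From HB Require Import structures.
From mathcomp Require Import all_boot all_order all_algebra.
From mathcomp Require Import all_classical all_reals all_analysis.
From mathcomp Require Import measurable_realfun ring lra.

Import Order.TTheory GRing.Theory Num.Theory.
Import numFieldNormedType.Exports.

Local Open Scope classical_set_scope.
Local Open Scope ring_scope.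
Set Implicit Arguments.
Unset Strict Implicit.
Unset Printing Implicit Defensive.

(** Write [G_B] for the indicator of [N(B) = 0] and [K_n(B)] for the [n]-fold
integral of the indicator of [B^n]. Cutting [B] and [C] into small cells and
keeping off-diagonal products only, [K_n(B)] is an [L^2] limit of multilinear
polynomials in independent compensated Poisson variables; this gives
[E(K_n(B) K_k(C)) = n! mu(B /\ C)^n] if [n = k] and [0] otherwise, and
[E(G_B K_n(B)) = e^(-mu B) (- mu B)^n]. Expanding the square of the error,
these formulas yield [G_B = e^(-mu B) sum_n (-1)^n / n! K_n(B)].
Variables with a chaos expansion form a closed subspace, because the integrals
are isometric up to [n!] on the closed span of the indicators of the [B^n].
The events [N(B) = 0] are stable under intersection ([N(B \/ C) = 0]), so by
Dynkin's theorem every square-integrable variable measurable with respect to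
the field that they and the null sets generate has an expansion. That field
contains the noise field: [N(A)] is the a.e. limit of the number of nonempty
cells of finer and finer subdivisions of [A], and [J f] is an [L^2] limit of
combinations of compensated counts. *)

(** The multiple integrals are given only as continuous linear operators with prescribed values, up
    to null sets, on boxes with pairwise disjoint sides, so the isometry has to be derived. The
    obstacle is the diagonal: the indicator of [B^n] is a limit of such boxes only if tuples with a
    repeated cell carry vanishing mass, which asks for finite cuts of [B] into cells of arbitrarily
    small mass. The time coordinate supplies them, even if [nu] has atoms or [d = 0].

    The [G_B] are bounded, multiplicative in [B], and explicitly expandable: the Charlier generating
    function [sum_n t^n / n! K_n(B) = e^(-t mu B) (1 + t)^(N(B))] at [t = -1] leaves the indicator
    of [N(B) = 0], which is the origin of the coefficients.

    Void events determine counts for a quantitative reason: a cell of mass [m] has on average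
    [m - 1 + e^(-m) <= m^2] points beyond the first, and over a subdivision of [A] these squares sum
    to at most the mesh times [mu A]. *)

Lemma cvg_EFinP (R : realType) (u : nat -> R) (l : R) :
  ((u k)%:E @[k --> \oo] --> l%:E) <-> (u k @[k --> \oo] --> l).
Proof.
split; first exact: fine_cvg.
by move=> ul; apply: cvg_EFin => //; exact: nearW.
Qed.

(** * The inner product of L2 *)

Section L2_inner_product.
Context d (X : measurableType d) (R : realType)
  (m : {measure set X -> \bar R}).
Implicit Types (f g h : X -> R) (u v : nat -> X -> R).

Lemma Lnorm2E f :
  ('N[m]_2%:E[EFin \o f] = (\int[m]_x (f x ^+ 2)%:E) `^ 2^-1)%E.
Proof.
rewrite unlock /=; congr (_ `^ _)%E; apply: eq_integral => x _ /=.
by rewrite powR_mulrn// -normrX ger0_norm// sqr_ge0.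
Qed.

Lemma L2P f : f \in Lfun m 2%:E <->
  measurable_fun setT f /\ (\int[m]_x (f x ^+ 2)%:E < +oo)%E.
Proof.
split.
  move=> f2; split; first by move: f2; rewrite inE => /andP[/[!inE]].
  have /integrableP[_] := Lfun2_integrable_sqr f2.
  by under eq_integral => x _ do rewrite /= ger0_norm ?sqr_ge0//.
move=> [mf f2]; rewrite inE; apply/andP; split; rewrite inE//=.
by rewrite /finite_norm Lnorm2E poweR_lty.
Qed.

Lemma L2_measurable f : f \in Lfun m 2%:E -> measurable_fun setT f.
Proof. by case/L2P. Qed.

(** Real-valued, so that [ring] and [lra] apply; being the [fine] of an extended integral, it is
    meaningful only for integrable products, whence the [L^2] hypotheses below. *)
Definition ip f g : R := \int[m]_x (f x * g x).

Lemma ipC f g : ip f g = ip g f.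
Proof. by apply: eq_Rintegral => x _; rewrite mulrC. Qed.

Lemma ip0l f : ip (cst 0) f = 0.
Proof.
rewrite /ip; under eq_Rintegral do rewrite mul0r.
by rewrite Rintegral_cst// mul0r.
Qed.

Lemma ip_ge0 f : 0 <= ip f f.
Proof. by apply: Rintegral_ge0 => x _; rewrite -expr2 sqr_ge0. Qed.

Lemma integrable_mul_L2 f g : f \in Lfun m 2%:E -> g \in Lfun m 2%:E ->
  m.-integrable setT (EFin \o (fun x => f x * g x)).
Proof. by move=> f2 g2; apply/Lfun1_integrable/Lfun2_mul_Lfun1. Qed.

Lemma L2_lin (a : R) f g : f \in Lfun m 2%:E -> g \in Lfun m 2%:E ->
  (a \*: f \+ g) \in Lfun m 2%:E.
Proof.
have [_ h] := @Lfun_submod_closed _ X R m 2%:E (lee1n 2).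
exact: h.
Qed.

Lemma L2_cst0 : cst 0 \in Lfun m 2%:E.
Proof.
by apply/L2P; split => //; under eq_integral do rewrite expr0n/=; rewrite integral0 ltry.
Qed.

Lemma L2D f g : f \in Lfun m 2%:E -> g \in Lfun m 2%:E ->
  (f \+ g) \in Lfun m 2%:E.
Proof.
move=> f2 g2; rewrite (_ : f \+ g = 1 \*: f \+ g); first exact: L2_lin.
by apply/funext => x /=; rewrite scale1r.
Qed.

Lemma L2B f g : f \in Lfun m 2%:E -> g \in Lfun m 2%:E ->
  (f \- g) \in Lfun m 2%:E.
Proof.
move=> f2 g2; rewrite (_ : f \- g = (-1) \*: g \+ f); first exact: L2_lin.
by apply/funext => x /=; rewrite scaleN1r addrC.
Qed.

Lemma L2Z (a : R) f : f \in Lfun m 2%:E -> a \*: f \in Lfun m 2%:E.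
Proof.
move=> f2; rewrite (_ : a \*: f = a \*: f \+ cst 0).
  by apply: L2_lin => //; exact: L2_cst0.
by apply/funext => x /=; rewrite addr0.
Qed.

Lemma ip_linl (a : R) f g h : f \in Lfun m 2%:E -> g \in Lfun m 2%:E ->
  h \in Lfun m 2%:E -> ip (a \*: f \+ g) h = a * ip f h + ip g h.
Proof.
move=> f2 g2 h2; rewrite /ip -RintegralZl//; last exact: integrable_mul_L2.
rewrite -RintegralD//; last exact: integrable_mul_L2.
  by apply: eq_Rintegral => x _ /=; rewrite /GRing.scale/= mulrDl mulrA.
by apply: integrableZl (integrable_mul_L2 f2 h2).
Qed.

Lemma ip_linr (a : R) f g h : f \in Lfun m 2%:E -> g \in Lfun m 2%:E ->
  h \in Lfun m 2%:E -> ip h (a \*: f \+ g) = a * ip h f + ip h g.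
Proof. by move=> f2 g2 h2; rewrite ipC ip_linl// !(ipC h). Qed.

Lemma ipDl f g h : f \in Lfun m 2%:E -> g \in Lfun m 2%:E ->
  h \in Lfun m 2%:E -> ip (f \+ g) h = ip f h + ip g h.
Proof.
move=> f2 g2 h2; rewrite -[ip f h]mul1r -ip_linl//; congr ip.
by apply/funext => x /=; rewrite scale1r.
Qed.

Lemma ipBl f g h : f \in Lfun m 2%:E -> g \in Lfun m 2%:E ->
  h \in Lfun m 2%:E -> ip (f \- g) h = ip f h - ip g h.
Proof.
move=> f2 g2 h2; rewrite [RHS]addrC -mulN1r -ip_linl//; congr ip.
by apply/funext => x /=; rewrite scaleN1r addrC.
Qed.

Lemma ipBr f g h : f \in Lfun m 2%:E -> g \in Lfun m 2%:E ->
  h \in Lfun m 2%:E -> ip h (f \- g) = ip h f - ip h g.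
Proof. by move=> f2 g2 h2; rewrite ipC ipBl// !(ipC h). Qed.

Lemma ipDr f g h : f \in Lfun m 2%:E -> g \in Lfun m 2%:E ->
  h \in Lfun m 2%:E -> ip h (f \+ g) = ip h f + ip h g.
Proof. by move=> f2 g2 h2; rewrite ipC ipDl// !(ipC h). Qed.

Lemma ip_sub f g : f \in Lfun m 2%:E -> g \in Lfun m 2%:E ->
  ip (f \- g) (f \- g) = ip f f - 2 * ip f g + ip g g.
Proof.
move=> f2 g2; rewrite ipBl//; last exact: L2B.
by rewrite !ipBr// (ipC g f); ring.
Qed.

(** Parallelogram law: the gap is the squared norm of [f \- g]. It replaces the triangle inequality
    and avoids square roots. *)
Lemma ip_add_le f g : f \in Lfun m 2%:E -> g \in Lfun m 2%:E ->
  ip (f \+ g) (f \+ g) <= 2 * (ip f f + ip g g).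
Proof.
move=> f2 g2; have := ip_ge0 (f \- g); rewrite ip_sub//.
by rewrite ipDl ?ipDr// ?L2D// (ipC g f); lra.
Qed.

Lemma EFin_ip f g : f \in Lfun m 2%:E -> g \in Lfun m 2%:E ->
  (ip f g)%:E = (\int[m]_x (f x * g x)%:E)%E.
Proof.
move=> f2 g2; rewrite /ip /Rintegral fineK//.
exact: integrable_fin_num (integrable_mul_L2 f2 g2).
Qed.

Lemma EFin_ip_sqr f : f \in Lfun m 2%:E ->
  (ip f f)%:E = (\int[m]_x (f x ^+ 2)%:E)%E.
Proof.
by move=> f2; rewrite EFin_ip//; apply: eq_integral => x _; rewrite expr2.
Qed.

Lemma Lnorm2_ip f : f \in Lfun m 2%:E ->
  ('N[m]_2%:E[EFin \o f] ^+ 2)%E = (ip f f)%:E.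
Proof.
move=> f2; rewrite Lnorm2E -EFin_ip_sqr// poweR_EFin -EFin_expe; congr EFin.
rewrite -powR_mulrn ?powR_ge0// -powRrM mulVf ?powRr1 ?ip_ge0//.
Qed.

Lemma ip_ae f f' g g' : f \in Lfun m 2%:E -> g \in Lfun m 2%:E ->
  f' \in Lfun m 2%:E -> g' \in Lfun m 2%:E ->
  f = f' %[ae m] -> g = g' %[ae m] -> ip f g = ip f' g'.
Proof.
move=> f2 g2 f'2 g'2 ff' gg'; apply/EFin_inj; rewrite !EFin_ip//.
apply: ae_eq_integral => //.
- by apply/measurable_EFinP; apply: measurable_funM; exact: L2_measurable.
- by apply/measurable_EFinP; apply: measurable_funM; exact: L2_measurable.
- by apply: filterS2 ff' gg' => x /(_ I) -> /(_ I) ->.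
Qed.

(** The quadratic polynomial [a |-> ip (a f + g) (a f + g)] is nonnegative; evaluate it at its
    minimum. *)
Lemma cauchy_schwarz f g : f \in Lfun m 2%:E -> g \in Lfun m 2%:E ->
  ip f g ^+ 2 <= ip f f * ip g g.
Proof.
move=> f2 g2.
have H (a : R) : 0 <= a ^+ 2 * ip f f + 2 * a * ip f g + ip g g.
  have := ip_ge0 (a \*: f \+ g).
  by rewrite ip_linl ?ip_linr ?L2_lin// (ipC g f); congr (_ <= _); ring.
have f0 := ip_ge0 f; have g0 := ip_ge0 g.
have [f00|fn0] := eqVneq (ip f f) 0.
  rewrite f00 mul0r; have [->|fg0] := eqVneq (ip f g) 0; first by rewrite expr0n.
  (* Here the polynomial is affine in [a]; this choice gives it the value -1. *)
  have := H (- (ip g g + 1) / (2 * ip f g)); rewrite f00 mulr0 add0r.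
  rewrite (_ : 2 * _ * _ = - (ip g g + 1)); first lra.
  by field.
have := H (- ip f g / ip f f).
rewrite (_ : _ + ip g g = ip g g - ip f g ^+ 2 / ip f f); last by field.
by rewrite subr_ge0 ler_pdivrMr 1?mulrC// lt_neqAle eq_sym fn0.
Qed.

(** Convergence is checked below in this form because squared norms expand into inner products. *)
Lemma L2cvgP u f : (forall k, u k \in Lfun m 2%:E) -> f \in Lfun m 2%:E ->
  L2cvg m u f <-> (ip (u k \- f) (u k \- f) @[k --> \oo] --> 0).
Proof.
move=> u2 f2.
have h k : (u k \- f) \in Lfun m 2%:E by apply: L2B.
pose n k : R := (ip (u k \- f) (u k \- f)) `^ 2^-1.
have nE k : ('N[m]_2%:E[EFin \o (u k \- f)%R] = (n k)%:E)%E.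
  by rewrite Lnorm2E -EFin_ip_sqr.
have n2 k : n k ^+ 2 = ip (u k \- f) (u k \- f).
  by rewrite -powR_mulrn ?powR_ge0// -powRrM mulVf ?powRr1 ?ip_ge0.
have nS k : n k = Num.sqrt (ip (u k \- f) (u k \- f)).
  by rewrite -n2 sqrtr_sqr ger0_norm// powR_ge0.
rewrite /L2cvg; split => [H|H].
  have {}H : n k @[k --> \oo] --> 0.
    apply/cvg_EFinP.
    rewrite (_ : (fun k => _) = (fun k => 'N[m]_2%:E[EFin \o (u k \- f)%R]))%E//.
    by apply/funext => k; rewrite nE.
  under eq_fun do rewrite -n2 expr2.
  by rewrite -(mulr0 0); exact: cvgM.
under eq_fun do rewrite nE.
apply/cvg_EFinP; under eq_fun do rewrite nS.
rewrite -(sqrtr0 R).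
by apply: continuous_cvg => //; exact: sqrt_continuous.
Qed.

Lemma L2cvg_cst f : f \in Lfun m 2%:E -> L2cvg m (fun=> f) f.
Proof.
move=> f2; apply/L2cvgP => //; rewrite (_ : (fun=> _) = cst 0); first exact: cvg_cst.
by apply/funext => k; rewrite ip_sub//=; ring.
Qed.

(** Turns closure under [L^2] limits into closure under almost everywhere equality. *)
Lemma L2cvg_cst_ae f g : f \in Lfun m 2%:E -> g \in Lfun m 2%:E ->
  f = g %[ae m] -> L2cvg m (fun=> f) g.
Proof.
move=> f2 g2 fg; apply/L2cvgP => //; rewrite (_ : (fun=> _) = cst 0); first exact: cvg_cst.
apply/funext => k; rewrite ip_sub//=.
by rewrite (ip_ae f2 f2 g2 g2)// (ip_ae f2 g2 g2 g2)//; [ring|exact: nearW].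
Qed.

Lemma L2cvg_le u f (e : nat -> R) : (forall k, u k \in Lfun m 2%:E) ->
  f \in Lfun m 2%:E -> (forall k, ip (u k \- f) (u k \- f) <= e k) ->
  e k @[k --> \oo] --> 0 -> L2cvg m u f.
Proof.
move=> u2 f2 ue e0; apply/L2cvgP => //.
apply: (squeeze_cvgr _ (cvg_cst 0) e0).
by near=> k; rewrite ip_ge0/= ue.
Unshelve. all: by end_near. Qed.

Lemma L2cvg_lin (a : R) u v f g : (forall k, u k \in Lfun m 2%:E) ->
  (forall k, v k \in Lfun m 2%:E) -> f \in Lfun m 2%:E -> g \in Lfun m 2%:E ->
  L2cvg m u f -> L2cvg m v g ->
  L2cvg m (fun k => a \*: u k \+ v k) (a \*: f \+ g).
Proof.
move=> u2 v2 f2 g2 /(L2cvgP u2 f2) uf /(L2cvgP v2 g2) vg.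
have d2 k : u k \- f \in Lfun m 2%:E by apply: L2B.
have d2' k : v k \- g \in Lfun m 2%:E by apply: L2B.
apply: (@L2cvg_le _ _ (fun k => 2 * (a ^+ 2 * ip (u k \- f) (u k \- f) +
   ip (v k \- g) (v k \- g)))); first by move=> k; exact: L2_lin.
- exact: L2_lin.
- move=> k; rewrite (_ : _ \- _ = (a \*: (u k \- f)) \+ (v k \- g)); last first.
    by apply/funext => x /=; rewrite /GRing.scale/=; ring.
  apply: (le_trans (ip_add_le _ _)) => //; first exact: L2Z.
  rewrite (_ : ip (a \*: _) _ = a ^+ 2 * ip (u k \- f) (u k \- f))//.
  rewrite (_ : a \*: _ = a \*: (u k \- f) \+ cst 0); last first.
    by apply/funext => x /=; rewrite addr0.
  rewrite ip_linl ?ip_linr ?L2_lin ?L2_cst0//.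
  by rewrite ![ip _ (cst 0)]ipC !ip0l; ring.
- rewrite (_ : 0 = 2 * (a ^+ 2 * 0 + 0)); last by ring.
  by apply: cvgMr; apply: cvgD => //; apply: cvgMr.
Qed.

Lemma L2cvgD u v f g : (forall k, u k \in Lfun m 2%:E) ->
  (forall k, v k \in Lfun m 2%:E) -> f \in Lfun m 2%:E -> g \in Lfun m 2%:E ->
  L2cvg m u f -> L2cvg m v g -> L2cvg m (fun k => u k \+ v k) (f \+ g).
Proof.
move=> u2 v2 f2 g2 uf vg; have := L2cvg_lin 1 u2 v2 f2 g2 uf vg.
rewrite (_ : 1 \*: f \+ g = f \+ g); last by apply/funext => x /=; rewrite scale1r.
rewrite (_ : (fun k => 1 \*: u k \+ v k) = fun k => u k \+ v k)//.
by apply/funext => k; apply/funext => x /=; rewrite scale1r.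
Qed.

Lemma L2cvgB u v f g : (forall k, u k \in Lfun m 2%:E) ->
  (forall k, v k \in Lfun m 2%:E) -> f \in Lfun m 2%:E -> g \in Lfun m 2%:E ->
  L2cvg m u f -> L2cvg m v g -> L2cvg m (fun k => u k \- v k) (f \- g).
Proof.
move=> u2 v2 f2 g2 uf vg; have := L2cvg_lin (-1) v2 u2 g2 f2 vg uf.
rewrite (_ : -1 \*: g \+ f = f \- g); last first.
  by apply/funext => x /=; rewrite scaleN1r addrC.
rewrite (_ : (fun k => -1 \*: v k \+ u k) = fun k => u k \- v k)//.
by apply/funext => k; apply/funext => x /=; rewrite scaleN1r addrC.
Qed.

Lemma L2_sum (J : Type) (s : seq J) (Q : pred J) (f : J -> X -> R) :
  (forall j, Q j -> f j \in Lfun m 2%:E) ->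
  (fun x => \sum_(j <- s | Q j) f j x) \in Lfun m 2%:E.
Proof.
move=> f2; elim: s => [|j s IH].
  rewrite (_ : (fun _ => _) = cst 0); first exact: L2_cst0.
  by apply/funext => x; rewrite big_nil.
have [Qj|Qj] := boolP (Q j).
  rewrite (_ : (fun _ => _) = f j \+ (fun x => \sum_(j <- s | Q j) f j x)).
    by apply: L2D => //; exact: f2.
  by apply/funext => x; rewrite big_cons Qj.
rewrite (_ : (fun _ => _) = (fun x => \sum_(j <- s | Q j) f j x))//.
by apply/funext => x; rewrite big_cons (negbTE Qj).
Qed.

Lemma ip_suml (J : Type) (s : seq J) (Q : pred J) (f : J -> X -> R) g :
  (forall j, Q j -> f j \in Lfun m 2%:E) -> g \in Lfun m 2%:E ->
  ip (fun x => \sum_(j <- s | Q j) f j x) g = \sum_(j <- s | Q j) ip (f j) g.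
Proof.
move=> f2 g2; elim: s => [|j s IH].
  rewrite big_nil (_ : (fun _ => _) = cst 0) ?ip0l//.
  by apply/funext => x; rewrite big_nil.
rewrite big_cons -IH; have [Qj|Qj] := boolP (Q j); last first.
  by congr ip; apply/funext => x; rewrite big_cons (negbTE Qj).
rewrite -ipDl//; [|exact: f2|exact: L2_sum].
by congr ip; apply/funext => x; rewrite big_cons Qj.
Qed.

Lemma ip_sumr (J : Type) (s : seq J) (Q : pred J) (f : J -> X -> R) g :
  (forall j, Q j -> f j \in Lfun m 2%:E) -> g \in Lfun m 2%:E ->
  ip g (fun x => \sum_(j <- s | Q j) f j x) = \sum_(j <- s | Q j) ip g (f j).
Proof.
move=> f2 g2; rewrite ipC ip_suml//; apply: eq_bigr => j _; exact: ipC.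
Qed.

End L2_inner_product.

(** * Almost everywhere convergence and completeness of [L^2] *)

Section L2_convergence.
Context d (X : measurableType d) (R : realType)
  (m : {measure set X -> \bar R}).
Implicit Types (f g h : X -> R) (u v : nat -> X -> R).

Lemma ip_cvg0 u v (l : R) : (forall k, u k \in Lfun m 2%:E) ->
  (forall k, v k \in Lfun m 2%:E) ->
  ip m (u k) (u k) @[k --> \oo] --> 0 -> ip m (v k) (v k) @[k --> \oo] --> l ->
  ip m (u k) (v k) @[k --> \oo] --> 0.
Proof.
move=> u2 v2 u0 vl; apply: norm_cvg0.
have h : Num.sqrt (ip m (u k) (u k) * ip m (v k) (v k)) @[k --> \oo] --> 0.
  rewrite -(sqrtr0 R) -(mul0r l).
  apply: continuous_cvg; first exact: sqrt_continuous.
  exact: cvgM.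
apply: (squeeze_cvgr _ (cvg_cst 0) h).
near=> k; rewrite normr_ge0/= -sqrtr_sqr ler_wsqrtr//.
exact: cauchy_schwarz.
Unshelve. all: by end_near. Qed.

Lemma L2cvg_ip u v f g : (forall k, u k \in Lfun m 2%:E) ->
  (forall k, v k \in Lfun m 2%:E) -> f \in Lfun m 2%:E -> g \in Lfun m 2%:E ->
  L2cvg m u f -> L2cvg m v g ->
  ip m (u k) (v k) @[k --> \oo] --> ip m f g.
Proof.
move=> u2 v2 f2 g2 /(L2cvgP u2 f2) uf /(L2cvgP v2 g2) vg.
have d2 k : u k \- f \in Lfun m 2%:E by apply: L2B.
have d2' k : v k \- g \in Lfun m 2%:E by apply: L2B.
rewrite (_ : (fun k => _) = (fun k => (ip m (u k \- f) (v k \- g) +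
    ip m (u k \- f) g) + (ip m (v k \- g) f + ip m f g))); last first.
  apply/funext => k; rewrite ipBl// !ipBr// !ipBl// (ipC m (v k) f) (ipC m g f).
  ring.
rewrite -[X in _ --> X]add0r; apply: cvgD.
  rewrite -(addr0 0); apply: cvgD; first exact: ip_cvg0 uf vg.
  by apply: ip_cvg0 uf (cvg_cst (ip m g g)).
rewrite -[X in _ --> X]add0r; apply: cvgD; last exact: cvg_cst.
by apply: ip_cvg0 vg (cvg_cst (ip m f f)).
Unshelve. all: by [].
Qed.

(** By monotone convergence the sum of the series is integrable, hence finite almost everywhere, and
    its terms tend to 0. This extracts almost everywhere convergence from summable errors. *)
Lemma summable_integral_ae_cvg0 (g : nat -> X -> R) :
  (forall j, measurable_fun setT (g j)) -> (forall j x, 0 <= g j x) ->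
  (\sum_(0 <= j <oo) \int[m]_x (g j x)%:E < +oo)%E ->
  {ae m, forall x, g j x @[j --> \oo] --> 0}.
Proof.
move=> mg g0 goo.
have mE j : measurable_fun setT (EFin \o g j) by exact/measurable_EFinP.
have E : (\int[m]_x (\sum_(0 <= j <oo) (g j x)%:E) =
    \sum_(0 <= j <oo) \int[m]_x (g j x)%:E)%E.
  by apply: (integral_nneseries _ measurableT (f := fun j x => (g j x)%:E))
    => // n x _; rewrite lee_fin.
have S0 x : (0 <= \sum_(0 <= j <oo) (g j x)%:E)%E.
  by apply: nneseries_ge0 => // n _ _; rewrite lee_fin.
have : m.-integrable setT (fun x => \sum_(0 <= j <oo) (g j x)%:E)%E.
  apply/integrableP; split.
    have h0 k x : setT x -> predT k -> (0 <= (g k x)%:E)%E by rewrite lee_fin.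
    exact: (ge0_emeasurable_sum h0 (fun k _ => mE k)).
  by under eq_integral => x _ do rewrite gee0_abs//; rewrite E.
move/(integrable_ae measurableT); apply: filterS => x /(_ I) xoo.
apply: cvg_series_cvg_0; apply: nnseries_is_cvg => //.
by rewrite ltey_eq xoo.
Qed.

Lemma cvg_summable_increments (w : nat -> R) (K : nat) :
  (forall j, (K <= j)%N -> `|w j.+1 - w j| <= 2^-1 ^+ j) -> cvgn w.
Proof.
move=> wK.
(* The geometric tail is written as a difference so that the induction on [n] closes: one more
   increment, at most [2^-(n+i)], is exactly what the right side gains. *)
have h i n : (K <= i)%N -> `|w (n + i)%N - w i| <= 2 * 2^-1 ^+ i - 2 * 2^-1 ^+ (n + i)%N.
  move=> Ki; elim: n => [|n IHn]; first by rewrite add0n !subrr normr0.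
  rewrite addSn -(subrKA (w (n + i)%N)) (le_trans (ler_normD _ _))//.
  have := wK (n + i)%N (leq_trans Ki (leq_addl _ _)).
  rewrite exprS; move: IHn; set a := `|_|; set b := `|_|; lra.
apply/cauchy_cvgP; apply: cauchy_exP => e e0.
have [M _ HM] : \forall j \near \oo, `|2^-1 ^+ j| < (e / 2 : R).
  have /cvgrPdist_lt /(_ (e/2)) : (2^-1 ^+ j : R) @[j --> \oo] --> 0.
    by apply: cvg_expr; rewrite ger0_norm// invf_lt1// ltr1n.
  by rewrite divr_gt0// => /(_ isT); apply: filterS => j; rewrite sub0r normrN.
exists (w (maxn K M)); exists (maxn K M) => // j /= Mj.
have [n ->] : exists n, j = (n + maxn K M)%N by exists (j - maxn K M)%N; rewrite subnK.
rewrite /ball/= distrC.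
apply: (le_lt_trans (h _ _ (leq_maxl _ _))).
have := HM (maxn K M) (leq_maxr _ _).
rewrite ger0_norm ?exprn_ge0//.
have : 0 <= 2^-1 ^+ (n + maxn K M) :> R by rewrite exprn_ge0.
by lra.
Qed.

Lemma limn_einf_le (a : nat -> \bar R) (e : \bar R) (K : nat) :
  (forall j, (K <= j)%N -> (a j <= e)%E) -> (limn_einf a <= e)%E.
Proof.
move=> aK; rewrite limn_einf_lim; apply: lime_le; first exact: is_cvg_einfs.
near=> n; apply: (@le_trans _ _ (a n)).
  by rewrite /einfs; apply: ereal_inf_lbound; exists n => /=.
by apply: aK; near: n; exact: nbhs_infty_ge.
Unshelve. all: by end_near. Qed.

(* The limit is an explicit function of a subsequence so that pointwise
   symmetries of the approximants are inherited exactly. *)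
Lemma L2_complete u : (forall k, u k \in Lfun m 2%:E) ->
  (forall e : R, 0 < e -> exists K, forall k l, (K <= k)%N -> (K <= l)%N ->
     ip m (u k \- u l) (u k \- u l) <= e) ->
  exists phi : nat -> nat,
    let f x := fine (limn_esup (fun j => (u (phi j) x)%:E)) in
    f \in Lfun m 2%:E /\ L2cvg m u f.
Proof.
move=> u2 uC.
have d2 k l : u k \- u l \in Lfun m 2%:E by apply: L2B.
(* The rate [8^-j] beats the weight [4^j] below: the weighted squared increments have integrals at
   most [2^-j], and a weighted square less than 1 means an increment less than [2^-j]. *)
have [Kf HK] : {Kf : nat -> nat & forall j k l, (Kf j <= k)%N -> (Kf j <= l)%N ->
    ip m (u k \- u l) (u k \- u l) <= 8^-1 ^+ j}.
  by apply: (@choice _ _ (fun j K => forall k l, (K <= k)%N -> (K <= l)%N ->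
    ip m (u k \- u l) (u k \- u l) <= 8^-1 ^+ j)) => j; apply: uC; rewrite exprn_gt0.
(* A running maximum, so that later indices also respect all earlier thresholds; [phi] may repeat
   values. *)
pose phi j := \max_(i < j.+1) Kf i.
have phiK i j : (i <= j)%N -> (Kf i <= phi j)%N.
  by move=> ij; apply: (@leq_bigmax _ (fun i : 'I_j.+1 => Kf i) (Ordinal (ij : i < j.+1)%N)).
exists phi => f.
have mf : measurable_fun setT f.
  apply: measurableT_comp; first exact: fine_measurable.
  apply: measurable_fun_limn_esup => n.
  by apply/measurable_EFinP; apply: L2_measurable (u2 _).
have aeD : {ae m, forall x, 4 ^+ j * (u (phi j.+1) x - u (phi j) x) ^+ 2 @[j --> \oo] --> 0}.
  apply: summable_integral_ae_cvg0.
  - move=> j; apply: measurable_funM => //; apply: measurable_funX.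
    exact: L2_measurable (d2 _ _).
  - by move=> j x; rewrite mulr_ge0 ?sqr_ge0 ?exprn_ge0.
  have le j : (\int[m]_x (4 ^+ j * (u (phi j.+1) x - u (phi j) x) ^+ 2)%:E <=
      (2 / (2 ^ (j + 1))%:R)%:E)%E.
    under eq_integral do rewrite EFinM.
    rewrite ge0_integralZl_EFin ?exprn_ge0//; last 2 first.
      - by move=> x _; rewrite lee_fin sqr_ge0.
      - apply/measurable_EFinP; apply: measurable_funX.
        exact: L2_measurable (d2 _ _).
    have := HK j (phi j.+1) (phi j) (phiK _ _ (leqnSn j)) (phiK _ _ (leqnn j)).
    move=> H; rewrite (_ : (\int[m]_x _)%E = (ip m (u (phi j.+1) \- u (phi j))
      (u (phi j.+1) \- u (phi j)))%:E); last by rewrite EFin_ip_sqr.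
    rewrite -EFinM lee_fin (le_trans (ler_wpM2l _ H)) ?exprn_ge0//.
    rewrite addn1 natrX exprS invfM mulrA divff// mul1r -exprVn -exprMn.
    rewrite le_eqVlt; apply/orP; left; apply/eqP; congr (_ ^+ j).
    by lra.
  apply: (@le_lt_trans _ _ (\sum_(0 <= j <oo) (2 / (2 ^ (j + 1))%:R)%:E)%E).
    apply: lee_nneseries => [j _ _|j _]; last exact: le.
    by apply: integral_ge0 => x _; rewrite lee_fin mulr_ge0 ?sqr_ge0 ?exprn_ge0.
  rewrite (cvg_lim _ (@cvg_geometric_eseries_half R 2 0))//.
  by rewrite ltry.
have aeC : {ae m, forall x, u (phi j) x @[j --> \oo] --> f x}.
  apply: filterS aeD => x x0.
  have [K _ HK2] : \forall j \near \oo, 4 ^+ j * (u (phi j.+1) x - u (phi j) x) ^+ 2 < 1.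
    move/cvgrPdist_lt : x0 => /(_ 1 ltr01); apply: filterS => j.
    by rewrite sub0r normrN; exact: le_lt_trans (ler_norm _).
  have /cvg_ex[/= l wl] : cvgn (fun j => u (phi j) x).
    apply: (@cvg_summable_increments _ K) => j /HK2.
    rewrite (_ : 4 = 2 ^+ 2); last by rewrite -natrX.
    rewrite -exprM mulnC exprM -exprMn -[X in _ < X](expr1n _ 2) => h.
    have : `|2 ^+ j * (u (phi j.+1) x - u (phi j) x)| ^+ 2 < 1 ^+ 2.
      by rewrite -normrX ger0_norm ?sqr_ge0.
    rewrite ltr_pXn2r ?nnegrE// normrM ger0_norm ?exprn_ge0// => h2.
    by rewrite exprVn -[leRHS]mul1r ler_pdivlMr ?exprn_gt0// mulrC ltW.
  have /cvg_EFinP wlE := wl.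
  by rewrite /f (cvg_limn_einf_sup wlE)/=.
(* Fatou along the subsequence: a bound on [u k \- u (phi j)] valid for large [j] passes to
   [u k \- f]. *)
have fat k (e : R) : (exists K, forall j, (K <= j)%N ->
    ip m (u k \- u (phi j)) (u k \- u (phi j)) <= e) ->
    (\int[m]_x ((u k \- f) x ^+ 2)%:E <= e%:E)%E.
  move=> [K HKe].
  have -> : (\int[m]_x ((u k \- f) x ^+ 2)%:E =
      \int[m]_x (limn_einf (fun j => ((u k \- u (phi j)) x ^+ 2)%:E)))%E.
    apply: ae_eq_integral => //.
    - apply/measurable_EFinP; apply: measurable_funX; apply: measurable_funB => //.
      exact: L2_measurable.
    - apply: measurableT_comp => //; apply: measurable_fun_limn_esup => j.
      apply: measurableT_comp => //; apply/measurable_EFinP.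
      apply: measurable_funX; exact: L2_measurable (d2 _ _).
    - apply: filterS aeC => x xf _ /=; apply/esym.
      have H : ((u k x - u (phi j) x) ^+ 2)%:E @[j --> \oo] --> ((u k x - f x) ^+ 2)%:E.
        apply/cvg_EFinP; rewrite expr2; under eq_fun do rewrite expr2.
        by apply: cvgM; (apply: cvgB; [exact: cvg_cst|exact: xf]).
      by rewrite (cvg_limn_einf_sup H).
  apply: le_trans (fatou _ measurableT _ _) _.
  - move=> j; apply/measurable_EFinP.
    apply: measurable_funX; exact: L2_measurable (d2 _ _).
  - by move=> j x _; rewrite lee_fin sqr_ge0.
  - by apply: (@limn_einf_le _ _ K) => j Kj; rewrite -EFin_ip_sqr ?lee_fin ?HKe.
have main e : 0 < e -> exists K, forall k, (K <= k)%N ->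
    (\int[m]_x ((u k \- f) x ^+ 2)%:E <= e%:E)%E.
  move=> e0; have [K0 HK0] := uC _ e0.
  have [i ie] : exists i, 8^-1 ^+ i < e :> R.
    have /cvgrPdist_lt /(_ e e0) [i _ Hi] : (8^-1 ^+ j : R) @[j --> \oo] --> 0.
      by apply: cvg_expr; rewrite ger0_norm// invf_lt1// ltr1n.
    exists i; have := Hi i (leqnn i); rewrite sub0r normrN.
    exact: le_lt_trans (ler_norm _).
  exists (Kf i) => k ik; apply: fat; exists i => j ij.
  apply: le_trans (ltW ie); apply: HK => //; exact: phiK.
(* Membership of [f] in [L^2] comes from its finite distance to a single [u K]. *)
have f2 : f \in Lfun m 2%:E.
  have [K HK1] := main 1 ltr01.
  have d2f : u K \- f \in Lfun m 2%:E.
    apply/L2P; split; first by apply: measurable_funB => //; exact: L2_measurable.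
    exact: le_lt_trans (HK1 K (leqnn K)) (ltry _).
  rewrite (_ : f = u K \- (u K \- f)); first exact: L2B.
  by apply/funext => x /=; rewrite opprB addrC subrK.
split=> //; apply/L2cvgP => //; apply/cvgrPdist_le => e e0.
have [K HKe] := main e e0; exists K => // k /= /HKe.
rewrite -EFin_ip_sqr ?lee_fin; last exact: L2B.
by rewrite sub0r normrN ger0_norm// ip_ge0.
Qed.
End L2_convergence.

(** * Approximation in [L^2] by indicators of level sets *)

Section L2_indicators.
Context d (X : measurableType d) (R : realType)
  (m : {measure set X -> \bar R}).
Implicit Types (A B : set X) (f g : X -> R).

Lemma sqr_indic A x : \1_A x ^+ 2 = \1_A x :> R.
Proof. by rewrite indicE; case: (_ \in _); rewrite ?expr1n ?expr0n. Qed.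

Lemma L2_indic A : measurable A -> (m A < +oo)%E ->
  (\1_A : X -> R) \in Lfun m 2%:E.
Proof.
move=> mA Aoo; apply/L2P; split => //.
under eq_integral do rewrite sqr_indic.
by rewrite integral_indic// setIT.
Qed.

Lemma ip_indic A B : measurable A -> measurable B ->
  ip m \1_A \1_B = fine (m (A `&` B)).
Proof.
move=> mA mB; rewrite /ip /Rintegral.
under eq_integral => x _.
  rewrite -[_ * _]/((\1_A \* \1_B) x) -indicI; over.
by rewrite integral_indic ?setIT//; exact: measurableI.
Qed.

(** Chebyshev: on the level set [f ^ 2] is at least [a ^ 2]. *)
Lemma finite_level_set f (C : set R) (a : R) : f \in Lfun m 2%:E -> 0 < a ->
  measurable C -> (forall y, C y -> a <= `|y|) -> (m (f @^-1` C) < +oo)%E.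
Proof.
move=> f2 a0 mC Ca; have /L2P[mf foo] := f2.
have mfC : measurable (f @^-1` C) by rewrite -[X in measurable X]setTI; exact: mf.
have h : ((a ^+ 2)%:E * m (f @^-1` C) < +oo)%E.
  apply: le_lt_trans foo; rewrite -integral_cst//.
  apply: (@le_trans _ _ (\int[m]_(x in f @^-1` C) (f x ^+ 2)%:E)%E).
    apply: ge0_le_integral => //.
    - by move=> x _; rewrite lee_fin sqr_ge0.
    - apply/measurable_EFinP; apply: measurable_funX; exact: measurable_funTS.
    - move=> x /Ca; rewrite lee_fin -(real_normK (num_real (f x))) => h.
      by rewrite lerXn2r// nnegrE ltW.
  apply: ge0_subset_integral => //.
  - by apply/measurable_EFinP; apply: measurable_funX.
  - by move=> x _; rewrite lee_fin sqr_ge0.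
rewrite ltey; apply/eqP => E; move: h.
by rewrite E gt0_muley ?lte_fin ?exprn_gt0// ltxx.
Qed.

(* [staircase n y] rounds [y] towards 0 to a multiple of [1/n], capped at [n] *)
Definition staircase (n : nat) (y : R) : R :=
  n%:R^-1 * \sum_(1 <= j < (n ^ 2).+1)
    (\1_(`[j%:R / n%:R, +oo[) y - \1_(`]-oo, - (j%:R / n%:R)]) y).

(** The sum is the minimum of [M] and the integer part of [z]; these are the three bounds that
    rounding needs. *)
Lemma count_le (M : nat) (z : R) : 0 <= z ->
  [/\ \sum_(1 <= j < M.+1) (j%:R <= z)%R%:R <= z,
      \sum_(1 <= j < M.+1) (j%:R <= z)%R%:R <= M%:R :> R &
      z <= M%:R -> z - 1 <= \sum_(1 <= j < M.+1) (j%:R <= z)%R%:R].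
Proof.
move=> z0; elim: M => [|M [h1 h2 h3]].
  by rewrite big_geq//; split => // h; lra.
have hM : (M%:R <= z) -> \sum_(1 <= j < M.+1) (j%:R <= z)%R%:R = M%:R :> R.
  move=> Mz; rewrite big_nat (eq_bigr (fun=> 1)) -?big_nat; last first.
    move=> j /andP[_ jM]; rewrite (_ : j%:R <= z)//.
    by apply: le_trans Mz; rewrite ler_nat -ltnS.
  by rewrite sumr_const_nat subn1.
have SM : M.+1%:R = M%:R + 1 :> R by rewrite -natr1.
rewrite big_nat_recr//= SM; have [h|h] := boolP (M%:R + 1 <= z) => /=.
  by rewrite hM; [split; lra|lra].
rewrite -ltNge in h; rewrite addr0; split => //; first lra.
move=> _; have [Mz|Mz] := leP z M%:R; first exact: h3.
by rewrite hM ?ltW//; lra.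
Qed.

(** For [y >= 0] only the positive half-lines contribute, and the sum is the count of [count_le]
    with [z = n y] and [M = n ^ 2]; that cap is reached beyond [y = n]. *)
Lemma staircase_pos n y : (0 < n)%N -> 0 <= y ->
  [/\ 0 <= staircase n y, staircase n y <= y &
      y <= n%:R -> y - n%:R^-1 <= staircase n y].
Proof.
move=> n0 y0; have nR : 0 < n%:R :> R by rewrite ltr0n.
have -> : staircase n y = n%:R^-1 * \sum_(1 <= j < (n ^ 2).+1) (j%:R <= n%:R * y)%R%:R.
  congr (_ * _); apply: eq_big_nat => j /andP[j1 _].
  rewrite !indicE !mem_setE !in_itv/= andbT ler_pdivrMr// (mulrC y).
  rewrite [X in _ - X](_ : _ = 0) ?subr0//.
  rewrite (_ : (y <= _) = false)//; apply/negbTE; rewrite -ltNge.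
  by apply: lt_le_trans y0; rewrite oppr_lt0 divr_gt0// ltr0n.
have [h1 h2 h3] := count_le (n ^ 2) (mulr_ge0 (ltW nR) y0).
split.
- by apply: mulr_ge0; [rewrite invr_ge0 ltW|exact: sumr_ge0].
- by rewrite ler_pdivrMl.
- move=> yn; rewrite ler_pdivlMl// mulrBr mulfV ?gt_eqF//; apply: h3.
  by rewrite natrX expr2 ler_pM2l.
Qed.

Lemma staircaseN n y : staircase n (- y) = - staircase n y.
Proof.
rewrite /staircase -mulrN -sumrN; congr (_ * _); apply: eq_bigr => j _.
rewrite !indicE !mem_setE !in_itv/= !andbT opprB.
by rewrite lerNr lerN2.
Qed.

Lemma staircase_dist n y : (0 < n)%N -> `|staircase n y - y| <= `|y|.
Proof.
move=> n0; have [y0|y0] := leP 0 y.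
  have [h1 h2 _] := staircase_pos n0 y0.
  by rewrite distrC !ger0_norm ?subr_ge0// lerBlDl lerDr.
have y1 : 0 <= - y by lra.
have [] := staircase_pos n0 y1; rewrite staircaseN => h1 h2 _.
by rewrite (ltr0_norm y0) ger0_norm; lra.
Qed.

Lemma staircase_near n y : (0 < n)%N -> `|y| <= n%:R ->
  `|staircase n y - y| <= n%:R^-1.
Proof.
move=> n0; have [y0|y0] := leP 0 y.
  have [h1 h2 h3] := staircase_pos n0 y0.
  rewrite ger0_norm// => /h3.
  by rewrite distrC ger0_norm ?subr_ge0//; lra.
have y1 : 0 <= - y by lra.
have [] := staircase_pos n0 y1; rewrite staircaseN => h1 h2 h3.
rewrite ltr0_norm// => /h3 h4.
by rewrite ger0_norm; lra.
Qed.

(** [staircase n \o f] is a linear combination of indicators of preimages under [f] itself, so these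
    sets inherit whatever measurability [f] has. The half-lines involved stay away from 0, so the
    sets have finite measure by Chebyshev, and only sets [C] avoiding 0 are asked for. *)
Lemma L2_indicator_induction (W : (X -> R) -> Prop) f :
  (forall a g h, g \in Lfun m 2%:E -> h \in Lfun m 2%:E -> W g -> W h ->
    W (a \*: g \+ h)) ->
  (forall (u : nat -> X -> R) g, (forall k, u k \in Lfun m 2%:E) ->
    g \in Lfun m 2%:E -> (forall k, W (u k)) -> L2cvg m u g -> W g) ->
  f \in Lfun m 2%:E ->
  (forall C : set R, measurable C -> ~ C 0 -> (m (f @^-1` C) < +oo)%E ->
    W (\1_(f @^-1` C))) ->
  W f.
Proof.
move=> Wlin Wcvg f2 Wind; have /L2P[mf foo] := f2.
(* The empty set provides the zero function, from which sums are built. *)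
have W0 : W (cst 0).
  have := Wind set0 measurable0 (fun h => h).
  by rewrite preimage_set0 measure0 indic0; apply.
have m0 : (\1_(set0 : set X) : X -> R) \in Lfun m 2%:E.
  by apply: L2_indic => //; rewrite measure0.
have Wst n : (0 < n)%N -> (staircase n \o f) \in Lfun m 2%:E /\ W (staircase n \o f).
  move=> n0; have nR : 0 < n%:R :> R by rewrite ltr0n.
  pose s := index_iota 1 (n ^ 2).+1.
  pose g (s : seq nat) x : R := \sum_(j <- s)
    (\1_(`[j%:R / n%:R, +oo[) (f x) - \1_(`]-oo, - (j%:R / n%:R)]) (f x)).
  have lev (C : set R) a : 0 < a -> measurable C -> (forall y, C y -> a <= `|y|) ->
     (\1_(f @^-1` C) : X -> R) \in Lfun m 2%:E /\ W \1_(f @^-1` C).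
    move=> a0 mC Ca; have Coo := finite_level_set f2 a0 mC Ca; split.
      by apply: L2_indic => //; rewrite -[X in measurable X]setTI; exact: mf.
    by apply: Wind => // /Ca; rewrite normr0 leNgt a0.
  have gP t : all (leq 1) t -> g t \in Lfun m 2%:E /\ W (g t).
    elim: t => [_|j t IH /= /andP[j0 /IH[gt2 Wt]]].
      rewrite (_ : g [::] = cst 0); first by split => //; exact: L2_cst0.
      by apply/funext => x; rewrite /g big_nil.
    have jn : 0 < j%:R / n%:R :> R by rewrite divr_gt0// ltr0n.
    have posC (y : R) : `[j%:R / n%:R, +oo[%classic y -> j%:R / n%:R <= `|y|.
      rewrite /= in_itv/= andbT => h; exact: le_trans h (ler_norm _).
    have negC (y : R) : `]-oo, - (j%:R / n%:R)]%classic y -> j%:R / n%:R <= `|y|.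
      rewrite /= in_itv/= lerNr => h; apply: le_trans h _.
      by rewrite -normrN ler_norm.
    have [A2 WA] := lev _ _ jn (measurable_itv _) posC.
    have [B2 WB] := lev _ _ jn (measurable_itv _) negC.
    rewrite (_ : g (j :: t) = 1 \*: \1_(f @^-1` `[(j%:R / n%:R), +oo[%classic) \+
      ((-1) \*: \1_(f @^-1` `]-oo, (- (j%:R / n%:R))]%classic) \+ g t)).
      by split; [apply: L2_lin => //; exact: L2_lin|
        apply: (Wlin) => //; [exact: L2_lin|exact: (Wlin)]].
    apply/funext => x; rewrite /g big_cons /= scale1r scaleN1r addrA.
    by congr (_ - _ + _); rewrite !indicE.
  have [g2 Wg] : g s \in Lfun m 2%:E /\ W (g s).
    by apply: gP; apply/allP => j; rewrite /s mem_index_iota => /andP[].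
  rewrite (_ : staircase n \o f = n%:R^-1 \*: g s \+ cst 0).
    by split; [apply: L2_lin => //; exact: L2_cst0|apply: (Wlin) => //; exact: L2_cst0].
  by apply/funext => x; rewrite /= addr0.
apply: (Wcvg (fun n => staircase n.+1 \o f)) => //; try by move=> k; apply Wst.
apply/L2cvgP => //; first by move=> k; apply Wst.
have d2 k : (staircase k.+1 \o f) \- f \in Lfun m 2%:E.
  by apply: L2B => //; apply Wst.
apply/cvg_EFinP; under eq_fun do rewrite EFin_ip_sqr//.
rewrite (_ : 0%:E = (\int[m]_x (cst 0%E x))%E); last by rewrite integral0.
(* The squared error is dominated by [f ^ 2] because rounding towards 0 moves [f x] by at most its
   absolute value. *)
apply: (@dominated_cvg _ _ _ _ _ measurableT _ _ (fun x => (f x ^+ 2)%:E)) => //.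
- move=> n; apply/measurable_EFinP/measurable_funX; exact: L2_measurable (d2 _).
- move=> x _; apply/cvg_EFinP; rewrite -(mulr0 0); under eq_fun do rewrite expr2.
  suff h : staircase n.+1 (f x) - f x @[n --> \oo] --> 0 by exact: cvgM.
  apply: norm_cvg0; apply: (squeeze_cvgr _ (cvg_cst 0) (@cvg_harmonic R)).
  near=> n; rewrite normr_ge0/=; apply: staircase_near => //.
  rewrite (@le_trans _ _ n%:R) ?ler_nat//.
  by near: n; exact: nbhs_infty_ger.
- exact: Lfun2_integrable_sqr.
- move=> n x _; rewrite lee_fin ger0_norm ?sqr_ge0// -[leLHS]real_normK ?num_real//.
  rewrite -[leRHS]real_normK ?num_real// lerXn2r ?nnegrE//.
  exact: staircase_dist.
Unshelve. all: by end_near. Qed.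
End L2_indicators.

Section probability_L2.
Context (R : realType) (dO : measure_display) (Omega : measurableType dO)
  (P : probability Omega R).

Lemma Rintegral_probability_cst (c : R) : \int[P]_w c = c.
Proof.
rewrite Rintegral_cst//.
by have := @probability_setT _ _ _ P; rewrite /= => ->; rewrite mulr1.
Qed.

Lemma L2_integrable (f : Omega -> R) : f \in Lfun P 2%:E ->
  P.-integrable setT (EFin \o f).
Proof.
move=> f2; apply/Lfun1_integrable; apply: Lfun_subset12 => //.
exact: fin_num_measure.
Qed.

End probability_L2.

(** * Independent Poisson variables *)

Section poisson_variables.
Context (R : realType) (dO : measure_display) (Omega : measurableType dO)
  (P : probability Omega R).
Implicit Types (Y : Omega -> \bar R) (psi : \bar R -> R) (m : R).

Definition pois m (k : nat) : R := m ^+ k / k`!%:R * expR (- m).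

Lemma pois_ge0 m k : 0 <= m -> 0 <= pois m k.
Proof. by move=> m0; rewrite mulr_ge0 ?expR_ge0// divr_ge0// exprn_ge0. Qed.

(** At rate 0 [poisson_prob] is a Dirac mass, so that case is separate; the formula survives because
    [0 ^ 0 = 1]. *)
Lemma poisson_prob1 m k : 0 <= m -> poisson_prob m 0 [set k] = (pois m k)%:E.
Proof.
rewrite /poisson_prob le_eqVlt => /predU1P[<-|m0]; last first.
  rewrite m0 esum_set1 ?lee_fin ?poisson_pmf_ge0//.
  by rewrite /poisson_pmf m0.
rewrite ltxx diracE /pois oppr0 expR0 mulr1.
case: k => [|k]; rewrite expr0n/= ?mul0r ?fact0 ?divr1.
  by rewrite mem_set.
by rewrite memNset.
Qed.

(** Read off from the total mass of the probability [poisson_prob m 0]. *)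
Lemma pois_sum m : 0 <= m -> (\sum_(0 <= k <oo) (pois m k)%:E = 1)%E.
Proof.
move=> m0; rewrite -(@probability_setT _ _ _ (poisson_prob m 0 : probability _ _)).
rewrite (_ : setT = \bigcup_k [set k]); last first.
  by apply/esym; rewrite -subTset => k _; exists k.
rewrite measure_semi_bigcup//=; last by move=> i j _ _ [x [/= -> ->]].
by apply: eq_eseriesr => k _; rewrite -poisson_prob1//.
Qed.

(** For [0 <= m] the masses at the naturals sum to 1, so they fix the law: all other values
    together, [+oo] included, have probability 0. *)
Definition poisson_law m Y := measurable_fun setT Y /\
  forall k : nat, P [set w | Y w = k%:R%:E] = (pois m k)%:E.

Section moments.
Variables (m : R) (Y : Omega -> \bar R).
Hypotheses (m0 : 0 <= m) (lawY : poisson_law m Y).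

Let ev k := [set w | Y w = k%:R%:E].

Let mev k : measurable (ev k).
Proof.
have [mY _] := lawY.
rewrite (_ : ev k = Y @^-1` [set k%:R%:E]); last by [].
by rewrite -[X in measurable X]setTI; apply: mY => //; exact: emeasurable_set1.
Qed.

Let tev : trivIset setT ev.
Proof.
move=> i j _ _ [w []]; rewrite /ev/= => -> [] /eqP.
by rewrite eqr_nat => /eqP.
Qed.

Let Pev : P (~` \bigcup_k ev k) = 0.
Proof.
have [_ pY] := lawY.
rewrite probability_setC; last exact: bigcup_measurable.
rewrite measure_semi_bigcup//; last exact: bigcup_measurable.
by rewrite (eq_eseriesr (fun k _ => pY k)) pois_sum// subee.
Qed.

Lemma integral_level_sets (h : Omega -> \bar R) : measurable_fun setT h ->
  (forall w, 0 <= h w)%E ->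
  (\int[P]_w h w = \sum_(0 <= k <oo) \int[P]_(w in [set w | Y w = k%:R%:E]) h w)%E.
Proof.
move=> mh h0; rewrite -ge0_integral_bigcup//; last first.
  exact: measurable_funTS.
rewrite (@ge0_negligible_integral _ _ _ P setT (~` \bigcup_k ev k))//.
  by rewrite setTD setCK.
by apply: measurableC; exact: bigcup_measurable.
Qed.

Lemma poisson_natural : {ae P, forall w, exists k : nat, Y w = k%:R%:E}.
Proof.
exists (~` \bigcup_k ev k); split => //.
  by apply: measurableC; exact: bigcup_measurable.
by move=> w /= h [k _ kw]; apply: h; exists k.
Qed.

Lemma poisson_integral psi : measurable_fun setT psi -> (forall y, 0 <= psi y) ->
  (\int[P]_w (psi (Y w))%:E = \sum_(0 <= k <oo) (psi k%:R%:E * pois m k)%:E)%E.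
Proof.
move=> mpsi psi0; have [mY pY] := lawY.
rewrite integral_level_sets; last 2 first.
- by apply/measurable_EFinP; apply: measurableT_comp.
- by move=> w; rewrite lee_fin.
apply: eq_eseriesr => k _.
rewrite (eq_integral (fun=> (psi k%:R%:E)%:E)); last first.
  by move=> w; rewrite inE/= => ->.
rewrite integral_cst; last exact: mev.
by rewrite EFinM; congr (_ * _)%E; exact: pY.
Qed.

Lemma nneseries_shift (a : nat -> R) : (forall k, 0 <= a k) -> a 0%N = 0 ->
  (\sum_(0 <= k <oo) (a k)%:E = \sum_(0 <= k <oo) (a k.+1)%:E)%E.
Proof.
move=> a0 a00; rewrite nneseries_recl//; last by move=> k _; rewrite lee_fin.
rewrite a00 add0e -(@nneseries_addn _ (fun k => (a k)%:E) 1).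
  by under eq_eseriesr => k _ do rewrite addn1.
by move=> k; rewrite lee_fin.
Qed.

(** Turns a factor [k] in a moment series into the constant [m] and a shift of the index; both
    moments follow from it. *)
Lemma poisS k : k.+1%:R * pois m k.+1 = m * pois m k.
Proof.
rewrite /pois exprS factS natrM.
have f0 : k`!%:R != 0 :> R by rewrite pnatr_eq0 -lt0n fact_gt0.
have k0 : k.+1%:R != 0 :> R by rewrite pnatr_eq0.
by rewrite -natr1 in k0 *; field; rewrite f0 k0.
Qed.

(** The absolute value changes [fine (Y w)] only on the null set where [Y] is not a natural number;
    it makes the integrand nonnegative, as [poisson_integral] demands. *)
Lemma poisson_moment1 : (\int[P]_w `|fine (Y w)|%:E = m%:E)%E.
Proof.
rewrite (poisson_integral (psi := fun y => `|fine y|))//; last first.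
  by apply: measurableT_comp => //; exact: fine_measurable.
rewrite nneseries_shift; last 2 first.
- by move=> k; rewrite mulr_ge0// pois_ge0.
- by rewrite /= normr0 mul0r.
under eq_eseriesr => k _ do rewrite /= ger0_norm// poisS EFinM.
rewrite nneseriesZl; last by move=> k _; rewrite lee_fin pois_ge0.
by rewrite pois_sum// mule1.
Qed.

Lemma poisson_moment2 : (\int[P]_w (fine (Y w) ^+ 2)%:E = (m * (m + 1))%:E)%E.
Proof.
have h1 : (\sum_(0 <= k <oo) (k%:R * pois m k)%:E = m%:E)%E.
  rewrite -poisson_moment1 (poisson_integral (psi := fun y => `|fine y|))//; last first.
    by apply: measurableT_comp => //; exact: fine_measurable.
  by under [RHS]eq_eseriesr => k _ do rewrite /= ger0_norm//.
rewrite (poisson_integral (psi := fun y => fine y ^+ 2)); last 2 first.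
- by apply: measurable_funX; exact: fine_measurable.
- by move=> y; exact: sqr_ge0.
rewrite nneseries_shift; last 2 first.
- by move=> k; rewrite mulr_ge0 ?sqr_ge0// pois_ge0.
- by rewrite /= expr0n mul0r.
under eq_eseriesr => k _.
  rewrite /= expr2 -mulrA poisS mulrCA -natr1 mulrDl mul1r EFinM EFinD; over.
rewrite nneseriesZl; last first.
  move=> k _; rewrite -EFinD lee_fin; apply: addr_ge0; last exact: pois_ge0.
  by apply: mulr_ge0 => //; exact: pois_ge0.
rewrite nneseriesD; last 2 first.
- by move=> k _; rewrite lee_fin mulr_ge0 ?pois_ge0//.
- by move=> k _; rewrite lee_fin pois_ge0.
by rewrite h1 pois_sum.
Qed.

Let mfY : measurable_fun setT (fine \o Y).
Proof.
by apply: measurableT_comp; [exact: fine_measurable|case: lawY].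
Qed.

Lemma poisson_L2 : fine \o Y \in Lfun P 2%:E.
Proof. by apply/L2P; split => //; rewrite poisson_moment2 ltry. Qed.

Lemma poisson_mean : \int[P]_w fine (Y w) = m.
Proof.
rewrite /Rintegral -[RHS]/(fine m%:E) -poisson_moment1; congr fine.
apply: ae_eq_integral => //.
- exact/measurable_EFinP.
- by apply/measurable_EFinP; apply: measurableT_comp.
- by apply: filterS poisson_natural => w [k ->] _ /=; rewrite ger0_norm.
Qed.

Lemma poisson_void : P [set w | Y w = 0%E] = (expR (- m))%:E.
Proof.
have [_ /(_ 0%N)] := lawY.
by rewrite /pois expr0 fact0 divr1 mul1r.
Qed.

End moments.
End poisson_variables.

Section independent_poisson.
Context (R : realType) (dO : measure_display) (Omega : measurableType dO)
  (P : probability Omega R).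
Context (I : finType) (Y : I -> Omega -> \bar R) (m : I -> R).
Hypotheses (m0 : forall i, 0 <= m i) (lawY : forall i, poisson_law P (m i) (Y i)).
Hypothesis indepY : forall C : I -> set (\bar R), (forall i, measurable (C i)) ->
  P [set w | forall i, C i (Y i w)] = (\prod_i P [set w | C i (Y i w)])%E.
Implicit Types psi : I -> \bar R -> R.

Let mY i : measurable_fun setT (Y i). Proof. by case: (lawY i). Qed.

Let mpY psi i : measurable_fun setT (psi i) ->
  measurable_fun setT (fun w => psi i (Y i w)).
Proof. by move=> ?; apply: measurableT_comp. Qed.

Let mprod psi : (forall i, measurable_fun setT (psi i)) ->
  measurable_fun setT (fun w => \prod_i psi i (Y i w)).
Proof.
by move=> mpsi; apply: measurable_prod => i _; exact: mpY.
Qed.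

(** Induction on the list of indices whose factor is not yet an indicator. With indicators only,
    this is [indepY]. Otherwise split by the value [k] of [Y x]: on that event [psi x (Y x)] is a
    constant and the factor becomes the indicator of [k], to which the induction hypothesis applies;
    summing over [k] rebuilds the integral of [psi x]. *)
Lemma indep_integral_ge0 psi : (forall i, measurable_fun setT (psi i)) ->
  (forall i y, 0 <= psi i y) ->
  (forall i, \int[P]_w (psi i (Y i w))%:E < +oo)%E ->
  (\int[P]_w (\prod_i psi i (Y i w))%:E = (\prod_i \int[P]_w psi i (Y i w))%:E)%E.
Proof.
move=> mpsi psi0 psioo.
(* Vacuous for the full enumeration; the induction shortens the list. *)
have : forall i, i \notin enum I ->
  exists2 C : set (\bar R), measurable C & psi i = \1_C.
  by move=> i; rewrite mem_enum.
elim: (enum I) psi mpsi psi0 psioo => [|x s IH] psi mpsi psi0 psioo psiC.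
  have [C HC] : {C : I -> set (\bar R) & forall i, measurable (C i) /\ psi i = \1_(C i)}.
    apply: (@choice _ _ (fun i C => measurable C /\ psi i = \1_C)) => i.
    by have [//|C mC CE] := psiC i; exists C.
  have mYC i : measurable (Y i @^-1` C i).
    by rewrite -[X in measurable X]setTI; apply: mY => //; case: (HC i).
  have mA : measurable [set w | forall i, C i (Y i w)].
    rewrite (_ : mkset _ = \bigcap_(i in [set: I]) (Y i @^-1` C i)).
      by apply: fin_bigcap_measurable.
    by apply/seteqP; split => w /= h i => [_|]; exact: h.
  rewrite (eq_integral (fun w => (\1_[set w | forall i, C i (Y i w)] w)%:E)); last first.
    move=> w _; congr EFin; rewrite (eq_bigr (fun i => \1_(C i) (Y i w))); last first.
      by move=> i _; have [_ ->] := HC i.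
    rewrite indicE; have [/set_mem /= h|h] := boolP (_ \in _).
      by rewrite big1// => i _; rewrite indicE mem_set.
    move/negP : h => /=; rewrite in_setE /= => /existsNP[i hi].
    by rewrite (bigD1 i)//= indicE memNset// mul0r.
  rewrite integral_indic// setIT.
  transitivity (\prod_i P [set w | C i (Y i w)])%E.
    by apply: indepY => i; case: (HC i).
  rewrite (big_morph EFin EFinM erefl); apply: eq_bigr => i _.
  have [mCi ->] := HC i.
  rewrite /Rintegral (eq_integral (fun w => (\1_(Y i @^-1` C i) w)%:E))//.
  rewrite integral_indic// setIT fineK//; exact: fin_num_measure.
pose psik k i := if i == x then \1_[set k%:R%:E] else psi i : \bar R -> R.
have IHk (k : nat) : (\int[P]_w (\prod_i psik k i (Y i w))%:E =
    (\prod_i \int[P]_w psik k i (Y i w))%:E)%E.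
  apply: IH.
  - by move=> i; rewrite /psik; case: ifPn.
  - by move=> i y; rewrite /psik; case: ifPn.
  - move=> i; rewrite /psik; case: ifPn => // _.
    apply: (@le_lt_trans _ _ (\int[P]_w (cst 1 w))%E).
      apply: ge0_le_integral => //.
      + by apply/measurable_EFinP/measurableT_comp.
      + by move=> w _; rewrite lee_fin indicE; case: (_ \in _).
    rewrite integral_cst// mul1e.
    exact: le_lt_trans (probability_le1 P measurableT) (ltry _).
  - move=> i si; rewrite /psik; case: ifPn => [_|ix].
      by exists [set k%:R%:E] => //; exact: emeasurable_set1.
    by apply: psiC; rewrite in_cons negb_or ix.
have psikx k : psik k x = \1_[set k%:R%:E] by rewrite /psik eqxx.
have psikn k i : i != x -> psik k i = psi i by rewrite /psik => /negbTE ->.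
have [_ pY] := lawY x.
rewrite (integral_level_sets (m0 x) (lawY x)); last 2 first.
- by apply/measurable_EFinP; exact: mprod.
- by move=> w; rewrite lee_fin prodr_ge0.
pose r := \prod_(i | i != x) \int[P]_w psi i (Y i w).
have r0 : 0 <= r by apply: prodr_ge0 => i _; exact: Rintegral_ge0.
transitivity (\sum_(0 <= k <oo) (r%:E * (psi x k%:R%:E * pois (m x) k)%:E))%E.
  apply: eq_eseriesr => k _.
  rewrite integral_mkcond.
  rewrite (eq_integral
    (fun w => (psi x k%:R%:E)%:E * (\prod_i psik k i (Y i w))%:E)%E); last first.
    move=> w _; rewrite patchE -EFinM; case: ifPn => [/set_mem/= Yw|].
      congr EFin; rewrite (bigD1 x)//= [in RHS](bigD1 x)//= psikx.
      rewrite indicE Yw mem_set// mul1r; congr (_ * _).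
      by apply: eq_bigr => i ix; rewrite psikn.
    move/negP; rewrite in_setE/= => Yw.
    by rewrite (bigD1 x)//= psikx indicE memNset// mul0r mulr0.
  rewrite ge0_integralZl_EFin//; last 2 first.
    - by move=> w _; rewrite lee_fin; apply: prodr_ge0 => i _; rewrite /psik; case: ifPn.
    - apply/measurable_EFinP; apply: (@mprod (psik k)) => i; by rewrite /psik; case: ifPn.
  rewrite IHk -!EFinM (bigD1 x)//= -/r; congr EFin.
  rewrite [in LHS](_ : \prod_(i | i != x) _ = r); last first.
    by apply: eq_bigr => i ix; rewrite psikn.
  rewrite psikx mulrA mulrC; congr (_ * (_ * _)).
  rewrite /Rintegral (eq_integral (fun w => (\1_(Y x @^-1` [set k%:R%:E]) w)%:E))//.
  rewrite integral_indic//; last first.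
    by rewrite -[X in measurable X]setTI; apply: mY.
  by rewrite setIT -[RHS]/(fine (pois (m x) k)%:E) -pY.
rewrite nneseriesZl; last first.
  by move=> k _; rewrite lee_fin mulr_ge0// pois_ge0.
rewrite -(poisson_integral (m0 x) (lawY x))//.
rewrite (bigD1 x)//= -/r EFinM muleC; congr (_ * _)%E.
rewrite /Rintegral fineK// ge0_fin_numE//.
by apply: integral_ge0 => w _; rewrite lee_fin.
Qed.

(** Split each factor into positive and negative parts; distributivity turns the product into a
    signed sum, over all choices of parts, of products of nonnegative factors. *)
Lemma indep_integral psi : (forall i, measurable_fun setT (psi i)) ->
  (forall i, P.-integrable setT (fun w => (psi i (Y i w))%:E)) ->
  P.-integrable setT (fun w => (\prod_i psi i (Y i w))%:E) /\
  \int[P]_w \prod_i psi i (Y i w) = \prod_i \int[P]_w psi i (Y i w).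
Proof.
move=> mpsi ipsi.
pose part (b : bool) i y : R := if b then Num.max (psi i y) 0 else Num.max (- psi i y) 0.
pose sgn (b : bool) : R := if b then 1 else -1.
have psiE i y : psi i y = \sum_(b : bool) sgn b * part b i y.
  rewrite big_bool /sgn /part mul1r mulN1r !maxEle.
  by have [h|h] := leP (psi i y) 0; have [h'|h'] := leP (- psi i y) 0 => /=; lra.
have part0 b i y : 0 <= part b i y by rewrite /part; case: b; rewrite le_max lexx orbT.
have mpart b i : measurable_fun setT (part b i).
  by rewrite /part; case: b; apply: measurable_maxr => //; exact: measurableT_comp.
have ipart b i : P.-integrable setT (fun w => (part b i (Y i w))%:E).
  apply: (le_integrable measurableT _ _ (ipsi i)).
    by apply/measurable_EFinP/measurableT_comp.
  move=> w _ /=; rewrite lee_fin (ger0_norm (part0 _ _ _)) /part.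
  case: b; rewrite ge_max normr_ge0 andbT ?ler_norm//.
  by rewrite -normrN ler_norm.
have poo b i : (\int[P]_w (part b i (Y i w))%:E < +oo)%E.
  have /integrableP[_] := ipart b i.
  by under eq_integral do rewrite /= ger0_norm//.
have prodE w : \prod_i psi i (Y i w) =
    \sum_(f : {ffun I -> bool}) (\prod_i sgn (f i)) * \prod_i part (f i) i (Y i w).
  under eq_bigr do rewrite psiE.
  by rewrite bigA_distr_bigA; apply: eq_bigr => f _; rewrite big_split.
have iprod (f : {ffun I -> bool}) :
    P.-integrable setT (fun w => (\prod_i part (f i) i (Y i w))%:E).
  apply/integrableP; split.
    by apply/measurable_EFinP; exact: (@mprod (fun i => part (f i) i)).
  under eq_integral do rewrite /= ger0_norm ?prodr_ge0//.
  by rewrite (indep_integral_ge0 (psi := fun i => part (f i) i))// ltry.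
have iprod' (f : {ffun I -> bool}) : P.-integrable setT
    (fun w => ((\prod_i sgn (f i)) * \prod_i part (f i) i (Y i w))%:E).
  under eq_fun do rewrite EFinM.
  exact: integrableZl.
have EE i : \int[P]_w psi i (Y i w) =
    \sum_(b : bool) sgn b * \int[P]_w part b i (Y i w).
  rewrite /Rintegral; under eq_integral do rewrite psiE -sumEFin.
  rewrite integral_sum//; last first.
    move=> b; under eq_fun do rewrite EFinM.
    by apply: (integrableZl measurableT); exact: ipart.
  rewrite -sum_fine; last first.
    move=> b _; under eq_integral do rewrite EFinM.
    by rewrite integralZl// fin_numM//; exact: integrable_fin_num.
  apply: eq_bigr => b _; under eq_integral do rewrite EFinM.
  by rewrite integralZl// fineM//; exact: integrable_fin_num.
split.
  under eq_fun do rewrite prodE -sumEFin.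
  by apply: integrable_sum => // f _; exact: iprod'.
rewrite /Rintegral; under eq_integral do rewrite prodE -sumEFin.
rewrite integral_sum//.
under [RHS]eq_bigr do rewrite -/(Rintegral _ _ _) EE.
rewrite bigA_distr_bigA -sum_fine; last first.
  by move=> f _; exact: integrable_fin_num (iprod' f).
apply: eq_bigr => f _; under eq_integral do rewrite EFinM.
rewrite integralZl// (indep_integral_ge0 (psi := fun i => part (f i) i))//.
by rewrite -EFinM /= big_split.
Qed.

End independent_poisson.

Section power_measure_box.
Context d (T : measurableType d) (R : realType)
  (m : {sigma_finite_measure set T -> \bar R}).

Definition box n (A : 'I_n -> set T) : set (n.-tuple T) :=
  [set t | forall i, A i (tnth t i)].

Lemma measurable_box n (A : 'I_n -> set T) : (forall i, measurable (A i)) ->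
  measurable (box A).
Proof.
move=> mA; rewrite (_ : box A = \bigcap_(i in [set: 'I_n]) ((tnth (T:=T))^~ i @^-1` A i)).
  apply: fin_bigcap_measurable => // i _.
  by rewrite -[X in measurable X]setTI; apply: measurable_tnth.
by apply/seteqP; split => t /= h i => [_|]; exact: h.
Qed.

Lemma power_measure_box n (A : 'I_n -> set T) : (forall i, measurable (A i)) ->
  power_measure m n (box A) = (\prod_(i < n) m (A i))%E.
Proof.
elim: n A => [|n IH] A mA.
  by rewrite big_ord0 /= diracE mem_set// => -[].
rewrite big_ord_recl -IH//= /pushforward.
rewrite (_ : _ @^-1` _ = A ord0 `*` box (fun i => A (lift ord0 i))).
  by rewrite product_measure1E//; exact: measurable_box.
apply/seteqP; split => -[x t] /=.
  move=> h; split; first by have := h ord0; rewrite (tnth_nth x).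
  by move=> i; have := h (lift ord0 i); rewrite !(tnth_nth x).
move=> [/= hx ht] i; case: (unliftP ord0 i) => [j|] ->.
  by have := ht j; rewrite !(tnth_nth x).
by rewrite (tnth_nth x).
Qed.

Lemma boxI n (A B : 'I_n -> set T) :
  box A `&` box B = box (fun i => A i `&` B i).
Proof.
apply/seteqP; split => t /=; first by move=> [h1 h2] i; split; [exact: h1|exact: h2].
by move=> h; split => i; have [] := h i.
Qed.

Lemma power_measure_box_lty n (A : 'I_n -> set T) :
  (forall i, measurable (A i)) -> (forall i, m (A i) < +oo)%E ->
  (power_measure m n (box A) < +oo)%E.
Proof.
move=> mA Aoo; rewrite power_measure_box//.
have [] // : (\prod_(i < n) m (A i) < +oo)%E /\ (0 <= \prod_(i < n) m (A i))%E.
apply: (big_ind (fun x => (x < +oo)%E /\ (0 <= x)%E)) => [|x y [x1 x0] [y1 y0]|i _].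
- by rewrite ltry.
- by rewrite lte_mul_pinfty ?mule_ge0// ge0_fin_numE.
- by rewrite Aoo.
Qed.

Lemma L2_box n (A : 'I_n -> set T) : (forall i, measurable (A i)) ->
  (forall i, m (A i) < +oo)%E ->
  (\1_(box A) : _ -> R) \in Lfun (power_measure m n) 2%:E.
Proof.
move=> mA Aoo; apply: L2_indic; first exact: measurable_box.
exact: power_measure_box_lty.
Qed.

Lemma ip_box n (A B : 'I_n -> set T) : (forall i, measurable (A i)) ->
  (forall i, measurable (B i)) -> (forall i, m (A i) < +oo)%E ->
  ip (power_measure m n) \1_(box A) \1_(box B) =
  \prod_(i < n) fine (m (A i `&` B i)).
Proof.
move=> mA mB Aoo; rewrite ip_indic; try exact: measurable_box.
have mAB i : measurable (A i `&` B i) by exact: measurableI.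
rewrite boxI [X in fine X](power_measure_box mAB) -[RHS]/(fine (_ %:E)).
congr fine; rewrite (big_morph EFin EFinM erefl); apply: eq_bigr => i _.
rewrite fineK// ge0_fin_numE// (le_lt_trans _ (Aoo i))// le_measure ?inE//.
Qed.

End power_measure_box.

(** * Sums over tuples without repetition *)

Section off_diagonal_sums.
Context (R : realType) (I : finType) (m : I -> R).
Hypothesis m0 : forall i, 0 <= m i.
Implicit Types S : {set I}.

(* [n`!] times the [n]-th elementary symmetric polynomial of [a] over [S] *)
Definition offdiag n S (a : I -> R) : R :=
  \sum_(t : n.-tuple I | all (mem S) t && uniq t) \prod_(x <- t) a x.

Lemma big_tuple_recl n (F : n.+1.-tuple I -> R) :
  \sum_t F t = \sum_(t : n.-tuple I) \sum_x F [tuple of x :: t].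
Proof.
rewrite pair_big/= (reindex (fun p : n.-tuple I * I => [tuple of p.2 :: p.1]))//=.
exists (fun t : n.+1.-tuple I => ([tuple of behead t], thead t)) => [[t x] _|t _] /=.
  by congr pair; exact/val_inj.
by rewrite [RHS]tuple_eta; exact/val_inj.
Qed.

Lemma offdiag0 S : offdiag 0 S m = 1.
Proof.
rewrite /offdiag (bigD1 [tuple])//= big_nil big1 ?addr0// => t.
by rewrite (tuple0 t) => /andP[_ /eqP].
Qed.

(** A tuple without repetition is extended by an element of [S] outside it, so the new factor is the
    total over [S] minus the entries already used. *)
Lemma offdiagS n S : offdiag n.+1 S m =
  \sum_(t : n.-tuple I | all (mem S) t && uniq t)
    (\prod_(x <- t) m x) * (\sum_(x in S) m x - \sum_(x <- t) m x).
Proof.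
rewrite /offdiag big_mkcond/= big_tuple_recl [RHS]big_mkcond/=.
apply: eq_bigr => t _; case: ifPn => [/andP[tS ut]|h]; last first.
  rewrite big1// => x _; case: ifPn => // /andP[/andP[_ tS] /andP[_ ut]].
  by rewrite tS ut in h.
rewrite [X in _ - X](big_uniq _ ut)/=.
rewrite [X in X - _](bigID (mem t))/=.
rewrite [X in X + _ - _](_ : _ = \sum_(x in t) m x); last first.
  apply: eq_bigl => x; rewrite andbC; case: (boolP (x \in t)) => //= xt.
  exact: (allP tS).
rewrite [X in _ * X]addrAC subrr add0r mulr_sumr [RHS]big_mkcond/=.
apply: eq_bigr => x _; rewrite tS ut andbT/= andbT; case: ifPn => // _.
by rewrite big_cons mulrC.
Qed.

Lemma offdiagS_le n S : offdiag n.+1 S m <= offdiag n S m * \sum_(x in S) m x.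
Proof.
rewrite offdiagS /offdiag mulr_suml; apply: ler_sum => t _.
apply: ler_wpM2l; first exact: prodr_ge0.
by rewrite gerBl sumr_ge0.
Qed.

(** The [n] entries already used carry at most [n * e]. Together with [offdiagS_le] this forces the
    off-diagonal sums towards the powers of the total mass as [e] tends to 0. *)
Lemma offdiagS_ge n S (e : R) : (forall i, m i <= e) ->
  offdiag n S m * (\sum_(x in S) m x - n%:R * e) <= offdiag n.+1 S m.
Proof.
move=> me; rewrite offdiagS /offdiag mulr_suml; apply: ler_sum => t _.
apply: ler_wpM2l; first exact: prodr_ge0.
rewrite lerB// big_tuple.
apply: (@le_trans _ _ (\sum_(i < n) e)); first exact: ler_sum.
by rewrite sumr_const card_ord mulr_natl.
Qed.

End off_diagonal_sums.

(** * Multilinear polynomials in independent compensated Poisson variables *)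

Section poisson_chaos_sums.
Context (R : realType) (dO : measure_display) (Omega : measurableType dO)
  (P : probability Omega R).
Context (I : finType) (Y : I -> Omega -> \bar R) (m : I -> R).
Hypotheses (m0 : forall i, 0 <= m i) (lawY : forall i, poisson_law P (m i) (Y i)).
Hypothesis indepY : forall C : I -> set (\bar R), (forall i, measurable (C i)) ->
  P [set w | forall i, C i (Y i w)] = (\prod_i P [set w | C i (Y i w)])%E.
Implicit Types S : {set I}.

Let X i w := fine (Y i w) - m i.

Let mX i : measurable_fun setT (X i).
Proof.
apply: measurable_funB => //; apply: measurableT_comp; first exact: fine_measurable.
by case: (lawY i).
Qed.

Let X2 i : X i \in Lfun P 2%:E.
Proof.
rewrite (_ : X i = (fine \o Y i) \- cst (m i))//.
by apply: L2B; [exact: poisson_L2|exact: Lfun_cst].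
Qed.

Let cst2 (c : R) : (cst c : Omega -> R) \in Lfun P 2%:E.
Proof. exact: Lfun_cst. Qed.

Let EX i : \int[P]_w X i w = 0.
Proof.
rewrite RintegralB//; last 2 first.
- by apply: L2_integrable; exact: poisson_L2.
- exact: finite_measure_integrable_cst.
by rewrite (poisson_mean (m0 i))// Rintegral_probability_cst subrr.
Qed.

Let EX2 i : \int[P]_w (X i w ^+ 2) = m i.
Proof.
have Y2 := poisson_L2 (m0 i) (lawY i).
have <- : ip P (X i) (X i) = \int[P]_w (X i w ^+ 2).
  by apply: eq_Rintegral => w _; rewrite expr2.
rewrite (_ : X i = (fine \o Y i) \- cst (m i))//.
rewrite ip_sub// [ip _ _ (cst _)]/ip RintegralZr//=; last first.
  exact: L2_integrable.
rewrite (poisson_mean (m0 i))//.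
have -> : ip P (cst (m i)) (cst (m i)) = m i * m i.
  exact: (Rintegral_probability_cst P (m i * m i)).
rewrite (_ : ip P _ _ = m i * (m i + 1)); first by ring.
apply: EFin_inj; rewrite EFin_ip_sqr//; exact: poisson_moment2.
Qed.

Let iX k i : (k <= 2)%N -> P.-integrable setT (fun w => (X i w ^+ k)%:E).
Proof.
case: k => [|[|[|//]]] _.
- under eq_fun do rewrite expr0; exact: finite_measure_integrable_cst.
- under eq_fun do rewrite expr1.
  exact: L2_integrable.
- exact: Lfun2_integrable_sqr.
Qed.

Let EXk k i : (k <= 2)%N ->
  \int[P]_w (X i w ^+ k) = if k is 0 then 1 else if k is 1 then 0 else m i.
Proof.
case: k => [|[|[|//]]] _.
- by under eq_Rintegral do rewrite expr0; rewrite Rintegral_probability_cst.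
- by under eq_Rintegral do rewrite expr1; rewrite EX.
- exact: EX2.
Qed.

Let prod_uniq (t : seq I) (a : I -> R) : uniq t ->
  \prod_(x <- t) a x = \prod_x a x ^+ (x \in t).
Proof.
move=> ut; rewrite big_uniq//= big_mkcond/=; apply: eq_bigr => x _.
by case: ifPn.
Qed.

Let prod_mul (t u : seq I) w : uniq t -> uniq u ->
  (\prod_(x <- t) X x w) * (\prod_(x <- u) X x w) =
  \prod_x X x w ^+ ((x \in t) + (x \in u)).
Proof.
move=> ut uu; rewrite (prod_uniq _ ut) (prod_uniq _ uu) -big_split/=; apply: eq_bigr => x _.
by rewrite exprD.
Qed.

Let mpow k i : measurable_fun setT (fun y : \bar R => (fine y - m i) ^+ k).
Proof.
by apply: measurable_funX; apply: measurable_funB.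
Qed.

(** Two lists without repetition use each variable at most twice, so first and second moments
    suffice below. *)
Let le2 (t u : seq I) x : ((x \in t) + (x \in u) <= 2)%N.
Proof. by case: (x \in t); case: (x \in u). Qed.

Lemma L2_prod_compensated (t : seq I) : uniq t ->
  (fun w => \prod_(x <- t) X x w) \in Lfun P 2%:E.
Proof.
move=> ut; apply/L2P; split.
  by apply: measurable_prod => i _; exact: mX.
have [/integrableP[_ H] _] := indep_integral m0 lawY indepY
  (fun i => mpow ((i \in t) + (i \in t)) i) (fun i => iX i (le2 t t i)).
apply: le_lt_trans H; apply: ge0_le_integral => //.
- by move=> w _; rewrite lee_fin sqr_ge0.
- by apply/measurable_EFinP; apply: measurable_funX; apply: measurable_prod.
- apply/measurable_EFinP; apply: measurableT_comp => //.
  by apply: measurable_prod => i _; apply: measurable_funX; exact: mX.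
- by move=> w _; rewrite lee_fin expr2 prod_mul// ler_norm.
Qed.

(** The expectation factorises over the indices: an index in exactly one list contributes the mean
    0, an index in both the variance [m x]. *)
Lemma ip_prod_compensated (t u : seq I) : uniq t -> uniq u ->
  ip P (fun w => \prod_(x <- t) X x w) (fun w => \prod_(x <- u) X x w) =
  if [forall x, (x \in t) == (x \in u)] then \prod_(x <- t) m x else 0.
Proof.
move=> ut uu; rewrite /ip.
under eq_Rintegral do rewrite prod_mul//.
have [_ ->] := indep_integral m0 lawY indepY
  (fun i => mpow ((i \in t) + (i \in u)) i) (fun i => iX i (le2 t u i)).
case: ifPn => [/forallP tu|/forallPn[x xtu]].
  rewrite (prod_uniq _ ut); apply: eq_bigr => x _.
  rewrite EXk//; have /eqP <- := tu x.
  by case: (x \in t).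
rewrite (bigD1 x)//= EXk//.
by move: xtu; case: (x \in t); case: (x \in u); rewrite //= mul0r.
Qed.

Definition chaos_sum n S w := offdiag n S (X^~ w).

Lemma L2_chaos_sum n S : chaos_sum n S \in Lfun P 2%:E.
Proof.
by apply: L2_sum => t /andP[_ ut]; exact: L2_prod_compensated.
Qed.

(** The source of the [n!] in the isometry: the repetition-free [u] with the same entries as [t] are
    its [n!] orderings, and either all of them have their entries in [S'] or none has. *)
Let card_same_set n k (t : n.-tuple I) S' : uniq t ->
  #|[pred u : k.-tuple I | (all (mem S') u && uniq u) &&
      [forall x, (x \in t) == (x \in u)]]| =
  if (n == k) && all (mem S') t then n`! else 0%N.
Proof.
move=> ut; case: ifPn => [/andP[/eqP nk tS']|h].
  subst k; rewrite -(ffactnn n) -[in X in X ^_ _](size_tuple t) -(card_uniqP ut).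
  rewrite -card_uniq_tuples; apply: eq_card => u; rewrite !inE.
  apply/idP/idP => [/andP[/andP[_ uu] /forallP tu]|/andP[ut' uu]].
    rewrite uu andbT; apply/allP => x xu.
    by have := eqP (tu x); rewrite xu; exact.
  rewrite uu andbT; apply/andP; split.
    by apply/allP => x /(allP ut') /(allP tS').
  have tule : (size t <= size u)%N by rewrite !size_tuple.
  have [_ tu] := uniq_min_size uu (allP ut') tule.
  by apply/forallP => x; rewrite tu.
apply: eq_card0 => u; rewrite inE; apply: contraNF h.
move=> /andP[/andP[uS uu] /forallP tu].
have tu' : t =i u by move=> x; exact/eqP.
apply/andP; split.
  have := uniq_perm ut uu tu'.
  by move/perm_size; rewrite !size_tuple => ->.
by apply/allP => x; rewrite tu' => /(allP uS).
Qed.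

Lemma ip_chaos_sum n k S S' : ip P (chaos_sum n S) (chaos_sum k S') =
  if n == k then n`!%:R * offdiag n (S :&: S') m else 0.
Proof.
rewrite /chaos_sum ip_suml; last exact: L2_chaos_sum.
  transitivity (\sum_(t : n.-tuple I | all (mem S) t && uniq t)
      (if (n == k) && all (mem S') t then n`! else 0%N)%:R * \prod_(x <- t) m x).
    apply: eq_bigr => t /andP[tS ut].
    rewrite ip_sumr; last exact: L2_prod_compensated.
      rewrite (eq_bigr (fun u : k.-tuple I => if [forall x, (x \in t) == (x \in u)]
        then \prod_(x <- t) m x else 0)); last first.
        by move=> u /andP[_ uu]; rewrite ip_prod_compensated.
      rewrite -big_mkcondr/= sumr_const -(card_same_set _ _ ut) mulr_natl.
      by congr (_ *+ _); apply: eq_card => u; rewrite !inE.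
    by move=> u /andP[_ uu]; exact: L2_prod_compensated.
  case: ifPn => nk; last by rewrite big1// => t _; rewrite mul0r.
  rewrite /offdiag mulr_sumr [LHS]big_mkcond [RHS]big_mkcond/=.
  apply: eq_bigr => t _.
  have -> : all (mem (S :&: S')) t = all (mem S) t && all (mem S') t.
    by rewrite -all_predI; apply: eq_all => x; rewrite /= !inE.
  by case: (all (mem S) t); case: (uniq t); case: (all (mem S') t); rewrite //= mul0r.
by move=> t /andP[_ ut]; exact: L2_prod_compensated.
Qed.

(** By independence, a cell in [t] contributes the mean of its void indicator times its compensated
    count, that is [- m e^(-m)], and every other cell of [S] contributes [e^(-m)]. *)
Lemma ip_void_chaos_sum n S :
  ip P (fun w => \prod_(x in S) \1_[set 0%E] (Y x w)) (chaos_sum n S) =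
  expR (- \sum_(x in S) m x) * (-1) ^+ n * offdiag n S m.
Proof.
have mvoid : measurable_fun setT (fun w => (\prod_(x in S) \1_[set 0%E] (Y x w) : R)).
  under eq_fun do rewrite -big_enum.
  apply: measurable_prod => x _; apply: measurableT_comp.
    by apply: measurable_indic; exact: emeasurable_set1.
  by case: (lawY x).
have void01 w : 0 <= (\prod_(x in S) \1_[set 0%E] (Y x w) : R) <= 1.
  rewrite prodr_ge0//=; apply: prodr_ile1 => x _.
  by rewrite indicE; case: (_ \in _); rewrite /= ?lexx ?ler01.
have void2 : (fun w => \prod_(x in S) \1_[set 0%E] (Y x w)) \in Lfun P 2%:E.
  apply/L2P; split => //.
  apply: (@le_lt_trans _ _ (\int[P]_w (cst 1 w))%E).
    apply: ge0_le_integral => //.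
    - by move=> w _; rewrite lee_fin sqr_ge0.
    - by apply/measurable_EFinP; apply: measurable_funX.
    - by move=> w _; have /andP[v0 v1] := void01 w; rewrite lee_fin expr_le1.
  rewrite integral_cst// mul1e.
  exact: le_lt_trans (probability_le1 P measurableT) (ltry _).
rewrite /chaos_sum ip_sumr//; last first.
  by move=> t /andP[_ ut]; exact: L2_prod_compensated.
rewrite /offdiag mulr_sumr; apply: eq_bigr => t /andP[tS ut].
pose psi i (y : \bar R) : R := (if i \in S then \1_[set 0%E] y else 1) *
  (fine y - m i) ^+ (i \in t).
transitivity (\int[P]_w \prod_i psi i (Y i w)).
  apply: eq_Rintegral => w _; rewrite /psi big_split/= (prod_uniq _ ut); congr (_ * _).
  by rewrite big_mkcond.
(* On the event that the count is 0, the compensated count is the constant [- m i]. *)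
have psiE (b c : bool) i (y : \bar R) :
    (if b then \1_[set 0%E] y else 1) * (fine y - m i) ^+ c =
    (if b then (- m i) ^+ c * \1_[set 0%E] y else (fine y - m i) ^+ c) :> R.
  case: b; rewrite ?mul1r// mulrC; have [->|y0] := eqVneq y 0%E.
    by rewrite sub0r.
  by rewrite indicE memNset ?mulr0//= => /eqP; rewrite (negbTE y0).
have i1 i : P.-integrable setT (fun w => (\1_[set 0%E] (Y i w))%:E).
  have h : measurable (Y i @^-1` [set 0%E]); last exact: integrable_indic h.
  rewrite -[X in measurable X]setTI; case: (lawY i) => mYi _.
  by apply: mYi => //; exact: emeasurable_set1.
have mpsi i : measurable_fun setT (psi i).
  rewrite /psi; apply: measurable_funM => //; case: (i \in S) => //.
  by apply: measurable_indic; exact: emeasurable_set1.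
have ipsi i : P.-integrable setT (fun w => (psi i (Y i w))%:E).
  rewrite /psi; under eq_fun do rewrite psiE.
  case: (i \in S).
    under eq_fun do rewrite EFinM.
    by apply: (integrableZl measurableT).
  by apply: iX; case: (i \in t).
have [_ ->] := indep_integral m0 lawY indepY mpsi ipsi.
transitivity (\prod_i ((if i \in S then expR (- m i) else 1) *
     (- m i) ^+ (i \in t))).
  apply: eq_bigr => i _; rewrite /psi; under eq_Rintegral do rewrite psiE.
  have [iS|iS] := boolP (i \in S).
    rewrite (RintegralZl _ measurableT (i1 i)) mulrC; congr (_ * _).
    rewrite /Rintegral (eq_integral (fun w => (\1_(Y i @^-1` [set 0%E]) w)%:E))//.
    rewrite integral_indic//; last first.
      rewrite -[X in measurable X]setTI; case: (lawY i) => mYi _.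
      by apply: mYi => //; exact: emeasurable_set1.
    rewrite setIT -[RHS]/(fine (expR (- m i))%:E) -(poisson_void (lawY i)).
    by congr fine; congr (P _).
  have it : i \in t = false by apply/negbTE; apply: contra iS => /(allP tS).
  rewrite it expr0 mul1r; under eq_Rintegral do rewrite expr0.
  exact: Rintegral_probability_cst.
rewrite big_split/= -big_mkcond/= -expR_sum sumrN -(prod_uniq _ ut) -mulrA.
congr (_ * _); rewrite -[in (-1) ^+ n](size_tuple t).
elim: (tval t) => [|x s IH]; first by rewrite !big_nil mulr1.
by rewrite !big_cons IH /= exprS; ring.
Qed.

End poisson_chaos_sums.

(** * Fine subdivisions and multiple integrals *)

Section refinements.
Context d (E : measurableType d) (R : realType) (mu : {measure set E -> \bar R})
  (D : set E).

Definition admissible (A : set E) :=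
  [/\ measurable A, A `<=` D & (mu A < +oo)%E].

Lemma admissible_sub A B : admissible A -> measurable B -> B `<=` A ->
  admissible B.
Proof.
move=> [mA AD Aoo] mB BA; split => //; first exact: subset_trans AD.
by rewrite (le_lt_trans _ Aoo)// le_measure ?inE.
Qed.

Lemma admissibleI A B : admissible A -> measurable B -> admissible (A `&` B).
Proof.
move=> aA mB; have [mA _ _] := aA.
by apply: admissible_sub aA _ _; [exact: measurableI|exact: subIsetl].
Qed.

Lemma admissibleU A B : admissible A -> admissible B -> admissible (A `|` B).
Proof.
move=> [mA AD Aoo] [mB BD Boo]; split; first exact: measurableU.
  by move=> x [/AD|/BD].
by rewrite (le_lt_trans (measureU2 _ mA mB))// lte_add_pinfty.
Qed.

Lemma admissible0 : admissible set0.
Proof. by split => //; rewrite measure0. Qed.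

Lemma admissible_fin_num A : admissible A -> mu A \is a fin_num.
Proof. by move=> [_ _ Aoo]; rewrite ge0_fin_numE. Qed.

(** A finite form of the absence of atoms; it makes the diagonals in the powers of [E]
    negligible. *)
Definition diffuse := forall B (e : R), admissible B -> 0 < e ->
  exists (J : finType) (A : J -> set E),
    [/\ forall i, admissible (A i), trivIset setT A,
        forall i, fine (mu (A i)) <= e & B = \bigcup_i A i].

(** One disjoint family serves both [B] and [C], so that their approximants are polynomials in the
    same independent counts. Both sets are recorded as sets of indices, and their intersection then
    corresponds to the intersection of the index sets. *)
Record refinement (B C : set E) (e : R) := Refinement {
  cell_index : finType ;
  cell : cell_index -> set E ;
  cells_in1 : {set cell_index} ;
  cells_in2 : {set cell_index} ;
  cell_admissible : forall i, admissible (cell i) ;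
  cell_trivIset : trivIset setT cell ;
  cell_small : forall i, fine (mu (cell i)) <= e ;
  cells_in1E : B = \bigcup_(i in [set` cells_in1]) cell i ;
  cells_in2E : C = \bigcup_(i in [set` cells_in2]) cell i }.

Arguments cell {B C e} r i.
Arguments cell_admissible {B C e} r i.
Arguments cell_trivIset {B C e} r.
Arguments cell_small {B C e} r i.
Arguments cells_in1E {B C e} r.
Arguments cells_in2E {B C e} r.

(** Cut the union of [B] and [C] by diffuseness, then split each piece by membership in [B] and in
    [C]; the two booleans of an index record these memberships, and cells outside both sets are
    empty. *)
Lemma refinement_exists (B C : set E) (e : R) : diffuse -> admissible B ->
  admissible C -> 0 < e -> exists r : refinement B C e, True.
Proof.
move=> dif aB aC e0.
have [J [A [aA tA Ae BCE]]] := dif _ _ (admissibleU aB aC) e0.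
have [mB _ _] := aB; have [mC _ _] := aC.
pose part (b : bool) (X : set E) := if b then X else ~` X.
have mpart b X : measurable X -> measurable (part b X).
  by case: b => // mX; exact: measurableC.
pose cl (x : J * bool * bool) := A x.1.1 `&` (part x.1.2 B `&` part x.2 C).
have acl x : admissible (cl x).
  by apply: admissibleI; [exact: aA|apply: measurableI; exact: mpart].
have tcl : trivIset setT cl.
  move=> [[i b] c] [[j b'] c'] _ _ [x [[/= Aix [Bx Cx]] [/= Ajx [B'x C'x]]]].
  have -> : i = j by apply: tA => //; exists x.
  have -> : b = b' by case: b b' Bx B'x => -[].
  by have -> : c = c' by case: c c' Cx C'x => -[].
have cov x : B x \/ C x -> exists i, A i x.
  by move=> h; have : (B `|` C) x by []; rewrite BCE => -[i _ ?]; exists i.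
apply: (ex_intro _ (@Refinement B C e _ cl
  [set x | x.1.2]%SET [set x | x.2]%SET acl tcl _ _ _)) => //.
- move=> x; apply: le_trans (Ae x.1.1).
  have [mcl _ _] := acl x; have [mA _ _] := aA x.1.1.
  rewrite fine_le ?admissible_fin_num// le_measure ?inE//.
  exact: subIsetl.
- apply/seteqP; split => [x Bx|x [[[i b] c] /=]]; last first.
    by rewrite inE /= => -> [_ []].
  have [i Aix] := cov _ (or_introl Bx).
  have [Cx|Cx] := pselect (C x).
    by exists (i, true, true) => //=; rewrite inE.
  by exists (i, true, false) => //=; rewrite inE.
- apply/seteqP; split => [x Cx|x [[[i b] c] /=]]; last first.
    by rewrite inE /= => -> [_ []].
  have [i Aix] := cov _ (or_intror Cx).
  have [Bx|Bx] := pselect (B x).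
    by exists (i, true, true) => //=; rewrite inE.
  by exists (i, false, true) => //=; rewrite inE.
Qed.

Lemma measure_finite_bigcup (m : {measure set E -> \bar R}) (I : finType)
  (A : I -> set E) (S : {set I}) : (forall i, measurable (A i)) ->
  trivIset setT A ->
  m (\bigcup_(i in [set` S]) A i) = (\sum_(i in S) m (A i))%E.
Proof.
move=> mA tA.
have -> : [set` S] = [set` enum S].
  by apply/seteqP; split => i /=; rewrite mem_enum.
rewrite bigcup_seq -big_enum/=.
elim: (enum S) (enum_uniq S) => [|x s IH /= /andP[xs us]].
  by rewrite !big_nil measure0.
rewrite !big_cons measureU//.
- by rewrite -IH.
- by apply: bigsetU_measurable => i _.
apply/seteqP; split => // y [Ax]; rewrite -bigcup_seq => -[i /= si Aiy].
have xi : x = i by apply: tA => //; exists y.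
by move: xs; rewrite xi si.
Qed.

Section refinement_measure.
Variables (B C : set E) (e : R) (r : refinement B C e).

Lemma measurable_cell i : measurable (cell r i).
Proof. by have [] := cell_admissible r i. Qed.

Lemma in1P x : B x <-> exists2 i, i \in cells_in1 r & cell r i x.
Proof.
have E1 : B x = (\bigcup_(i in [set` cells_in1 r]) cell r i) x :=
  congr1 (fun U => U x) (cells_in1E r).
by split => [|[i iS Aix]]; rewrite E1; [move=> [i /= iS Aix]|]; exists i.
Qed.

Lemma in2P x : C x <-> exists2 i, i \in cells_in2 r & cell r i x.
Proof.
have E2 : C x = (\bigcup_(i in [set` cells_in2 r]) cell r i) x :=
  congr1 (fun U => U x) (cells_in2E r).
by split => [|[i iS Aix]]; rewrite E2; [move=> [i /= iS Aix]|]; exists i.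
Qed.

Lemma cells_in12E :
  B `&` C = \bigcup_(i in [set` (cells_in1 r :&: cells_in2 r)%SET]) cell r i.
Proof.
apply/seteqP; split => [x [/in1P[i iS Aix] /in2P[j jS Ajx]]|x [i /=]].
  have ij : i = j by apply: (cell_trivIset r) => //; exists x.
  by exists i => //=; rewrite inE iS ij jS.
by rewrite inE => /andP[iS iS'] Aix; split; [apply/in1P|apply/in2P]; exists i.
Qed.

Let mass i := fine (mu (cell r i)).

Lemma sum_mass (S : {set cell_index r}) :
  \sum_(i in S) mass i = fine (mu (\bigcup_(i in [set` S]) cell r i)).
Proof.
rewrite measure_finite_bigcup; last 2 first.
- exact: measurable_cell.
- exact: cell_trivIset.
rewrite sum_fine// => i _; exact: admissible_fin_num (cell_admissible r i).
Qed.

Lemma cellI i j : fine (mu (cell r i `&` cell r j)) = if i == j then mass i else 0.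
Proof.
case: eqVneq => [->|ij]; first by rewrite setIid.
have /trivIsetP/(_ i j I I ij) -> := cell_trivIset r.
by rewrite measure0.
Qed.

Lemma cells_inI (S : {set cell_index r}) i :
  fine (mu ((\bigcup_(k in [set` S]) cell r k) `&` cell r i)) =
  if i \in S then mass i else 0.
Proof.
case: ifPn => iS.
  by congr (fine (mu _)); apply/setIidPr => x Aix; exists i.
rewrite [X in mu X](_ : _ = set0) ?measure0//.
apply/seteqP; split => // x [[j /= jS Ajx] Aix].
have ij : i = j by apply: (cell_trivIset r) => //; exists x.
by rewrite ij jS in iS.
Qed.

End refinement_measure.

(** Induction on [n], squeezing between [offdiagS_ge] with mesh [1/(j+1)] and [offdiagS_le]. *)
Lemma cvg_offdiag n (B C : set E) (r : forall j : nat, refinement B C j.+1%:R^-1)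
    (S : forall j, {set cell_index (r j)}) (a : R) :
  (forall j, \sum_(i in S j) fine (mu (cell (r j) i)) = a) ->
  offdiag n (S j) (fun i => fine (mu (cell (r j) i))) @[j --> \oo] --> a ^+ n.
Proof.
move=> Sa.
have m0 j i : 0 <= fine (mu (cell (r j) i)) by apply: fine_ge0.
elim: n => [|n IH].
  under eq_fun do rewrite offdiag0; exact: cvg_cst.
have harm : n%:R * j.+1%:R^-1 @[j --> \oo] --> (0 : R).
  by rewrite -(mulr0 n%:R); apply: cvgMr; exact: cvg_harmonic.
have lo : offdiag n (S j) (fun i => fine (mu (cell (r j) i))) *
    (a - n%:R * j.+1%:R^-1) @[j --> \oo] --> a ^+ n.+1.
  rewrite exprSr -[X in _ * X]subr0; apply: cvgM => //.
  by apply: cvgB => //; exact: cvg_cst.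
have up : offdiag n (S j) (fun i => fine (mu (cell (r j) i))) * a @[j --> \oo] -->
    a ^+ n.+1.
  by rewrite exprSr; apply: cvgMl.
apply: (squeeze_cvgr _ lo up).
near=> j; apply/andP; split.
  have := offdiagS_ge (m0 j) n (S j) (fun i => cell_small (r j) i).
  by rewrite Sa.
by have := offdiagS_le (m0 j) n (S j); rewrite Sa.
Unshelve. all: by end_near. Qed.

End refinements.

Arguments cell {d E R mu D B C e} r i.
Arguments cell_admissible {d E R mu D B C e} r i.
Arguments cell_trivIset {d E R mu D B C e} r.
Arguments cell_small {d E R mu D B C e} r i.
Arguments cells_in1E {d E R mu D B C e} r.
Arguments cells_in2E {d E R mu D B C e} r.

(** * Multiple integrals of cubes as limits of off-diagonal sums *)

Section multiple_integrals.
Context (R : realType) (dO : measure_display) (Omega : measurableType dO)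
  (P : probability Omega R) (dE : measure_display) (E : measurableType dE)
  (mu : {sigma_finite_measure set E -> \bar R}) (D : set E)
  (N : R.-ker Omega ~> E) (MI : forall n, (n.-tuple E -> R) -> Omega -> R).
Local Notation adm := (admissible mu D).
Local Notation mun := (power_measure mu).
Hypothesis lawN : forall A, adm A -> poisson_law P (fine (mu A)) (N^~ A).
Hypothesis indepN : forall (J : finType) (A : J -> set E) (C : J -> set (\bar R)),
  (forall i, adm (A i)) -> trivIset setT A -> (forall i, measurable (C i)) ->
  P [set w | forall i, C i (N w (A i))] = (\prod_i P [set w | C i (N w (A i))])%E.
Hypothesis mu_diffuse : diffuse mu D.
Hypothesis linI : forall n, L2_continuous_linear (mun n) P (@MI n).
Hypothesis I_box : forall n (A : 'I_n -> set E), (forall i, adm (A i)) ->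
  trivIset setT A ->
  @MI n \1_(box A) = (fun w => \prod_(i < n) compensated mu N (A i) w) %[ae P].

Lemma I_L2 n f : f \in Lfun (mun n) 2%:E -> @MI n f \in Lfun P 2%:E.
Proof. by case: (linI n) => h _ _; exact: h. Qed.

Lemma I_cvg n (u : nat -> _) f : (forall k, u k \in Lfun (mun n) 2%:E) ->
  f \in Lfun (mun n) 2%:E -> L2cvg (mun n) u f ->
  L2cvg P (fun k => @MI n (u k)) (@MI n f).
Proof. by case: (linI n) => _ _; exact. Qed.

Lemma I_lin n a f g : f \in Lfun (mun n) 2%:E -> g \in Lfun (mun n) 2%:E ->
  @MI n (a \*: f \+ g) = a \*: @MI n f \+ @MI n g %[ae P].
Proof. by case: (linI n) => _ h _; exact: h. Qed.

Lemma I_cst0 n : @MI n (cst 0) = cst 0 %[ae P].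
Proof.
have c2 := L2_cst0 (mun n).
have := I_lin (-1) c2 c2; rewrite (_ : _ \+ _ = cst 0); last first.
  by apply/funext => x /=; rewrite scaler0 addr0.
apply: filterS => w /(_ I) /= h _; move: h.
by rewrite scaleN1r addNr.
Qed.

(** Linearity holds only almost everywhere, so one null set per summand is collected along the
    induction. *)
Lemma I_sum n (J : Type) (s : seq J) (Q : pred J) (f : J -> n.-tuple E -> R) :
  (forall j, Q j -> f j \in Lfun (mun n) 2%:E) ->
  @MI n (fun t => \sum_(j <- s | Q j) f j t) =
  (fun w => \sum_(j <- s | Q j) @MI n (f j) w) %[ae P].
Proof.
move=> f2; elim: s => [|j s IH].
  rewrite (_ : (fun t : n.-tuple E => _) = cst 0); last first.
    by apply/funext => t; rewrite big_nil.
  by have := I_cst0 n; apply: filterS => w /(_ I) -> _; rewrite big_nil.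
have [Qj|Qj] := boolP (Q j); last first.
  rewrite (_ : (fun t : n.-tuple E => _) = (fun t => \sum_(j <- s | Q j) f j t)); last first.
    by apply/funext => t; rewrite big_cons (negbTE Qj).
  by apply: filterS IH => w /(_ I) -> _; rewrite big_cons (negbTE Qj).
rewrite (_ : (fun t : n.-tuple E => _) =
    1 \*: f j \+ (fun t => \sum_(j <- s | Q j) f j t)); last first.
  by apply/funext => t /=; rewrite big_cons Qj scale1r.
have := I_lin 1 (f2 j Qj) (L2_sum s f2).
apply: filterS2 IH => w /(_ I) /= IHw /(_ I) /= -> _.
by rewrite big_cons Qj scale1r IHw.
Qed.

Lemma ae_eq_sum (J : Type) (s : seq J) (Q : pred J) (f g : J -> Omega -> R) :
  (forall j, Q j -> f j = g j %[ae P]) ->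
  (fun w => \sum_(j <- s | Q j) f j w) = (fun w => \sum_(j <- s | Q j) g j w) %[ae P].
Proof.
move=> fg; elim: s => [|j s IH].
  by apply: nearW => w _; rewrite !big_nil.
have [Qj|Qj] := boolP (Q j).
  apply: filterS2 IH (fg j Qj) => w /(_ I) h /(_ I) h' _.
  by rewrite !big_cons Qj h h'.
by apply: filterS IH => w /(_ I) h _; rewrite !big_cons (negbTE Qj).
Qed.

(** The [n]-th tensor power of the indicator of [B]. *)
Definition cube n (B : set E) : n.-tuple E -> R := \1_(box (fun=> B)).
Arguments cube n B : clear implicits.

Lemma L2_cube n B : adm B -> cube n B \in Lfun (mun n) 2%:E.
Proof. by move=> [mB _ Boo]; apply: L2_box. Qed.

Lemma ip_cube n B C : adm B -> adm C ->
  ip (mun n) (cube n B) (cube n C) = fine (mu (B `&` C)) ^+ n.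
Proof.
move=> [mB _ Boo] [mC _ _]; rewrite /cube ip_box//.
by rewrite prodr_const card_ord.
Qed.

Section approximation.
Variables (B C : set E) (r : forall j : nat, refinement mu D B C j.+1%:R^-1).
Variables (B' : set E) (S : forall j, {set cell_index (r j)}).
Hypotheses (aB' : adm B')
  (SE : forall j, B' = \bigcup_(i in [set` S j]) cell (r j) i).

Let mass j i := fine (mu (cell (r j) i)).

Definition offdiag_cube n j (x : n.-tuple E) : R :=
  \sum_(t : n.-tuple (cell_index (r j)) | all (mem (S j)) t && uniq t)
    \1_(box (fun i => cell (r j) (tnth t i))) x.

Let L2_cell n j (t : n.-tuple (cell_index (r j))) :
  (\1_(box (fun i => cell (r j) (tnth t i))) : _ -> R) \in Lfun (mun n) 2%:E.
Proof.
by apply: L2_box => i; have [] := cell_admissible (r j) (tnth t i).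
Qed.

Lemma L2_offdiag_cube n j : @offdiag_cube n j \in Lfun (mun n) 2%:E.
Proof. by apply: L2_sum => t _; exact: L2_cell. Qed.

Let ip_cube_offdiag n j :
  ip (mun n) (cube n B') (@offdiag_cube n j) = offdiag n (S j) (@mass j).
Proof.
have [mB' _ B'oo] := aB'.
rewrite /offdiag_cube ip_sumr; last 2 first.
- by move=> t _; exact: L2_cell.
- exact: L2_cube.
apply: eq_bigr => t /andP[tS _].
rewrite ip_box//; last by move=> i; have [] := cell_admissible (r j) (tnth t i).
rewrite big_tuple; apply: eq_bigr => i _.
rewrite [in LHS](SE j) cells_inI (_ : _ \in S j)//.
by apply: (allP tS); exact: mem_tnth.
Qed.

Let ip_offdiag_offdiag n j :
  ip (mun n) (@offdiag_cube n j) (@offdiag_cube n j) = offdiag n (S j) (@mass j).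
Proof.
rewrite {1}/offdiag_cube ip_suml; last 2 first.
- by move=> t _; exact: L2_cell.
- exact: L2_offdiag_cube.
apply: eq_bigr => t tP; rewrite /offdiag_cube ip_sumr; last 2 first.
- by move=> u _; exact: L2_cell.
- exact: L2_cell.
have mc i : measurable (cell (r j) i) by have [] := cell_admissible (r j) i.
have coo i : (mu (cell (r j) i) < +oo)%E by have [] := cell_admissible (r j) i.
rewrite (bigD1 t)//= [X in _ + X]big1 ?addr0.
  rewrite ip_box// big_tuple; apply: eq_bigr => i _.
  by rewrite cellI eqxx.
move=> u /andP[_ ut]; rewrite ip_box//.
have [i ti] : exists i, tnth t i != tnth u i.
  apply/existsP; apply: contraR ut; rewrite negb_exists => /forallP h.
  by apply/eqP/eq_from_tnth => i; apply/eqP; rewrite eq_sym -[_ == _]negbK h.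
by rewrite (bigD1 i)//= cellI (negbTE ti) mul0r.
Qed.

Lemma sum_mass_cells j : \sum_(i in S j) @mass j i = fine (mu B').
Proof. by rewrite sum_mass [in RHS](SE j). Qed.

(** The inner product with the cube and the squared norm are the same off-diagonal sum, so the
    squared error is [b^n] minus that sum, [b] being the mass of [B']. *)
Lemma cvg_offdiag_cube n : L2cvg (mun n) (@offdiag_cube n) (cube n B').
Proof.
apply/L2cvgP; [exact: L2_offdiag_cube|exact: L2_cube|].
have h j : ip (mun n) (@offdiag_cube n j \- cube n B') (@offdiag_cube n j \- cube n B') =
    fine (mu B') ^+ n - offdiag n (S j) (@mass j).
  rewrite ip_sub; [|exact: L2_offdiag_cube|exact: L2_cube].
  rewrite ip_offdiag_offdiag [ip _ _ (cube n B')]ipC ip_cube_offdiag ip_cube//.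
  by rewrite setIid; ring.
under eq_fun do rewrite h.
rewrite -(subrr (fine (mu B') ^+ n)); apply: cvgB; first exact: cvg_cst.
by apply: cvg_offdiag => j; exact: sum_mass_cells.
Qed.

Let mass_ge0 j i : 0 <= @mass j i. Proof. by apply: fine_ge0. Qed.

Let law_cell j i : poisson_law P (@mass j i) (N^~ (cell (r j) i)).
Proof. exact: lawN (cell_admissible (r j) i). Qed.

Let indep_cell j (K : cell_index (r j) -> set (\bar R)) :
  (forall i, measurable (K i)) ->
  P [set w | forall i, K i (N w (cell (r j) i))] =
  (\prod_i P [set w | K i (N w (cell (r j) i))])%E.
Proof.
by apply: indepN; [exact: cell_admissible|exact: cell_trivIset].
Qed.

Definition cell_chaos n j : Omega -> R :=
  chaos_sum (fun i w => N w (cell (r j) i)) (@mass j) n (S j).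

Lemma L2_cell_chaos n j : cell_chaos n j \in Lfun P 2%:E.
Proof. by apply: L2_chaos_sum; [exact: mass_ge0|exact: law_cell|exact: indep_cell]. Qed.

(** Linearity, then [I_box]: the entries of [t] are distinct, so the sides of each box are disjoint
    cells. *)
Lemma I_offdiag_cube n j : @MI n (@offdiag_cube n j) = cell_chaos n j %[ae P].
Proof.
have h := @I_sum n _ (index_enum _)
  (fun t : n.-tuple (cell_index (r j)) => all (mem (S j)) t && uniq t) _
  (fun t _ => @L2_cell n j t).
have h' : (fun w => \sum_(t : n.-tuple (cell_index (r j)) | all (mem (S j)) t && uniq t)
    @MI n \1_(box (fun i => cell (r j) (tnth t i))) w) = cell_chaos n j %[ae P].
  apply: ae_eq_sum => t /andP[_ ut].
  have tcell : trivIset setT (fun i => cell (r j) (tnth t i)).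
    apply/trivIsetP => i k _ _ ik; have /trivIsetP := cell_trivIset (r j).
    by apply => //; apply: contra ik => /eqP /(tuple_uniqP _ ut) ->.
  have := I_box (fun i => cell_admissible (r j) (tnth t i)) tcell.
  by apply: filterS => w /(_ I) -> _; rewrite big_tuple.
by apply: filterS2 h h' => w /(_ I) hw /(_ I) hw' _; rewrite hw.
Qed.

Lemma cvg_cell_chaos n : L2cvg P (cell_chaos n) (@MI n (cube n B')).
Proof.
have c2 j := I_L2 (@L2_offdiag_cube n j).
have f2 : @MI n (cube n B') \in Lfun P 2%:E by apply: I_L2; exact: L2_cube.
have := I_cvg (@L2_offdiag_cube n) (L2_cube n aB') (cvg_offdiag_cube n).
move=> /(L2cvgP c2 f2) h; apply/(L2cvgP (L2_cell_chaos n) f2).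
rewrite (_ : (fun k => _) = (fun k => ip P (@MI n (@offdiag_cube n k) \- @MI n (cube n B'))
  (@MI n (@offdiag_cube n k) \- @MI n (cube n B'))))//.
apply/funext => j; have H := I_offdiag_cube n j.
by apply: ip_ae; (try by apply: L2B; rewrite ?L2_cell_chaos ?c2);
  apply: filterS H => w /(_ I) + _ /= => ->.
Qed.

End approximation.
Arguments cell_chaos {B C} r S n j.

Lemma exists_refinements B C : adm B -> adm C ->
  {r : forall j : nat, refinement mu D B C j.+1%:R^-1 & True}.
Proof.
move=> aB aC.
have h (j : nat) : exists r : refinement mu D B C j.+1%:R^-1, True.
  by apply: refinement_exists.
by exists (fun j => sval (cid (h j))).
Qed.

(** Limit of [ip_chaos_sum] along common refinements, whose shared cells exhaust the intersection of
    [B] and [C]. *)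
Lemma ip_multiple_integral_cube n k B C : adm B -> adm C ->
  ip P (@MI n (cube n B)) (@MI k (cube k C)) =
  if n == k then n`!%:R * fine (mu (B `&` C)) ^+ n else 0.
Proof.
move=> aB aC; have [r _] := exists_refinements aB aC.
have E1 j := cells_in1E (r j); have E2 j := cells_in2E (r j).
have I2 n' B' : adm B' -> @MI n' (cube n' B') \in Lfun P 2%:E.
  by move=> aB'; apply: I_L2; exact: L2_cube.
pose S1 j := cells_in1 (r j); pose S2 j := cells_in2 (r j).
have h : ip P (cell_chaos r S1 n j) (cell_chaos r S2 k j) @[j --> \oo] -->
    ip P (@MI n (cube n B)) (@MI k (cube k C)).
  apply: L2cvg_ip; rewrite ?I2//; try (by move=> j; exact: L2_cell_chaos).
    exact: cvg_cell_chaos.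
  exact: cvg_cell_chaos.
have h' : ip P (cell_chaos r S1 n j) (cell_chaos r S2 k j) @[j --> \oo] -->
    if n == k then n`!%:R * fine (mu (B `&` C)) ^+ n else 0.
  rewrite (_ : (fun j => _) = fun j => if n == k then n`!%:R *
    offdiag n (S1 j :&: S2 j)%SET (fun i => fine (mu (cell (r j) i))) else 0); last first.
    apply/funext => j; apply: ip_chaos_sum.
    - by move=> i; apply: fine_ge0.
    - by move=> i; apply: lawN; exact: cell_admissible.
    - by move=> K mK; apply: indepN => //; [exact: cell_admissible|exact: cell_trivIset].
  case: eqP => _; last exact: cvg_cst.
  apply: cvgMr; apply: cvg_offdiag => j.
  by rewrite sum_mass -cells_in12E.
exact: cvg_unique h h'.
Qed.

Definition void B : Omega -> R := fun w => \1_[set 0%E] (N w B).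

Lemma voidE B : void B = \1_[set w | N w B = 0%E].
Proof. by []. Qed.

Lemma measurable_void B : measurable B -> measurable [set w | N w B = 0%E].
Proof.
move=> mB; rewrite -[X in measurable X]setTI.
exact: (measurable_kernel N B mB measurableT _ (emeasurable_set1 0%E)).
Qed.

Lemma L2_void B : measurable B -> void B \in Lfun P 2%:E.
Proof.
move=> mB; rewrite voidE; apply: L2_indic; first exact: measurable_void.
by rewrite -ge0_fin_numE//; exact: fin_num_measure (measurable_void mB).
Qed.

(** Valid for overlapping sets too, a union being free of points exactly when both sets are; this is
    what makes the void events stable under intersection. *)
Lemma void_setU B C w : measurable B -> measurable C ->
  void (B `|` C) w = void B w * void C w.
Proof.
move=> mB mC; rewrite !voidE -[RHS]/((\1_[set w | N w B = 0%E] \*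
  \1_[set w | N w C = 0%E]) w) -indicI.
congr (\1__ w); apply/seteqP; split => v /=; last first.
  move=> [B0 C0]; apply/eqP; rewrite eq_le measure_ge0 andbT.
  by rewrite (le_trans (measureU2 _ mB mC))// [X in (X + _)%E]B0 [X in (_ + X)%E]C0 adde0.
move=> BC0; split; apply/eqP; rewrite eq_le measure_ge0 andbT -BC0 le_measure ?inE//;
  by [exact: measurableU|exact: subsetUl|exact: subsetUr].
Qed.

Lemma ip_void B : adm B -> ip P (void B) (void B) = expR (- fine (mu B)).
Proof.
move=> aB; have [mB _ _] := aB.
rewrite voidE ip_indic ?setIid; try exact: measurable_void.
rewrite -[RHS]/(fine (expR (- fine (mu B)))%:E).
by rewrite -(poisson_void (lawN aB)).
Qed.

Lemma void_prod (J : finType) (A : J -> set E) (S : {set J}) w :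
  (forall i, measurable (A i)) -> trivIset setT A ->
  void (\bigcup_(i in [set` S]) A i) w = \prod_(i in S) \1_[set 0%E] (N w (A i)).
Proof.
move=> mA tA; rewrite /void measure_finite_bigcup//.
suff [_ ->] : (0 <= \sum_(i in S) N w (A i))%E /\
    \1_[set 0%E] (\sum_(i in S) N w (A i))%E =
    \prod_(i in S) \1_[set 0%E] (N w (A i)) :> R by [].
apply: (big_ind2 (fun (x : \bar R) (y : R) => (0 <= x)%E /\ \1_[set 0%E] x = y)).
- by split => //; rewrite indicE mem_set.
- move=> x1 y1 x2 y2 [x10 <-] [x20 <-]; split; first exact: adde_ge0.
  have in0 (x : \bar R) : (x \in [set 0%E]) = (x == 0%E).
    by apply/idP/eqP => [/set_mem|->]//; rewrite mem_set.
  by rewrite !indicE !in0 padde_eq0// -natrM mulnb.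
- by move=> i _; split.
Qed.

(** Limit of [ip_void_chaos_sum]: the void indicator is the product over the cells of any
    refinement, and does not depend on the refinement. *)
Lemma ip_void_multiple_integral n B : adm B ->
  ip P (void B) (@MI n (cube n B)) =
  expR (- fine (mu B)) * (-1) ^+ n * fine (mu B) ^+ n.
Proof.
move=> aB; have [r _] := exists_refinements aB aB; have [mB _ _] := aB.
pose S1 j := cells_in1 (r j).
have h : ip P (void B) (cell_chaos r S1 n j) @[j --> \oo] -->
    ip P (void B) (@MI n (cube n B)).
  apply: (L2cvg_ip (u := fun=> void B)).
  - by move=> _; exact: L2_void.
  - by move=> j; exact: L2_cell_chaos.
  - exact: L2_void.
  - by apply: I_L2; exact: L2_cube.
  - by apply: L2cvg_cst; exact: L2_void.
  - by apply: cvg_cell_chaos => // j; exact: cells_in1E.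
have Sm j : \sum_(i in S1 j) fine (mu (cell (r j) i)) = fine (mu B).
  by rewrite sum_mass -cells_in1E.
have h' : ip P (void B) (cell_chaos r S1 n j) @[j --> \oo] -->
  expR (- fine (mu B)) * (-1) ^+ n * fine (mu B) ^+ n.
  rewrite (_ : (fun j => _) = fun j => expR (- fine (mu B)) * (-1) ^+ n *
    offdiag n (S1 j) (fun i => fine (mu (cell (r j) i)))); last first.
    apply/funext => j; rewrite -[in RHS](Sm j) -(@ip_void_chaos_sum _ _ _ P _
      (fun i w => N w (cell (r j) i)) (fun i => fine (mu (cell (r j) i)))).
    - congr ip; apply/funext => w.
      rewrite [in LHS](cells_in1E (r j)) void_prod//; last exact: cell_trivIset.
      by move=> i; have [] := cell_admissible (r j) i.
    - by move=> i; apply: fine_ge0.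
    - by move=> i; apply: lawN; exact: cell_admissible.
    - by move=> K mK; apply: indepN => //; [exact: cell_admissible|exact: cell_trivIset].
  by apply: cvgMr; apply: cvg_offdiag.
exact: cvg_unique h h'.
Qed.

End multiple_integrals.

Arguments cube {R dE E} n B.

(** * Chaos expansions *)

Section chaos_expansion.
Context (R : realType) (dO : measure_display) (Omega : measurableType dO)
  (P : probability Omega R) (dE : measure_display) (E : measurableType dE)
  (mu : {sigma_finite_measure set E -> \bar R}) (D : set E)
  (MI : forall n, (n.-tuple E -> R) -> Omega -> R).
Local Notation adm := (admissible mu D).
Local Notation mun := (power_measure mu).
Hypothesis linI : forall n, L2_continuous_linear (mun n) P (@MI n).
Hypothesis ip_I : forall n k B C, adm B -> adm C ->
  ip P (@MI n (cube n B)) (@MI k (cube k C)) =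
  if n == k then n`!%:R * fine (mu (B `&` C)) ^+ n else 0.

(* The isometry is needed, and proved, only on the closed span of the indicators
   of cubes; that this span contains all symmetric functions plays no role. *)
Inductive chaos_space n : (n.-tuple E -> R) -> Prop :=
| chaos_cube B : adm B -> chaos_space (cube n B)
| chaos_lin a f g : chaos_space f -> chaos_space g -> chaos_space (a \*: f \+ g)
| chaos_lim u f : (forall k, chaos_space (u k)) -> f \in Lfun (mun n) 2%:E ->
    symmetric_fun f -> L2cvg (mun n) u f -> chaos_space f.

Lemma chaos_L2 n (f : n.-tuple E -> R) : chaos_space f -> f \in Lfun (mun n) 2%:E.
Proof. by elim => // [B aB|a g h _ g2 _ h2]; [exact: L2_cube aB|exact: L2_lin]. Qed.

Lemma chaos_symmetric n (f : n.-tuple E -> R) : chaos_space f -> symmetric_fun f.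
Proof.
elim => // [B aB s t|a g h _ gs _ hs s t]; last by rewrite /= gs hs.
rewrite /cube !indicE; congr (_%:R); congr nat_of_bool.
apply/idP/idP => /set_mem h; apply/mem_set => i /=.
  by have := h (invF (@perm.perm_inj _ s) i); rewrite tnth_mktuple f_invF.
by rewrite tnth_mktuple.
Qed.

Let MI_L2 n f : f \in Lfun (mun n) 2%:E -> @MI n f \in Lfun P 2%:E.
Proof. exact: (I_L2 linI). Qed.

(** Both sides are linear and [L^2]-continuous in [f], so an identity on cubes propagates to the
    whole chaos space. Applied to one argument after the other, it extends bilinear identities. *)
Lemma chaos_functional n (h : Omega -> R) (g : n.-tuple E -> R) (c : R) :
  h \in Lfun P 2%:E -> g \in Lfun (mun n) 2%:E ->
  (forall B, adm B -> ip P (@MI n (cube n B)) h = c * ip (mun n) (cube n B) g) ->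
  forall f, chaos_space f -> ip P (@MI n f) h = c * ip (mun n) f g.
Proof.
move=> h2 g2 H f; elim => // [a f1 f2 /chaos_L2 f1L IH1 /chaos_L2 f2L IH2|].
  rewrite ip_linl// mulrDr mulrCA -IH1 -IH2 -ip_linl//; last 2 first.
  - exact: MI_L2.
  - exact: MI_L2.
  apply: ip_ae => //.
  - by apply: MI_L2; exact: L2_lin.
  - by apply: L2_lin; exact: MI_L2.
  - by have := I_lin linI a f1L f2L; apply.
  - exact: nearW.
move=> u f1 uc IH f1L _ uf; have u2 k := chaos_L2 (uc k).
have l1 : ip P (@MI n (u k)) h @[k --> \oo] --> ip P (@MI n f1) h.
  apply: (L2cvg_ip (v := fun=> h)) => //; try by move=> k; exact: MI_L2.
  - exact: MI_L2.
  - exact: (I_cvg linI).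
  - exact: L2cvg_cst.
have l2 : ip P (@MI n (u k)) h @[k --> \oo] --> c * ip (mun n) f1 g.
  under eq_fun do rewrite IH.
  apply: cvgMr; apply: (L2cvg_ip (v := fun=> g)) => //.
  exact: L2cvg_cst.
exact: cvg_unique l1 l2.
Qed.

Lemma chaos_isometry n (f g : n.-tuple E -> R) : chaos_space f -> chaos_space g ->
  ip P (@MI n f) (@MI n g) = n`!%:R * ip (mun n) f g.
Proof.
move=> fc gc; apply: chaos_functional fc.
- by apply: MI_L2; exact: chaos_L2.
- exact: chaos_L2.
move=> B aB; rewrite ipC [in RHS]ipC; apply: chaos_functional gc.
- by apply: MI_L2; exact: L2_cube aB.
- exact: L2_cube aB.
by move=> C aC; rewrite ip_I// eqxx (ip_cube _ aC aB).
Qed.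

Lemma chaos_orthogonal n k (f : n.-tuple E -> R) (g : k.-tuple E -> R) : n != k ->
  chaos_space f -> chaos_space g -> ip P (@MI n f) (@MI k g) = 0.
Proof.
(* Orthogonality is the case [c = 0] of [chaos_functional], with a dummy [g]. *)
move=> nk fc gc; rewrite -(mul0r (ip (mun n) f (cst 0))).
apply: chaos_functional fc; [by apply: MI_L2; exact: chaos_L2|exact: L2_cst0|].
move=> B aB; rewrite mul0r ipC -(mul0r (ip (mun k) g (cst 0))).
apply: chaos_functional gc; [by apply: MI_L2; exact: L2_cube aB|exact: L2_cst0|].
by move=> C aC; rewrite ip_I// eq_sym (negbTE nk) mul0r.
Qed.

Implicit Types (F G : Omega -> R) (f g : forall n, n.-tuple E -> R).

(** Degree 0 is included; it will carry the mean. *)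
Definition partial_chaos f M : Omega -> R :=
  fun w => \sum_(n < M) @MI n (f n) w.

Lemma L2_partial_chaos f M : (forall n, chaos_space (f n)) ->
  partial_chaos f M \in Lfun P 2%:E.
Proof. by move=> fc; apply: L2_sum => n _; apply: MI_L2; exact: chaos_L2. Qed.

Lemma ip_partial_chaos f g M : (forall n, chaos_space (f n)) ->
  (forall n, chaos_space (g n)) ->
  ip P (partial_chaos f M) (partial_chaos g M) =
  \sum_(n < M) n`!%:R * ip (mun n) (f n) (g n).
Proof.
move=> fc gc; rewrite /partial_chaos ip_suml; last 2 first.
- by move=> n _; apply: MI_L2; exact: chaos_L2.
- exact: L2_partial_chaos.
apply: eq_bigr => n _; rewrite ip_sumr; last 2 first.
- by move=> k _; apply: MI_L2; exact: chaos_L2.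
- by apply: MI_L2; exact: chaos_L2.
rewrite (bigD1 n)//= chaos_isometry// big1 ?addr0// => k kn.
by rewrite chaos_orthogonal// eq_sym.
Qed.

Lemma partial_chaos_lin (a : R) f g M : (forall n, chaos_space (f n)) ->
  (forall n, chaos_space (g n)) ->
  partial_chaos (fun n => a \*: f n \+ g n) M =
  a \*: partial_chaos f M \+ partial_chaos g M %[ae P].
Proof.
move=> fc gc; rewrite (_ : a \*: _ \+ _ =
  (fun w => \sum_(n < M) (a *: @MI n (f n) w + @MI n (g n) w))); last first.
  by apply/funext => w /=; rewrite /partial_chaos big_split/= scaler_sumr.
apply: ae_eq_sum => n _.
exact: (I_lin linI a (chaos_L2 (fc n)) (chaos_L2 (gc n))).
Qed.

Definition expands F f := [/\ F \in Lfun P 2%:E, forall n, chaos_space (f n) &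
  L2cvg P (partial_chaos f) F].

Lemma expands_lin (a : R) F G f g : expands F f -> expands G g ->
  expands (a \*: F \+ G) (fun n => a \*: f n \+ g n).
Proof.
move=> [F2 fc Ff] [G2 gc Gg]; split; first exact: L2_lin.
  by move=> n; exact: chaos_lin.
have fM M := L2_partial_chaos M fc; have gM M := L2_partial_chaos M gc.
have sM M := L2_partial_chaos M (fun n => chaos_lin a (fc n) (gc n)).
have := L2cvg_lin a fM gM F2 G2 Ff Gg.
move=> /(L2cvgP (fun M => L2_lin a (fM M) (gM M)) (L2_lin a F2 G2)) h.
apply/(L2cvgP sM (L2_lin a F2 G2)).
rewrite (_ : (fun k => _) = fun k =>
  ip P (a \*: partial_chaos f k \+ partial_chaos g k \- (a \*: F \+ G))
  (a \*: partial_chaos f k \+ partial_chaos g k \- (a \*: F \+ G)))//.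
apply/funext => M; have H := partial_chaos_lin a M fc gc.
by apply: ip_ae; (try by apply: L2B => //; apply: L2_lin);
  apply: filterS H => w /(_ I) + _ /= => ->.
Qed.

Lemma expandsB F G f g : expands F f -> expands G g ->
  expands (F \- G) (fun n => f n \- g n).
Proof.
move=> Ff Gg; have := expands_lin (-1) Gg Ff.
rewrite (_ : -1 \*: G \+ F = F \- G); last first.
  by apply/funext => w /=; rewrite scaleN1r addrC.
rewrite (_ : (fun n => _) = fun n => f n \- g n)//.
apply: functional_extensionality_dep => n.
by apply/funext => t /=; rewrite scaleN1r addrC.
Qed.

(** Parseval's identity, by continuity of the norm. *)
Lemma expands_norm F f : expands F f ->
  \sum_(n < M) n`!%:R * ip (mun n) (f n) (f n) @[M --> \oo] --> ip P F F.
Proof.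
move=> [F2 fc Ff]; have fM M := L2_partial_chaos M fc.
under eq_fun => M do rewrite -ip_partial_chaos//.
exact: L2cvg_ip.
Qed.

Lemma expands_norm_le F f M : expands F f ->
  \sum_(n < M) n`!%:R * ip (mun n) (f n) (f n) <= ip P F F.
Proof.
move=> /expands_norm h; rewrite -(cvg_lim _ h)//.
have nd : nondecreasing_seq (fun M => \sum_(n < M) n`!%:R * ip (mun n) (f n) (f n)).
  apply/nondecreasing_seqP => k; rewrite big_ord_recr/= lerDl.
  by rewrite mulr_ge0// ip_ge0.
by apply: nondecreasing_cvgn_le => //; apply/cvg_ex; exists (ip P F F).
Qed.

(** Bessel's inequality with [n! >= 1]: it lets convergence of the variables force convergence of
    the coefficients in each degree. *)
Lemma expands_coef_le F f n : expands F f ->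
  ip (mun n) (f n) (f n) <= ip P F F.
Proof.
move=> /(expands_norm_le n.+1); apply: le_trans.
rewrite big_ord_recr/= ler_wpDl//.
  by apply: sumr_ge0 => i _; rewrite mulr_ge0// ip_ge0.
by rewrite ler_peMl ?ip_ge0// ler1n fact_gt0.
Qed.

(** In each degree the coefficients of [Fk k] form a Cauchy sequence, since those of [Fk k \- Fk l]
    are bounded by its norm; [f] collects the limits. The control is uniform in the truncation [M]:
    Bessel for [Fk k \- Fk l], as [l] tends to infinity, bounds the distance between the partial
    sums of [fk k] and [f] by that between [Fk k] and [F]. *)
Lemma expands_closed (Fk : nat -> Omega -> R) F
  (fk : nat -> forall n, n.-tuple E -> R) :
  (forall k, expands (Fk k) (fk k)) -> F \in Lfun P 2%:E -> L2cvg P Fk F ->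
  exists f, expands F f.
Proof.
move=> Fe F2 FF.
have Fk2 k : Fk k \in Lfun P 2%:E by case: (Fe k).
have fc k n : chaos_space (fk k n) by case: (Fe k).
have f2 k n := chaos_L2 (fc k n).
have d2 k : Fk k \- F \in Lfun P 2%:E by exact: L2B.
have F0 : ip P (Fk k \- F) (Fk k \- F) @[k --> \oo] --> 0 by apply/L2cvgP.
have Fkl k l : ip P (Fk k \- Fk l) (Fk k \- Fk l) <=
    2 * (ip P (Fk k \- F) (Fk k \- F) + ip P (Fk l \- F) (Fk l \- F)).
  rewrite (_ : ip P (Fk l \- F) (Fk l \- F) = ip P (F \- Fk l) (F \- Fk l)).
    rewrite (_ : Fk k \- Fk l = (Fk k \- F) \+ (F \- Fk l)).
      by apply: ip_add_le => //; exact: L2B.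
    by apply/funext => w /=; rewrite addrA subrK.
  by apply: eq_Rintegral => w _ /=; ring.
have Cauchy n (e : R) : 0 < e -> exists K, forall k l, (K <= k)%N -> (K <= l)%N ->
    ip (mun n) (fk k n \- fk l n) (fk k n \- fk l n) <= e.
  move=> e0; move/cvgrPdist_le : F0 => /(_ (e / 4)); rewrite divr_gt0// => /(_ isT).
  move=> [K _ HK]; exists K => k l Kk Kl.
  apply: (le_trans (expands_coef_le n (expandsB (Fe k) (Fe l)))).
  apply: (le_trans (Fkl k l)).
  have := HK k Kk; have := HK l Kl; rewrite !sub0r !normrN !ger0_norm ?ip_ge0//.
  lra.
have [f Hf] : {f : forall n, n.-tuple E -> R & forall n, chaos_space (f n) /\
    L2cvg (mun n) (fun k => fk k n) (f n)}.
  suff h n : exists g : n.-tuple E -> R, chaos_space g /\ L2cvg (mun n) (fun k => fk k n) g.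
    by exists (fun n => sval (cid (h n))) => n; case: (cid (h n)).
  have [phi [g2 gcv]] := L2_complete (fun k => f2 k n) (Cauchy n).
  set g := (fun x => _) in g2 gcv; exists g; split => //.
  (* Symmetry must hold at every point, and it passes through the pointwise upper limit; an
     arbitrary [L^2] limit would keep it only almost everywhere. *)
  apply: chaos_lim g2 _ gcv => // s t.
  congr (fine (limn_esup _)); apply/funext => j; congr EFin.
  exact: chaos_symmetric.
have fcn n := (Hf n).1.
exists f; split => //.
have fM M := L2_partial_chaos M fcn.
have fkM k M := L2_partial_chaos M (fc k).
apply/(L2cvgP fM F2); apply/cvgrPdist_le => e e0.
(* Two applications of [ip_add_le] split the error through [partial_chaos (fk k) M] and [Fk k]. *)
have le3 k M : ip P (partial_chaos f M \- F) (partial_chaos f M \- F) <=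
  2 * (2 * (ip P (partial_chaos (fk k) M \- partial_chaos f M)
      (partial_chaos (fk k) M \- partial_chaos f M)
    + ip P (partial_chaos (fk k) M \- Fk k) (partial_chaos (fk k) M \- Fk k))
    + ip P (Fk k \- F) (Fk k \- F)).
  rewrite (_ : partial_chaos f M \- F = ((\- (partial_chaos (fk k) M \- partial_chaos f M)) \+
     (partial_chaos (fk k) M \- Fk k)) \+ (Fk k \- F)); last first.
    by apply/funext => w /=; ring.
  have N2 : \- (partial_chaos (fk k) M \- partial_chaos f M) \in Lfun P 2%:E.
    rewrite (_ : \- _ = partial_chaos f M \- partial_chaos (fk k) M); first exact: L2B.
    by apply/funext => w /=; ring.
  apply: le_trans (ip_add_le _ _) _ => //; first by apply: L2D => //; exact: L2B.
  rewrite ler_pM2l// lerD2r.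
  apply: le_trans (ip_add_le _ _) _ => //; first exact: L2B.
  rewrite ler_pM2l// lerD2r.
  by rewrite le_eqVlt; apply/orP; left; apply/eqP; apply: eq_Rintegral => w _ /=; ring.
have pcvg M : L2cvg P (fun l => partial_chaos (fk l) M) (partial_chaos f M).
  elim: M => [|M IH].
    rewrite (_ : partial_chaos f 0 = cst 0).
      rewrite (_ : (fun l => _) = fun=> cst 0); first exact: L2cvg_cst (L2_cst0 P).
      by apply/funext => l; apply/funext => w; rewrite /partial_chaos big_ord0.
    by apply/funext => w; rewrite /partial_chaos big_ord0.
  have pcS g : partial_chaos g M.+1 = partial_chaos g M \+ @MI M (g M).
    by apply/funext => w; rewrite /partial_chaos big_ord_recr.
  rewrite pcS (_ : (fun l => _) = fun l => partial_chaos (fk l) M \+ @MI M (fk l M)).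
    apply: L2cvgD => //.
    - by move=> l; apply: MI_L2; exact: f2.
    - by apply: MI_L2; exact: chaos_L2.
    - apply: (I_cvg linI); [by move=> l; exact: f2|exact: chaos_L2|].
      by case: (Hf M).
  by apply/funext => l; rewrite pcS.
have diffM k M : ip P (partial_chaos (fk k) M \- partial_chaos f M)
    (partial_chaos (fk k) M \- partial_chaos f M) <= ip P (Fk k \- F) (Fk k \- F).
  have l1 : ip P (partial_chaos (fk k) M \- partial_chaos (fk l) M)
      (partial_chaos (fk k) M \- partial_chaos (fk l) M) @[l --> \oo] -->
    ip P (partial_chaos (fk k) M \- partial_chaos f M)
      (partial_chaos (fk k) M \- partial_chaos f M).
    have c : L2cvg P (fun l => partial_chaos (fk k) M \- partial_chaos (fk l) M)
        (partial_chaos (fk k) M \- partial_chaos f M).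
      by apply: L2cvgB => //; exact: L2cvg_cst.
    by apply: L2cvg_ip => //; try move=> l; exact: L2B.
  have l2 : ip P (Fk k \- Fk l) (Fk k \- Fk l) @[l --> \oo] --> ip P (Fk k \- F) (Fk k \- F).
    have c : L2cvg P (fun l => Fk k \- Fk l) (Fk k \- F).
      by apply: L2cvgB => //; exact: L2cvg_cst.
    by apply: L2cvg_ip => //; try move=> l; exact: L2B.
  apply: ler_cvg_to l1 l2 _; apply: nearW => l.
  have := expands_norm_le M (expandsB (Fe k) (Fe l)); apply: le_trans.
  rewrite le_eqVlt; apply/orP; left; apply/eqP.
  rewrite ip_sub// !ip_partial_chaos// mulr_sumr -sumrB -big_split/=.
  apply: eq_bigr => n _; rewrite /= ip_sub; [|exact: f2|exact: f2].
  by rewrite mulrDr mulrBr [in RHS]mulrCA.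
(* With [x <= e / 12] here and [y <= e / 8] for the truncation of [Fk k], the bound
   [2 (2 (x + y) + x)] is at most [e]. *)
have [k kE] : exists k, ip P (Fk k \- F) (Fk k \- F) <= e / 12.
  move/cvgrPdist_le : F0 => /(_ (e / 12)); rewrite divr_gt0// => /(_ isT).
  move=> [K _ HK]; exists K; have := HK K (leqnn K).
  by rewrite sub0r normrN ger0_norm// ip_ge0.
have [_ _ /(L2cvgP (fkM k) (Fk2 k)) /cvgrPdist_le /(_ (e / 8))] := Fe k.
rewrite divr_gt0// => /(_ isT); apply: filterS => M.
rewrite !sub0r !normrN !ger0_norm ?ip_ge0// => hM.
have := le3 k M; have := diffM k M.
lra.
Qed.

End chaos_expansion.

(** * Expansion of the void indicators *)

Section void_expansion.
Context (R : realType) (dO : measure_display) (Omega : measurableType dO)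
  (P : probability Omega R) (dE : measure_display) (E : measurableType dE)
  (mu : {sigma_finite_measure set E -> \bar R}) (D : set E)
  (N : R.-ker Omega ~> E) (MI : forall n, (n.-tuple E -> R) -> Omega -> R).
Local Notation adm := (admissible mu D).
Local Notation mun := (power_measure mu).
Hypothesis lawN : forall A, adm A -> poisson_law P (fine (mu A)) (N^~ A).
Hypothesis linI : forall n, L2_continuous_linear (mun n) P (@MI n).
Hypothesis ip_I : forall n k B C, adm B -> adm C ->
  ip P (@MI n (cube n B)) (@MI k (cube k C)) =
  if n == k then n`!%:R * fine (mu (B `&` C)) ^+ n else 0.
Hypothesis ip_void_I : forall n B, adm B ->
  ip P (void N B) (@MI n (cube n B)) =
  expR (- fine (mu B)) * (-1) ^+ n * fine (mu B) ^+ n.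

Lemma I_scale n (a : R) f : f \in Lfun (mun n) 2%:E ->
  @MI n (a \*: f) = a \*: @MI n f %[ae P].
Proof.
move=> f2; have c2 := L2_cst0 (mun n).
have := I_lin linI a f2 c2; rewrite (_ : a \*: f \+ cst 0 = a \*: f); last first.
  by apply/funext => x /=; rewrite addr0.
apply: filterS2 (I_cst0 linI n) => w /(_ I) /= h /(_ I) /= -> _.
by rewrite h addr0.
Qed.

Lemma chaos_scale n (a : R) f : chaos_space mu D f ->
  chaos_space mu D (n := n) (a \*: f).
Proof.
move=> fc; rewrite (_ : a \*: f = (a - 1) \*: f \+ f); first exact: chaos_lin.
by apply/funext => x /=; rewrite scalerBl scale1r subrK.
Qed.

(** When [b > 0], [c n] is a projection coefficient: the inner product [e^(-b) (-b)^n] of the void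
    indicator with the integral of the cube, divided by the squared norm [n! b^n]. Accordingly [E1]
    and [E2] agree, and the squared error is [e^(-b) - e^(-2b) sum_(n < M) b^n / n!], which tends to
    0. *)
Lemma void_expands B : adm B -> exists f, expands P mu D MI (void N B) f.
Proof.
move=> aB; have [mB _ _] := aB; set b := fine (mu B).
pose c n : R := expR (- b) * (-1) ^+ n / n`!%:R.
pose f n := c n \*: cube n B : n.-tuple E -> R.
have fc n : chaos_space mu D (f n) by apply: chaos_scale; exact: chaos_cube.
have v2 : void N B \in Lfun P 2%:E by exact: L2_void.
have p2 M : partial_chaos MI f M \in Lfun P 2%:E by exact: (L2_partial_chaos linI).
have K2 n : @MI n (cube n B) \in Lfun P 2%:E.
  by apply: (I_L2 linI); exact: L2_cube aB.
have fact_neq0 n : n`!%:R != 0 :> R by rewrite pnatr_eq0 -lt0n fact_gt0.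
have sgn2 n : (-1) ^+ n * (-1) ^+ n = 1 :> R by rewrite -exprMn mulrNN mulr1 expr1n.
exists f; split => //.
have E1 M : ip P (partial_chaos MI f M) (partial_chaos MI f M) =
    expR (- b) ^+ 2 * \sum_(n < M) b ^+ n / n`!%:R.
  rewrite (ip_partial_chaos linI ip_I)// mulr_sumr; apply: eq_bigr => n _.
  have -> : ip (mun n) (f n) (f n) = c n ^+ 2 * b ^+ n.
    have c2 := L2_cube n aB.
    rewrite -[b ^+ n](_ : ip (mun n) (cube n B) (cube n B) = _); last first.
      by rewrite (ip_cube _ aB aB) setIid.
    have fE : f n = c n \*: cube n B \+ cst 0.
      by apply/funext => x /=; rewrite addr0.
    rewrite fE ip_linl ?ip_linr ?L2_lin ?L2_cst0// !(ipC _ _ (cst 0)) !ip0l.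
    by ring.
  rewrite /c; transitivity
    (n`!%:R * (expR (- b) ^+ 2 * ((-1) ^+ n * (-1) ^+ n) * b ^+ n / n`!%:R ^+ 2)).
    by set u := n`!%:R; set s := (-1) ^+ n; rewrite expr2 -expr2 !exprMn exprVn expr2; ring.
  rewrite sgn2; set u := n`!%:R; have u0 : u != 0 := fact_neq0 n.
  by field.
have E2 M : ip P (partial_chaos MI f M) (void N B) =
    expR (- b) ^+ 2 * \sum_(n < M) b ^+ n / n`!%:R.
  rewrite /partial_chaos ip_suml//; last first.
    by move=> n _; apply: (I_L2 linI); exact: chaos_L2.
  rewrite mulr_sumr; apply: eq_bigr => n _.
  have -> : ip P (@MI n (f n)) (void N B) = c n * ip P (void N B) (@MI n (cube n B)).
    rewrite -(ipC _ (@MI n (cube n B))) -[RHS]addr0 -(ip0l P (void N B)) -ip_linl ?L2_cst0//.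
    apply: ip_ae => //.
    - by apply: (I_L2 linI); exact: chaos_L2.
    - by apply: L2_lin => //; exact: L2_cst0.
    - apply: filterS (I_scale (c n) (L2_cube n aB)) => w /(_ I) h _.
      by rewrite /f h /= addr0.
    - exact: nearW.
  rewrite ip_void_I// -/b /c.
  transitivity (expR (- b) ^+ 2 * (((-1) ^+ n * (-1) ^+ n) * b ^+ n / n`!%:R)).
    by rewrite expr2; ring.
  by rewrite sgn2 mul1r.
have E3 : ip P (void N B) (void N B) = expR (- b).
  exact: (ip_void lawN aB).
apply/L2cvgP => //.
rewrite (_ : (fun k => _) = fun M => expR (- b) - expR (- b) ^+ 2 *
    series (exp_coeff b) M); last first.
  apply/funext => M; rewrite ip_sub// E1 E2 E3 /series/= big_mkord.
  by ring.
rewrite (_ : 0 = expR (- b) - expR (- b) ^+ 2 * expR b); last first.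
  by rewrite expr2 -mulrA -expRD addNr expR0 mulr1 subrr.
apply: cvgB; first exact: cvg_cst.
apply: cvgMr; exact: is_cvg_series_exp_coeff.
Qed.

End void_expansion.

(** * Variables measurable with respect to the void events *)

Section void_sigma_field.
Context (R : realType) (dO : measure_display) (Omega : measurableType dO)
  (P : probability Omega R) (dE : measure_display) (E : measurableType dE)
  (mu : {measure set E -> \bar R}) (D : set E) (N : R.-ker Omega ~> E).
Local Notation adm := (admissible mu D).

(* Null sets are included so that a.e. limits stay measurable. *)
Definition void_system : set (set Omega) :=
  [set A | measurable A /\ (P A = 0 \/
    exists2 B, adm B & (\1_A : Omega -> R) = void N B %[ae P])].

(** An intersection with a null set is null; otherwise [void_setU] identifies it with the void event
    of the union. *)
Lemma void_systemI : setI_closed void_system.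
Proof.
move=> A A' [mA hA] [mA' hA']; split; first exact: measurableI.
have null (U V : set Omega) : measurable U -> measurable V -> P U = 0 -> P (U `&` V) = 0.
  move=> mU mV U0; apply/eqP; rewrite eq_le measure_ge0 andbT -U0.
  by rewrite le_measure ?inE//; exact: measurableI.
case: hA => [A0|[B aB AB]]; first by left; exact: null.
case: hA' => [A'0|[B' aB' AB']]; first by left; rewrite setIC; exact: null.
have [mB _ _] := aB; have [mB' _ _] := aB'.
right; exists (B `|` B'); first exact: admissibleU.
apply: filterS2 AB AB' => w /(_ I) h /(_ I) h' _.
by rewrite indicI /= h h' void_setU.
Qed.

Definition void_measurable (Y : Omega -> R) :=
  forall C : set R, measurable C -> <<s void_system>> (Y @^-1` C).

Lemma void_measurableP (Y : Omega -> R) : void_measurable Y <->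
  @measurable_fun _ _ (g_sigma_algebraType void_system) _ setT Y.
Proof.
split => [h _ C mC|h C mC]; first by rewrite setTI; exact: h.
by rewrite -[X in smallest _ _ X]setTI; apply: h => //; exact: measurableT.
Qed.

Lemma void_measurable_ae (Y Z : Omega -> R) : void_measurable Y ->
  measurable_fun setT Z -> Y = Z %[ae P] -> void_measurable Z.
Proof.
move=> vY mZ [U [mU U0 YZ]] C mC.
have YZU w : ~ U w -> Y w = Z w.
  by move=> Uw; apply: contrapT => h; apply: Uw; apply: YZ => /= /(_ I).
(* Outside the null set [U] the preimages agree; inside it every measurable set is null and hence a
   generator. *)
have -> : Z @^-1` C = (Y @^-1` C `\` U) `|` (Z @^-1` C `&` U).
  apply/seteqP; split => w /=.
    by move=> CZ; have [Uw|Uw] := pselect (U w); [right|left; rewrite YZU].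
  by move=> [[CY Uw]|[]//]; rewrite -YZU.
have mZC : measurable (Z @^-1` C) by rewrite -[X in measurable X]setTI; exact: mZ.
have sU (V : set Omega) : measurable V -> P V = 0 -> <<s void_system>> V.
  by move=> mV V0; apply: sub_gen_smallest; split => //; left.
pose T' := g_sigma_algebraType void_system.
apply: (@measurableU _ T').
  by apply: (@measurableD _ T'); [exact: vY|exact: sU].
apply: sU; first exact: measurableI.
apply/eqP; rewrite eq_le measure_ge0 andbT -U0 le_measure ?inE//.
exact: measurableI.
Qed.

Lemma void_measurable_lin (a : R) (Y Z : Omega -> R) : void_measurable Y ->
  void_measurable Z -> void_measurable (a \*: Y \+ Z).
Proof.
move=> /void_measurableP vY /void_measurableP vZ; apply/void_measurableP.
by apply: measurable_funD => //; apply: measurable_funM.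
Qed.

Lemma void_measurable_cvg (u : nat -> Omega -> R) (Y : Omega -> R) :
  (forall k, void_measurable (u k)) -> measurable_fun setT Y ->
  {ae P, forall w, u k w @[k --> \oo] --> Y w} -> void_measurable Y.
Proof.
move=> vu mY uY.
apply: (@void_measurable_ae (fun w => fine (limn_esup (fun k => (u k w)%:E)))) => //.
  apply/void_measurableP; apply: measurableT_comp; first exact: fine_measurable.
  apply: measurable_fun_limn_esup => k; apply/measurable_EFinP.
  exact/void_measurableP.
apply: filterS uY => w /cvg_EFinP h _.
by rewrite (cvg_limn_einf_sup h).
Qed.

(** A subsequence whose squared errors are at most [2^-(j+1)] converges almost everywhere. *)
Lemma void_measurable_L2cvg (u : nat -> Omega -> R) (Y : Omega -> R) :
  (forall k, void_measurable (u k)) -> (forall k, u k \in Lfun P 2%:E) ->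
  Y \in Lfun P 2%:E -> L2cvg P u Y -> void_measurable Y.
Proof.
move=> vu u2 Y2 /(L2cvgP u2 Y2) /cvgrPdist_le uY.
have h (j : nat) : exists k, ip P (u k \- Y) (u k \- Y) <= 1 / (2 ^ j.+1)%:R.
  have [|K _ HK] := uY (1 / (2 ^ j.+1)%:R); first by rewrite divr_gt0// ltr0n expn_gt0.
  exists K; have := HK K (leqnn K).
  by rewrite sub0r normrN ger0_norm// ip_ge0.
have [phi Hphi] := choice h.
have d2 k : u k \- Y \in Lfun P 2%:E by apply: L2B.
apply: (@void_measurable_cvg (fun j => u (phi j))).
- by move=> j; exact: vu.
- exact: L2_measurable Y2.
have ae0 : {ae P, forall w, (u (phi j) w - Y w) ^+ 2 @[j --> \oo] --> 0}.
  apply: summable_integral_ae_cvg0.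
  - by move=> j; apply: measurable_funX; exact: L2_measurable (d2 _).
  - by move=> j w; exact: sqr_ge0.
  apply: (@le_lt_trans _ _ (\sum_(0 <= j <oo) (1 / (2 ^ j.+1)%:R)%:E)%E).
    apply: lee_nneseries => [j _ _|j _].
      by apply: integral_ge0 => w _; rewrite lee_fin sqr_ge0.
    by have := Hphi j; rewrite -lee_fin EFin_ip_sqr.
  by apply: le_lt_trans (epsilon_trick0 xpredT ler01) (ltry _).
apply: filterS ae0 => w /= h0.
suff : u (phi j) w - Y w @[j --> \oo] --> 0.
  by move=> h1; apply/subr_cvg0.
apply: norm_cvg0; rewrite -(sqrtr0 R); under eq_fun do rewrite -sqrtr_sqr.
by apply: continuous_cvg => //; exact: sqrt_continuous.
Qed.

Lemma subset_void_sigma_field (H : set (set Omega)) : dynkin H ->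
  void_system `<=` H -> <<s void_system>> `<=` H.
Proof.
move=> dH vH; rewrite -(setI_closed_g_dynkin_g_sigma_algebra void_systemI).
exact: smallest_sub.
Qed.

End void_sigma_field.

(** * Expansion of every variable measurable for the void field *)

Section chaos_density.
Context (R : realType) (dO : measure_display) (Omega : measurableType dO)
  (P : probability Omega R) (dE : measure_display) (E : measurableType dE)
  (mu : {sigma_finite_measure set E -> \bar R}) (D : set E)
  (N : R.-ker Omega ~> E) (MI : forall n, (n.-tuple E -> R) -> Omega -> R).
Local Notation adm := (admissible mu D).
Local Notation mun := (power_measure mu).
Hypothesis linI : forall n, L2_continuous_linear (mun n) P (@MI n).
Hypothesis ip_I : forall n k B C, adm B -> adm C ->
  ip P (@MI n (cube n B)) (@MI k (cube k C)) =
  if n == k then n`!%:R * fine (mu (B `&` C)) ^+ n else 0.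
Hypothesis void_exp : forall B, adm B -> exists f, expands P mu D MI (void N B) f.

Let expandable F := exists f, expands P mu D MI F f.

Let expandable_lin (a : R) F G : expandable F -> expandable G ->
  expandable (a \*: F \+ G).
Proof.
by move=> [f Ff] [g Gg]; exists (fun n => a \*: f n \+ g n); exact: expands_lin.
Qed.

Let expandable_cvg (Fk : nat -> Omega -> R) F : (forall k, expandable (Fk k)) ->
  F \in Lfun P 2%:E -> L2cvg P Fk F -> expandable F.
Proof.
move=> /choice[fk Fke] F2 FF.
exact: (expands_closed linI ip_I Fke F2 FF).
Qed.

Let expandable_L2 F : expandable F -> F \in Lfun P 2%:E.
Proof. by move=> [f []]. Qed.

Let expandable_ae F G : expandable F -> G \in Lfun P 2%:E -> F = G %[ae P] ->
  expandable G.
Proof.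
move=> Fe G2 FG; apply: (expandable_cvg (Fk := fun=> F)) => //.
by apply: L2cvg_cst_ae => //; exact: expandable_L2.
Qed.

Let L2_indicP (A : set Omega) : measurable A -> (\1_A : Omega -> R) \in Lfun P 2%:E.
Proof.
move=> mA; apply: L2_indic => //.
by rewrite -ge0_fin_numE//; exact: fin_num_measure.
Qed.

(** The empty set never has points, so the constant 1 is a void indicator. *)
Let expandable1 : expandable (cst 1).
Proof.
have h := void_exp (admissible0 mu D).
rewrite (_ : cst 1 = void N set0); first exact: h.
by apply/funext => w; rewrite /void measure0 indicE mem_set.
Qed.

Let expandable0 : expandable (cst 0).
Proof.
have := expandable_lin (-1) expandable1 expandable1.
by congr expandable; apply/funext => w /=; rewrite scaleN1r addNr.
Qed.

(** The sets with an expandable indicator form a Dynkin class: complements use the constant 1,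
    disjoint countable unions the [L^2] limit along partial unions. *)
Lemma expands_indic A : <<s void_system P mu D N>> A ->
  exists f, expands P mu D MI (\1_A) f.
Proof.
pose H := [set A : set Omega | measurable A /\ expandable \1_A].
suff : <<s void_system P mu D N>> `<=` H by move=> /[apply] -[].
apply: subset_void_sigma_field.
  split.
  - by split; [exact: measurableT|rewrite indicT; exact: expandable1].
  - move=> B [mB eB]; split; first exact: measurableC.
    have := expandable_lin (-1) eB expandable1.
    congr expandable; apply/funext => w /=; rewrite scaleN1r !indicE in_setC.
    by case: (_ \in _); rewrite /= ?addNr// oppr0 add0r.
  - move=> B tB HB; have mB n : measurable (B n) by case: (HB n).
    have mU : measurable (\bigcup_k B k) by exact: bigcup_measurable.
    split => //.
    (* The squared [L^2] distance from a partial union to the full one is the missing probability,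
       which tends to 0. *)
    pose G n := \big[setU/set0]_(i < n) B i.
    have mG n : measurable (G n) by apply: bigsetU_measurable.
    have eG n : expandable \1_(G n).
      elim: n => [|n IH]; first by rewrite /G big_ord0 indic0; exact: expandable0.
      have := expandable_lin 1 (HB n).2 IH; congr expandable.
      apply/funext => w /=; rewrite scale1r /G big_ord_recr/=.
      have : ~ ((\big[setU/set0]_(i < n) B i) w /\ B n w).
        rewrite -bigcup_mkord => -[[i /= i_n Biw] Bnw].
        have : i = n by apply: tB => //; exists w.
        by move=> E'; rewrite E' ltnn in i_n.
      rewrite -/(G n) !indicE in_setU => h.
      case: (boolP (w \in G n)) => [/set_mem Gw|_]; last by rewrite /= addr0.
      by rewrite memNset ?add0r// => Bw; apply: h.
    apply: (expandable_cvg eG); first exact: L2_indicP.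
    apply/L2cvgP; [by move=> n; exact: L2_indicP|exact: L2_indicP|].
    have GU n : G n `<=` \bigcup_k B k.
      by rewrite /G -bigcup_mkord => w [i _ Biw]; exists i.
    rewrite (_ : (fun k => _) =
      fun k => fine (P (\bigcup_k B k)) - fine (P (G k))); last first.
      apply/funext => k; rewrite ip_sub; [|exact: L2_indicP|exact: L2_indicP].
      rewrite !ip_indic// !setIid.
      have -> : G k `&` \bigcup_k B k = G k by apply/setIidPl; exact: GU.
      by ring.
    rewrite -(subrr (fine (P (\bigcup_k B k)))); apply: cvgB; first exact: cvg_cst.
    have := @nondecreasing_cvg_mu _ _ _ P G mG.
    have -> : \bigcup_n G n = \bigcup_n B n.
      apply/seteqP; split => w [n _]; first by move/GU.
      by move=> Bn; exists n.+1 => //; rewrite /G -bigcup_mkord; exists n => /=.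
    move=> /(_ mU) h; apply: fine_cvg; rewrite fineK; last exact: fin_num_measure.
    apply: h => n k nk; rewrite subsetEset /G -!bigcup_mkord.
    by apply: bigcup_subset => i /= /leq_trans; apply.
(* The generators: the indicator of a null set is 0 almost everywhere, that of a void event equals
   some [void N B] almost everywhere. *)
move=> A' [mA' [A'0|[B aB AB]]]; split => //.
  apply: (expandable_ae expandable0); first exact: L2_indicP.
  exists A'; split => // w /= h; apply: contrapT => A'w; apply: h => _.
  by rewrite indicE memNset.
apply: (expandable_ae (void_exp aB)); first exact: L2_indicP.
by apply: filterS AB => w /(_ I) ->.
Qed.

Lemma void_measurable_expands F : F \in Lfun P 2%:E ->
  void_measurable P mu D N F -> exists f, expands P mu D MI F f.
Proof.
move=> F2 vF; apply: (L2_indicator_induction (W := expandable) _ _ F2).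
- by move=> a g h _ _; exact: expandable_lin.
- by move=> u g _ g2 eu; exact: expandable_cvg.
- by move=> C mC _ _; apply: expands_indic; exact: vF.
Qed.

End chaos_density.

(** * Recovering the counts from the void events *)

Section counts_void_measurable.
Context (R : realType) (dO : measure_display) (Omega : measurableType dO)
  (P : probability Omega R) (dE : measure_display) (E : measurableType dE)
  (mu : {measure set E -> \bar R}) (D : set E) (N : R.-ker Omega ~> E).
Local Notation adm := (admissible mu D).
Hypothesis lawN : forall A, adm A -> poisson_law P (fine (mu A)) (N^~ A).
Hypothesis mu_diffuse : diffuse mu D.

Lemma void_measurable_void A : adm A -> void_measurable P mu D N (void N A).
Proof.
move=> aA; have [mA _ _] := aA; apply/void_measurableP; rewrite voidE.
apply: measurable_indic; apply: sub_gen_smallest; split.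
  exact: measurable_void.
by right; exists A => //; exact: nearW.
Qed.

(** Bounds the mean number of points beyond the first in a cell of mass [x]. After multiplication by
    [1 + x], the inequality [expR (- x) * (1 + x) <= 1] reduces the claim to
    [x ^ 2 <= x ^ 2 * (1 + x)]. *)
Lemma expRN_le (x : R) : 0 <= x -> x - 1 + expR (- x) <= x ^+ 2.
Proof.
move=> x0; have h := expR_ge1Dx x.
have h1 : expR (- x) * (1 + x) <= 1.
  apply: (@le_trans _ _ (expR (- x) * expR x)).
    by rewrite ler_wpM2l// expR_ge0.
  by rewrite -expRD addNr expR0.
have x3 : 0 <= x ^+ 3 by rewrite exprn_ge0.
have x1 : 0 < 1 + x by lra.
rewrite -(ler_pM2r x1); apply: (@le_trans _ _ ((x - 1) * (1 + x) + 1)).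
  by rewrite mulrDl lerD2l.
rewrite -subr_ge0 (_ : _ - _ = x ^+ 3)//; ring.
Qed.

(** [X] counts the nonempty cells of a subdivision into cells of mass at most [e]. A cell of mass
    [m] loses on average [m - 1 + e^(-m) <= m ^ 2 <= e * m], and the masses sum to that of [A]. *)
Lemma count_approximation A (e : R) : adm A -> 0 < e ->
  exists X : Omega -> R, [/\ void_measurable P mu D N X, measurable_fun setT X &
    (\int[P]_w `|fine (N w A) - X w|%:E <= (e * fine (mu A))%:E)%E].
Proof.
move=> aA e0; have [J [B [aB tB Be AE]]] := mu_diffuse aA e0.
have mB i : measurable (B i) by have [] := aB i.
have mV i : measurable_fun setT (void N (B i)).
  by rewrite voidE; apply: measurable_indic; exact: measurable_void.
have mN i : measurable_fun setT (fun w => fine (N w (B i))).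
  apply: measurableT_comp; first exact: fine_measurable.
  exact: measurable_kernel.
have AS : A = \bigcup_(i in [set` [set: J]%SET]) B i.
  rewrite AE; apply/seteqP; split => x [i _ Bix]; exists i => //=.
exists (fun w => \sum_i (1 - void N (B i) w)); split.
- elim: (index_enum _) => [|i s IH].
    under eq_fun do rewrite big_nil.
    by apply/void_measurableP.
  under eq_fun do rewrite big_cons.
  apply/void_measurableP; apply: measurable_funD; last exact/void_measurableP.
  apply: measurable_funB => //; apply/void_measurableP.
  exact: void_measurable_void.
- by apply: measurable_sum => i; apply: measurable_funB.
have m0 i : 0 <= fine (mu (B i)) by apply: fine_ge0.
have nat_ae : {ae P, forall w, forall i, exists k : nat, N w (B i) = k%:R%:E}.
  apply: filter_forall => i; exact: (poisson_natural (m0 i) (lawN (aB i))).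
(* The points beyond the first in cell [i], a nonnegative number as soon as the count is natural. *)
pose W i w := fine (N w (B i)) - 1 + void N (B i) w.
have mW i : measurable_fun setT (W i).
  by apply: measurable_funD => //; apply: measurable_funB.
apply: (@le_trans _ _ (\int[P]_w (\sum_i `|W i w|%:E))%E).
  apply: ae_ge0_le_integral => //.
  - apply/measurable_EFinP; apply: measurableT_comp => //; apply: measurable_funB.
      apply: measurableT_comp; first exact: fine_measurable.
      by apply: measurable_kernel; have [] := aA.
    by apply: measurable_sum => i; apply: measurable_funB.
  - by move=> w _; apply: sume_ge0 => i _; rewrite lee_fin.
  - apply: emeasurable_sum => i; apply/measurable_EFinP.
    exact: measurableT_comp.
  apply: filterS nat_ae => w hw _.
  rewrite AS measure_finite_bigcup// sumEFin lee_fin.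
  rewrite -sum_fine; last by move=> i _; have [k ->] := hw i.
  rewrite (eq_bigl xpredT); last by move=> i; exact: finset.in_setT.
  rewrite -sumrB (le_trans (ler_norm_sum _ _ _))//; apply: ler_sum => i _.
  by rewrite /W opprB addrA addrAC.
rewrite ge0_integral_sum//; last first.
  by move=> i; apply/measurable_EFinP; exact: measurableT_comp.
have W1 i : (\int[P]_w `|W i w|%:E = (fine (mu (B i)) - 1 + expR (- fine (mu (B i))))%:E)%E.
  have law := lawN (aB i).
  have N2 := poisson_L2 (m0 i) law; have V2 := L2_void P N (mB i).
  have iW : P.-integrable setT (EFin \o W i).
    apply: L2_integrable; apply: (L2D _ V2); apply: (L2B N2); exact: Lfun_cst.
  transitivity (\int[P]_w (W i w)%:E)%E.
    apply: ae_eq_integral => //.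
    - by apply/measurable_EFinP; exact: measurableT_comp.
    - exact/measurable_EFinP.
    - apply: filterS nat_ae => w hw _; have [k wk] := hw i.
      rewrite ger0_norm// /W /void wk /=.
      case: k {wk} => [|k]; first by rewrite indicE mem_set//= subrK.
      by rewrite -natr1 addrK addr_ge0.
  rewrite -[LHS]fineK; last exact: integrable_fin_num.
  congr EFin; rewrite -/(Rintegral _ _ _) RintegralD//; last 2 first.
  - by apply: L2_integrable; apply: (L2B N2); exact: Lfun_cst.
  - exact: L2_integrable.
  rewrite RintegralB//; last 2 first.
  - exact: L2_integrable.
  - by apply: (L2_integrable (f := cst 1)); exact: Lfun_cst.
  rewrite (poisson_mean (m0 i) law) Rintegral_probability_cst; congr (_ + _).
  rewrite /Rintegral integral_indic ?setIT//; last exact: measurable_void.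
  by have := poisson_void law; rewrite /= => ->.
under eq_bigr do rewrite W1.
rewrite sumEFin lee_fin [in leRHS]AS measure_finite_bigcup//.
rewrite -sum_fine; last by move=> i _; exact: admissible_fin_num (aB i).
rewrite mulr_sumr [leRHS](eq_bigl xpredT); last by move=> i; exact: finset.in_setT.
apply: ler_sum => i _; apply: le_trans (expRN_le (m0 i)) _.
by rewrite expr2 ler_wpM2r.
Qed.

(** Tolerances [2^-(j+1)] make the [L^1] errors summable, so the approximations converge almost
    everywhere to the count. *)
Lemma void_measurable_compensated A : adm A ->
  void_measurable P mu D N (compensated mu N A).
Proof.
move=> aA; have [mA _ _] := aA.
have e0 (j : nat) : 0 < 1 / (2 ^ j.+1)%:R :> R by rewrite divr_gt0// ltr0n expn_gt0.
have /choice[X HX] := fun j => count_approximation aA (e0 j).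
have mN : measurable_fun setT (fun w => fine (N w A)).
  apply: measurableT_comp; first exact: fine_measurable.
  exact: measurable_kernel.
have vN : void_measurable P mu D N (fun w => fine (N w A)).
  apply: (@void_measurable_cvg _ _ _ _ _ _ _ _ _ X) => //; first by move=> k; case: (HX k).
  have h : {ae P, forall w, `|fine (N w A) - X j w| @[j --> \oo] --> 0}.
    apply: summable_integral_ae_cvg0 => //.
    - move=> j; apply: measurableT_comp => //; apply: measurable_funB => //.
      by case: (HX j).
    - apply: (@le_lt_trans _ _ (\sum_(0 <= j <oo) (fine (mu A) / (2 ^ j.+1)%:R)%:E)%E).
        apply: lee_nneseries => [j _ _|j _]; first exact: integral_ge0.
        by have [_ _] := HX j; rewrite div1r mulrC.
      by apply: le_lt_trans (epsilon_trick0 xpredT (fine_ge0 (measure_ge0 mu A))) (ltry _).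
  apply: filterS h => w h0.
  suff : fine (N w A) - X j w @[j --> \oo] --> 0.
    move=> h1; rewrite (_ : (fun k => X k w) = fun k => fine (N w A) - (fine (N w A) - X k w)).
      by rewrite -[X in _ --> X]subr0; apply: cvgB => //; exact: cvg_cst.
    by apply/funext => k; rewrite opprB addrC subrK.
  exact: norm_cvg0.
move=> C mC; rewrite /compensated.
have /void_measurableP h := vN.
have /void_measurableP : @measurable_fun _ _
  (g_sigma_algebraType (void_system P mu D N)) _ setT
   (fun w => fine (N w A) - fine (mu A)) by apply: measurable_funB.
exact.
Qed.

End counts_void_measurable.

(** * The intensity and the noise field *)

Section intensity_facts.
Context (R : realType) (d : nat) (nu : levyMeasure R).
Local Open Scope ereal_scope.
Local Notation base :=
  ((lebesgue_measure \x power_measure lebesgue_measure d) \x levy nu).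
Implicit Types (A B : set (jumpSpace R d)) (Iv : interval R).

Lemma intensity_sub Iv A : A `<=` slab d Iv -> intensity d nu Iv A = base A.
Proof.
by move=> AI; rewrite /intensity /mrestr (_ : A `&` _ = A)//; exact/setIidPl.
Qed.

Lemma intensity_le Iv A : measurable A -> intensity d nu Iv A <= base A.
Proof.
move=> mA; rewrite /intensity /mrestr.
have h : measurable (A `&` slab d Iv).
  by apply: measurableI => //; exact: measurable_slab.
by apply: (@le_measure _ _ _ base); rewrite ?inE.
Qed.

Lemma slab_subset (T : R) : slab d `[0, T]%R `<=` slab d `[0%R, +oo[ .
Proof.
move=> [[t x] z] [[/= t0 _] z0]; split => //; split => //=.
by move: t0; rewrite /= !in_itv/= andbT => /andP[].
Qed.

Lemma base_slice (U : set R) (F : set (euclidean R d)) (G : set R) :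
  measurable (U : set (measurableTypeR R)) -> measurable F -> measurable G ->
  base ((U `*` F) `*` G) =
  lebesgue_measure U * power_measure lebesgue_measure d F * levy nu G.
Proof.
move=> mU mF mG; rewrite product_measure1E//; last exact: measurableX.
by congr (_ * _); exact: product_measure1E.
Qed.

(** Only the time coordinate is cut. A part of small mass is discarded so that space and jumps
    remain in sets of finite measure; there the mass of a time slice is proportional to its
    length. *)
Lemma intensity_diffuse (T : R) : (0 < T)%R ->
  diffuse (intensity d nu `[0%R, T]) (slab d `[0%R, T]).
Proof.
move=> T0 B e aB e0; have [mB BS Boo] := aB.
have /sigma_finiteP[F [UF ndF mF]] := sigma_finiteT (power_measure (@lebesgue_measure R) d).
have /sigma_finiteP[G [UG ndG mG]] := sigma_finiteT (levy nu).
pose S k : set (jumpSpace R d) := ([set: R] `*` F k) `*` G k.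
have mS k : measurable (S k).
  apply: measurableX; last by case: (mG k).
  by apply: measurableX; [exact: measurableT|case: (mF k)].
have ndS k l : (k <= l)%N -> S k `<=` S l.
  move=> kl [[t x] z] [[/= _ Fx] Gz]; split => //=; [split => //=|].
    by have /subsetPset := ndF _ _ kl; exact.
  by have /subsetPset := ndG _ _ kl; exact.
have US : \bigcap_k (B `\` S k) = set0.
  apply/seteqP; split => // -[[t x] z] h.
  have : [set: euclidean R d] x by []. rewrite UF => -[i _ Fi].
  have : [set: R] z by []. rewrite UG => -[j _ Gj].
  have [_] := h (maxn i j) Logic.I; apply; split => /=; [split => //=|].
    by have /subsetPset := ndF _ _ (leq_maxl i j); exact.
  by have /subsetPset := ndG _ _ (leq_maxr i j); exact.
have [k ke] : exists k, (fine (intensity d nu `[0%R, T] (B `\` S k)) <= e)%R.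
  have mBS k : measurable (B `\` S k) by exact: measurableD.
  have h : intensity d nu `[0%R, T] (B `\` S k) @[k --> \oo] --> 0.
    have := @nonincreasing_cvg_mu _ _ _ (intensity d nu `[0%R, T]) (fun k => B `\` S k).
    rewrite US measure0; apply => //.
    - apply: le_lt_trans Boo; rewrite le_measure ?inE//; exact: subDsetl.
    - by move=> k l kl; rewrite subsetEset; apply: setDS; exact: ndS.
  have /cvgrPdist_le /(_ e e0) [k _ Hk] :
      fine (intensity d nu `[0%R, T] (B `\` S k)) @[k --> \oo] --> 0%R.
    exact: fine_cvg.
  exists k; have := Hk k (leqnn k).
  by rewrite sub0r normrN ger0_norm// fine_ge0.
have [mFk Fkoo] := mF k; have [mGk Gkoo] := mG k.
have Fkfin : power_measure lebesgue_measure d (F k) \is a fin_num by rewrite ge0_fin_numE.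
have Gkfin : levy nu (G k) \is a fin_num by rewrite ge0_fin_numE.
(* The mass of [S k] per unit of time; [n] is then chosen so that a slice of length [T / (n+1)] has
   mass at most [e]. *)
pose c := (fine (power_measure lebesgue_measure d (F k)) * fine (levy nu (G k)))%R.
have c0 : (0 <= c)%R by rewrite mulr_ge0 ?fine_ge0.
have [n nE] : exists n : nat, (T * c / e <= n.+1%:R)%R.
  have [n _ Hn] := nbhs_infty_ger (T * c / e)%R.
  by exists n; apply: le_trans (Hn n (leqnn n)) _; rewrite ler_nat.
pose t (i : nat) := (i%:R * (T / n.+1%:R))%R.
pose piece (i : nat) : set R := [set` `[t i, t i.+1[].
have h0 : (0 < T / n.+1%:R)%R by rewrite divr_gt0.
(* [None] is the discarded part. The slices are half-open, so the final time [T] falls into one more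
   than the [n+1] slices before it; hence [n.+2] indices. *)
pose cl (i : option 'I_n.+2) := match i with
  | None => B `\` S k
  | Some i => B `&` ((piece i `*` F k) `*` G k) end.
have mslice (i : nat) : measurable (((piece i `*` F k) `*` G k) : set (jumpSpace R d)).
  by apply: measurableX => //; apply: measurableX => //; exact: measurable_itv.
have acl i : admissible (intensity d nu `[0%R, T]) (slab d `[0%R, T]) (cl i).
  case: i => [i|]; first exact: admissibleI.
  by apply: admissible_sub aB _ _; [exact: measurableD|exact: subDsetl].
exists (option 'I_n.+2), cl; split => //.
- have tpiece (i j : nat) x : piece i x -> piece j x -> i = j.
    have h (i' j' : nat) : (i' < j')%N -> piece i' x -> piece j' x -> False.
      rewrite /piece/= !in_itv/= => ij /andP[_ x1] /andP[x2 _].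
      have := lt_le_trans x1 (ler_wpM2r (ltW h0) _ :
        (i'.+1%:R * _ <= j'%:R * (T / n.+1%:R))%R).
      rewrite ler_nat => /(_ ij) h1.
      by have := lt_le_trans h1 x2; rewrite ltxx.
    move=> xi xj; have [ij|ji|//] := ltngtP i j; exfalso;
      [exact: h ij xi xj|exact: h ji xj xi].
  move=> [i|] [j|] _ _ [[[s x] z] []] //=.
  + move=> [_ [[/= p1 _] _]] [_ [[/= p2 _] _]]; congr Some; apply/val_inj => /=.
    exact: tpiece p1 p2.
  + by move=> [_ [[/= _ Fx] Gz]] [_] []; split.
  + by move=> [_ nS] [_ [[/= _ Fx] Gz]]; exfalso; apply: nS; split.
- case=> [i|//]; have [mcl clS _] := acl (Some i).
  rewrite [X in fine X](intensity_sub clS).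
  have slE : base ((piece i `*` F k) `*` G k) = ((T / n.+1%:R) * c)%:E.
    rewrite base_slice//; last exact: measurable_itv.
    rewrite lebesgue_measure_itv/= lte_fin ltr_pM2r// ltr_nat ltnSn -EFinB -mulrBl.
    rewrite -(fineK Fkfin) -(fineK Gkfin) -!EFinM /c mulrA.
    by rewrite -natr1 addrAC subrr add0r mul1r.
  apply: (@le_trans _ _ ((T / n.+1%:R) * c)%R); last first.
    rewrite mulrAC ler_pdivrMr//.
    by move: nE; rewrite ler_pdivrMr// [leRHS]mulrC.
  have le1 : base (cl (Some i)) <= ((T / n.+1%:R) * c)%:E.
    rewrite -slE; apply: (@le_measure _ _ _ base).
    - by rewrite inE; exact: mcl.
    - by rewrite inE; exact: mslice.
    - exact: subIsetr.
  rewrite -lee_fin fineK// ge0_fin_numE//.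
  by apply: le_lt_trans le1 (ltry _).
- apply/seteqP; split => [y By|y [[i|] _]]; last 2 first.
  + by case.
  + by case.
  have [Sy|Sy] := pselect (S k y); last by exists None.
  move: y By Sy => [[s x] z] By [[/= _ Fx] Gz].
  have [[/= sT _] _] := BS _ By.
  move: sT; rewrite /= in_itv/= => /andP[s0 sT].
  pose i := Num.trunc (s / (T / n.+1%:R)).
  have sq0 : (0 <= s / (T / n.+1%:R))%R by rewrite divr_ge0// ltW.
  have /andP[i1 i2] := truncn_itv sq0.
  have iN : (i < n.+2)%N.
    rewrite ltnS -(ler_nat R); apply: le_trans i1 _.
    by rewrite ler_pdivrMr// mulrCA divff ?mulr1// pnatr_eq0.
  exists (Some (Ordinal iN)) => //=; split => //; split => //=; split => //=.
  rewrite /piece/= in_itv/= /t; apply/andP; split.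
    by rewrite -ler_pdivlMr.
  by rewrite -ltr_pdivrMr.
Qed.

End intensity_facts.

(** By Tonelli the integral is the mass of [Q] times the second moment of [m2]. *)
Lemma integral_indic_sqr_lty d1 (X1 : measurableType d1) (R : realType)
    (m1 : {sigma_finite_measure set X1 -> \bar R})
    (m2 : {sigma_finite_measure set R -> \bar R}) (Q : set X1) : measurable Q ->
  (m1 Q < +oo)%E -> (\int[m2]_z (z ^+ 2)%:E < +oo)%E ->
  (\int[m1 \x m2]_e ((\1_Q e.1 * e.2) ^+ 2)%:E < +oo)%E.
Proof.
move=> mQ Qoo m2oo.
have mf : measurable_fun setT (fun e : X1 * R => ((\1_Q e.1 * e.2) ^+ 2)%:E).
  apply/measurable_EFinP; apply: measurable_funX; apply: measurable_funM => //.
  by apply: measurableT_comp => //; exact: measurable_indic.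
have f0 (e : X1 * R) : (0 <= ((\1_Q e.1 * e.2) ^+ 2)%:E)%E by rewrite lee_fin sqr_ge0.
rewrite (fubini_tonelli1 _ mf f0) /fubini_F.
have z0 (z : R) : (0 <= (z ^+ 2)%:E)%E by rewrite lee_fin sqr_ge0.
have mz : measurable_fun setT (fun z : R => (z ^+ 2)%:E).
  by apply/measurable_EFinP; exact: measurable_funX.
have i0 : (0 <= \int[m2]_z (z ^+ 2)%:E)%E by apply: integral_ge0.
pose c := fine (\int[m2]_z (z ^+ 2)%:E)%E.
have cE : (\int[m2]_z (z ^+ 2)%:E = c%:E)%E by rewrite fineK// ge0_fin_numE.
have c0 : 0 <= c by apply: fine_ge0.
rewrite (eq_integral (fun x => c%:E * (\1_Q x)%:E)%E); last first.
  move=> x _ /=; rewrite -cE muleC -ge0_integralZl_EFin//.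
  by apply: eq_integral => z _; rewrite exprMn sqr_indic EFinM.
have m1Q : measurable_fun setT (fun x : X1 => (\1_Q x)%:E : \bar R).
  by apply/measurable_EFinP; exact: measurable_indic.
have Q0 x : setT x -> (0 <= (\1_Q x)%:E :> \bar R)%E by rewrite lee_fin.
rewrite (ge0_integralZl_EFin _ measurableT Q0 m1Q c0).
by rewrite integral_indic// setIT lte_mul_pinfty.
Qed.

Section levy_noise_field.
Context (R : realType) (d : nat) (dO : measure_display) (Omega : measurableType dO)
  (P : probability Omega R) (nu : levyMeasure R)
  (N : R.-ker Omega ~> (jumpSpace R d)).
Hypothesis nu2 : (\int[levy nu]_(z in [set~ 0%R]) (z ^+ 2)%R%:E < +oo)%E.
Hypothesis poissonN : poisson_random_measure P (intensity d nu `[0, +oo[) N.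
Variables (J : (jumpSpace R d -> R) -> Omega -> R)
  (intJ : compensated_integral P nu N J) (T : R) (T_gt0 : 0 < T).
Local Notation muoo := (intensity d nu `[0, +oo[).
Local Notation mu := (intensity d nu `[0, T]).
Local Notation adm := (admissible mu (slab d `[0, T])).

(** [N] and [J] refer to all times, the multiple integrals to [[0, T]]; this identity lets facts
    about one intensity serve the other. *)
Lemma intensity_restrict A : A `<=` slab d `[0, T] -> mu A = muoo A.
Proof.
move=> AT; rewrite (intensity_sub nu AT) intensity_sub//.
by apply: subset_trans AT _; exact: slab_subset.
Qed.

Lemma admissible_intensity A : adm A ->
  [/\ measurable A, A `<=` slab d `[0, +oo[, (muoo A < +oo)%E & muoo A = mu A].
Proof.
move=> [mA AT Aoo]; rewrite -[muoo A]intensity_restrict//; split => //.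
by apply: subset_trans AT _; exact: slab_subset.
Qed.

Lemma poisson_law_count A : adm A -> poisson_law P (fine (mu A)) (N^~ A).
Proof.
move=> aA; have [mA AT Aoo EA] := admissible_intensity aA.
split; first exact: measurable_kernel.
move=> k; have [h _ _] := poissonN.
by rewrite h// [X in fine X]EA poisson_prob1// fine_ge0.
Qed.

(** Independence is given for families indexed by ordinals; a finite type is enumerated to reach
    them. *)
Lemma indep_counts (K : finType) (A : K -> set (jumpSpace R d))
    (C : K -> set (\bar R)) : (forall i, adm (A i)) -> trivIset setT A ->
  (forall i, measurable (C i)) ->
  P [set w | forall i, C i (N w (A i))] = (\prod_i P [set w | C i (N w (A i))])%E.
Proof.
move=> aA tA mC; have [_ _ h] := poissonN.
rewrite (_ : [set w | _] =
    [set w | forall i : 'I_#|K|, C (enum_val i) (N w (A (enum_val i)))]); last first.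
  apply/seteqP; split => w /= hw i //.
  by have := hw (enum_rank i); rewrite enum_rankK.
rewrite (h _ (fun i => A (enum_val i)) (fun i => C (enum_val i)))//.
- by rewrite -(big_enum_val (A := K) (fun i => P [set w | C i (N w (A i))])).
- by move=> i; case: (aA (enum_val i)).
- move=> i j _ _ AA; apply: enum_val_inj; exact: tA AA.
Qed.

Definition mark (B : set (spaceTime R d)) (e : jumpSpace R d) : R := \1_B e.1 * e.2.

Lemma measurable_mark B : measurable B -> measurable_fun setT (mark B).
Proof.
move=> mB; apply: measurable_funM => //.
by apply: measurableT_comp => //; exact: measurable_indic.
Qed.

Lemma bounded_borel_finite (s : R) (B : set (euclidean R d)) : 0 <= s ->
  bounded_borel B ->
  ((lebesgue_measure \x power_measure lebesgue_measure d)
    ([set` `[0%R, s]] `*` B) < +oo)%E.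
Proof.
move=> s0 [mB [M BM]].
pose I : set (measurableTypeR R) := [set` `[- M, M]].
have mI (a b : R) : measurable ([set` `[a, b]] : set (measurableTypeR R)).
  exact: measurable_itv.
have fI (a b : R) : (lebesgue_measure ([set` `[a, b]] : set (measurableTypeR R)) < +oo)%E.
  by rewrite lebesgue_measure_itv/=; case: ifP => _; rewrite ?ltry.
have mbox : measurable (box (fun _ : 'I_d => I)).
  by apply: measurable_box => i; exact: mI.
apply: (@le_lt_trans _ _ ((lebesgue_measure \x power_measure lebesgue_measure d)%E
    ([set` `[0%R, s]] `*` box (fun _ : 'I_d => I)))).
  apply: le_measure; rewrite ?inE; [exact: measurableX|exact: measurableX|].
  move=> [t x] [/= ts Bx]; split => //= i.
  by rewrite /I /= in_itv/= -ler_norml; exact: BM.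
rewrite product_measure1E// lte_mul_pinfty//.
  by rewrite ge0_fin_numE//; exact: fI.
by apply: power_measure_box_lty => i; [exact: mI|exact: fI].
Qed.

(** Here the second moment of [nu] enters: it makes the integrand of the noise square-integrable, so
    that the linearity and continuity of [J] apply to it. *)
Lemma L2_mark (s : R) (B : set (euclidean R d)) : 0 <= s ->
  bounded_borel B -> mark ([set` `[0%R, s]] `*` B) \in Lfun muoo 2%:E.
Proof.
move=> s0 bB; have Qoo := bounded_borel_finite s0 bB; have [mB _] := bB.
set Q := [set` `[0%R, s]] `*` B in Qoo *.
have mQ : measurable Q by apply: measurableX => //; exact: measurable_itv.
apply/L2P; split; first exact: measurable_mark.
have sq0 e : (0 <= (mark Q e ^+ 2)%:E)%E by rewrite lee_fin sqr_ge0.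
have sf : sigma_finite setT
    (lebesgue_measure \x power_measure (@lebesgue_measure R) d)%E.
  by apply: product_sigma_finite; exact: sigma_finiteT.
pose m1 : {sigma_finite_measure set (spaceTime R d) -> \bar R} :=
  HB.pack (lebesgue_measure \x power_measure (@lebesgue_measure R) d)%E
    (Measure_isSigmaFinite.Build _ _ _ _ sf).
apply: (@le_lt_trans _ _ (\int[(m1 \x levy nu)%E]_e (mark Q e ^+ 2)%:E)%E).
  apply: ge0_le_measure_integral => //.
    by move=> A mA; exact: intensity_le.
  by apply/measurable_EFinP; apply: measurable_funX; exact: measurable_mark.
apply: integral_indic_sqr_lty => //.
(* The point 0 has no [levy nu] mass, so the second moment over the whole line is the one assumed
   finite. *)
rewrite (@ge0_negligible_integral _ _ _ (levy nu) setT [set 0%R])//.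
- by rewrite setTD.
- by apply/measurable_EFinP; exact: measurable_funX.
- by move=> z _; rewrite lee_fin sqr_ge0.
- exact: levy_measure_set1.
Qed.

(** [L2_indicator_induction] on the integrand: that [J f] is void-measurable passes through linear
    combinations and [L^2] limits, and for the indicator of a level set [J] gives a compensated
    count. *)
Lemma noise_field_void : noise_field J T `<=` <<s void_system P mu (slab d `[0, T]) N >>.
Proof.
apply: smallest_sub; first exact: smallest_sigma_algebra.
have [linJ J_indic] := intJ.
have lawN := poisson_law_count.
move=> _ [s [B [C [/andP[s0 sT] bB mC ->]]]].
have mB : measurable B by case: bB.
rewrite /levy_noise -/(mark _).
have linJn (n : nat) := linJ.
have [JL2 Jlin Jcvg] := linJ.
suff : void_measurable P mu (slab d `[0, T]) N (J (mark ([set` `[0%R, s]] `*` B))) by apply.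
apply: (L2_indicator_induction (W := fun f => void_measurable P mu (slab d `[0, T]) N (J f))
  _ _ (L2_mark s0 bB)).
- move=> a g h g2 h2 vg vh.
  apply: (void_measurable_ae (void_measurable_lin a vg vh)).
    by apply: L2_measurable; apply: JL2; exact: L2_lin.
  by have := Jlin a g h g2 h2; apply: filterS => w /(_ Logic.I) -> _.
- move=> u g u2 g2 vu ug.
  apply: (void_measurable_L2cvg vu) => [k||]; [exact: JL2|exact: JL2|exact: Jcvg].
- move=> C' mC' C'0 C'oo.
  set A := _ @^-1` C' in C'oo *.
  (* A nonzero mark has a nonzero jump and a time in [[0, s]], so a level set away from 0 lies in
     the slab up to time [T], where counts are void-measurable. *)
  have AT : A `<=` slab d `[0, T].
    move=> [[t x] z]; rewrite /A /mark /= => h.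
    have [z0|z0] := eqVneq z 0; first by exfalso; apply: C'0; rewrite z0 mulr0 in h.
    split => /=; last exact/eqP.
    split => //=; rewrite in_itv/=.
    have : ([set` `[0%R, s]] `*` B) (t, x).
      apply: contrapT => nQ; apply: C'0; move: h.
      by rewrite indicE memNset// mul0r.
    by move=> [/= ts _]; move: ts; rewrite /= in_itv/= => /andP[-> /le_trans]; apply.
  have mA : measurable A.
    rewrite -[X in measurable X]setTI; apply: measurable_mark => //.
    by apply: measurableX => //; exact: measurable_itv.
  have aA : adm A by split => //; rewrite [X in (X < _)%E]intensity_restrict.
  apply: (void_measurable_ae (void_measurable_compensated lawN (intensity_diffuse T_gt0) aA)).
    by apply: L2_measurable; apply: JL2; exact: L2_indic.
  have [_ AS _ EA] := admissible_intensity aA.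
  apply: filterS (J_indic A mA AS C'oo) => w /(_ Logic.I) -> _.
  by rewrite /compensated EA.
Qed.

End levy_noise_field.

(** * Application to the given integrals, degree 0, and conclusion *)

Lemma multiple_integral_gram (R : realType) (d : nat)
  (dO : measure_display) (Omega : measurableType dO) (P : probability Omega R)
  (nu : levyMeasure R) (N : R.-ker Omega ~> (jumpSpace R d))
  (poissonN : poisson_random_measure P (intensity d nu `[0, +oo[) N)
  (T : R) (T_gt0 : 0 < T)
  (MI : forall n : nat, (n.-tuple (jumpSpace R d) -> R) -> Omega -> R)
  (intI : forall n : nat, multiple_integral P nu N T (@MI n)) :
  let mu := intensity d nu `[0, T] in
  let adm := admissible mu (slab d `[0, T]) in
  [/\ forall n, L2_continuous_linear (power_measure mu n) P (@MI n),
      forall n k B C, adm B -> adm C ->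
        ip P (@MI n (cube n B)) (@MI k (cube k C)) =
        if n == k then n`!%:R * fine (mu (B `&` C)) ^+ n else 0 &
      forall n B, adm B -> ip P (void N B) (@MI n (cube n B)) =
        expR (- fine (mu B)) * (-1) ^+ n * fine (mu B) ^+ n].
Proof.
move=> mu adm.
have lawN := poisson_law_count poissonN (T := T).
have indepN := indep_counts poissonN (T := T).
have dif := intensity_diffuse (d := d) (nu := nu) T_gt0.
have linI n : L2_continuous_linear (power_measure mu n) P (@MI n).
  by case: (intI n).
have I_box n (A : 'I_n -> set (jumpSpace R d)) : (forall i, adm (A i)) ->
    trivIset setT A ->
    @MI n \1_(box A) = (fun w => \prod_(i < n) compensated mu N (A i) w) %[ae P].
  by move=> aA tA; have [_ h] := intI n; apply: h => // i; case: (aA i).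
split => //.
- exact: ip_multiple_integral_cube lawN indepN dif linI I_box.
- exact: ip_void_multiple_integral lawN indepN dif linI I_box.
Qed.

Lemma poisson_chaos_expansion (R : realType) (d : nat)
  (dO : measure_display) (Omega : measurableType dO) (P : probability Omega R)
  (nu : levyMeasure R)
  (nu2 : (\int[levy nu]_(z in [set~ 0%R]) (z ^+ 2)%R%:E < +oo)%E)
  (N : R.-ker Omega ~> (jumpSpace R d))
  (poissonN : poisson_random_measure P (intensity d nu `[0, +oo[) N)
  (J : (jumpSpace R d -> R) -> Omega -> R)
  (intJ : compensated_integral P nu N J)
  (T : R) (T_gt0 : 0 < T)
  (MI : forall n : nat, (n.-tuple (jumpSpace R d) -> R) -> Omega -> R)
  (intI : forall n : nat, multiple_integral P nu N T (@MI n))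
  (F : Omega -> R) (F2 : F \in Lfun P 2%:E)
  (mF : forall C : set R, measurable C -> noise_field J T (F @^-1` C)) :
  exists f, expands P (intensity d nu `[0, T]) (slab d `[0, T]) MI F f.
Proof.
have [linI ip_I ip_V] := multiple_integral_gram poissonN T_gt0 intI.
have vexp := void_expands (poisson_law_count poissonN (T := T)) linI ip_I ip_V.
apply: (void_measurable_expands linI ip_I vexp F2) => C mC.
exact: (noise_field_void nu2 poissonN intJ T_gt0 (mF C mC)).
Qed.

(* In degree 0 the tuple space is a single point, so I_0 is evaluation there. *)
Definition extend_degree0 (R : realType) (E Omega : Type)
    (I : forall n, (n.-tuple E -> R) -> Omega -> R) n : (n.-tuple E -> R) -> Omega -> R :=
  match n with 0 => fun f _ => f [tuple] | n'.+1 => @I n'.+1 end.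

Lemma ip_power_measure0 d (E : measurableType d) (R : realType)
    (mu : {sigma_finite_measure set E -> \bar R}) (f g : 0.-tuple E -> R) :
  ip (power_measure mu 0) f g = f [tuple] * g [tuple].
Proof.
transitivity (\int[power_measure mu 0]_x (f [tuple] * g [tuple])).
  by apply: eq_Rintegral => x _; rewrite (tuple0 x).
rewrite Rintegral_cst// [X in fine X](_ : _ = 1%E) ?mulr1//.
by rewrite /= diracE mem_set.
Qed.

(** Integrals are given for [n >= 1], whereas expansions start in degree 0. There the box is the
    whole one-point space and the product is empty, so both sides are 1. *)
Lemma multiple_integral0 (R : realType) (d : nat)
  (dO : measure_display) (Omega : measurableType dO) (P : probability Omega R)
  (nu : levyMeasure R) (N : R.-ker Omega ~> (jumpSpace R d)) (T : R)
  (I : forall n : nat, (n.-tuple (jumpSpace R d) -> R) -> Omega -> R) :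
  multiple_integral P nu N T (extend_degree0 I (n := 0)).
Proof.
have c2 (c : R) : (fun _ : Omega => c) \in Lfun P 2%:E by exact: Lfun_cst.
split; last first.
  move=> A _ _ _ _; apply: nearW => w _ /=.
  by rewrite big_ord0 indicE mem_set// => -[].
split => [f _|a f g _ _|u f u2 f2]; first exact: c2.
  exact: nearW.
move=> /(L2cvgP u2 f2) h; apply/L2cvgP; [by move=> k; exact: c2|exact: c2|].
have E k : ip P ((fun=> u k [tuple]) \- (fun=> f [tuple]))
      ((fun=> u k [tuple]) \- (fun=> f [tuple])) =
    ip (power_measure (intensity d nu `[0, T]) 0) (u k \- f) (u k \- f).
  rewrite ip_power_measure0.
  exact: (Rintegral_probability_cst P ((u k [tuple] - f [tuple]) * (u k [tuple] - f [tuple]))).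
by rewrite (eq_cvg _ _ E).
Qed.

Theorem theorem4p6 (R : realType) (d : nat)
  (dO : measure_display) (Omega : measurableType dO) (P : probability Omega R)
  (nu : levyMeasure R)
  (nu2 : (\int[levy nu]_(z in [set~ 0%R]) (z ^+ 2)%R%:E < +oo)%E)
  (N : R.-ker Omega ~> (jumpSpace R d))
  (poissonN : poisson_random_measure P (intensity d nu `[0, +oo[) N)
  (J : (jumpSpace R d -> R) -> Omega -> R)
  (intJ : compensated_integral P nu N J)
  (T : R) (T_gt0 : 0 < T)
  (I : forall n : nat, (n.-tuple (jumpSpace R d) -> R) -> Omega -> R)
  (intI : forall n : nat, (0 < n)%N -> multiple_integral P nu N T (I n))
  (F : Omega -> R) (F2 : F \in Lfun P 2%:E)
  (mF : forall C : set R, measurable C -> noise_field J T (F @^-1` C)) :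
  exists f : forall n : nat, n.-tuple (jumpSpace R d) -> R,
    [/\ forall n : nat, (0 < n)%N ->
          f n \in Lfun (power_measure (intensity d nu `[0, T]) n) 2%:E /\
          symmetric_fun (f n),
        L2cvg P (fun m w => fine 'E_P[F] + \sum_(1 <= n < m.+1) I n (f n) w) F &
        ('E_P[fun w => (`|F w| ^+ 2)%R] = `|'E_P[F]| ^+ 2 +
          \sum_(1 <= n <oo) (n`!%:R)%:E *
            'N[power_measure (intensity d nu `[0, T]%R) n]_2%:E[EFin \o f n] ^+ 2)%E ].
Proof.
pose MI := extend_degree0 I.
have intMI n : multiple_integral P nu N T (@MI n).
  by case: n => [|n]; [exact: multiple_integral0|exact: intI].
have [f Ff] := poisson_chaos_expansion nu2 poissonN intJ T_gt0 intMI F2 mF.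
have [linI ip_I _] := multiple_integral_gram poissonN T_gt0 intMI.
have [_ fc Fcv] := Ff.
set mu := intensity d nu `[0, T] in linI ip_I Ff fc *.
have p2 M : partial_chaos MI f M \in Lfun P 2%:E by exact: (L2_partial_chaos linI).
have one2 : (cst 1 : Omega -> R) \in Lfun P 2%:E by exact: Lfun_cst.
have ip1 G : ip P G (cst 1) = fine 'E_P[G].
  by rewrite unlock /ip /Rintegral; congr fine; apply: eq_integral => w _; rewrite mulr1.
(* A box over no index imposes no condition, so even the empty set gives 1: the constant is itself
   an integral of degree 0. *)
have cube1 : @MI 0%N (cube 0 set0) = cst 1.
  apply/funext => w; rewrite /MI /extend_degree0 /cube indicE mem_set// => -[].
  done.
have c0 := admissible0 mu (slab d `[0, T]).
(* Test the partial sums against the constant 1: it is orthogonal to all positive degrees, so only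
   the coefficient of degree 0 remains. *)
have meanE : fine 'E_P[F] = f 0%N [tuple].
  have h1 : ip P (partial_chaos MI f M.+1) (cst 1) @[M --> \oo] --> fine 'E_P[F].
    rewrite -ip1 (cvg_shiftS (fun M => ip P (partial_chaos MI f M) (cst 1))).
    by apply: (L2cvg_ip (v := fun=> cst 1)) => //; exact: L2cvg_cst.
  have h2 : ip P (partial_chaos MI f M.+1) (cst 1) @[M --> \oo] --> f 0%N [tuple].
    rewrite (_ : (fun M => _) = fun=> f 0%N [tuple]); first exact: cvg_cst.
    apply/funext => M; rewrite /partial_chaos ip_suml//; last first.
      by move=> n _; apply: (I_L2 linI); exact: chaos_L2.
    rewrite big_ord_recl big1 ?addr0 => [|n _].
      by rewrite ip1 /= expectation_cst.
    by rewrite -cube1; apply: (chaos_orthogonal linI ip_I) => //; exact: chaos_cube.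
  exact: cvg_unique h1 h2.
exists f; split.
- move=> n n0; split; [exact: chaos_L2|exact: chaos_symmetric (fc n)].
(* The sum up to degree [m] has [m + 1] terms, the first of which is the mean. *)
- rewrite (_ : (fun m w => _) = fun m => partial_chaos MI f m.+1).
    rewrite /L2cvg (cvg_shiftS (fun k => 'N[P]_2%:E[EFin \o (partial_chaos MI f k \- F)%R]%E)).
    exact: Fcv.
  apply/funext => m; apply/funext => w.
  rewrite /partial_chaos meanE big_ord_recl/=; congr (_ + _).
  by rewrite big_add1 big_mkord.
- have n0E : ip (power_measure mu 0) (f 0%N) (f 0%N) = f 0%N [tuple] ^+ 2.
    by rewrite ip_power_measure0 expr2.
  have EF : ('E_P[F] = (f 0%N [tuple])%:E)%E.
    rewrite -meanE fineK// unlock.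
    exact: (integrable_fin_num measurableT (L2_integrable F2)).
  have -> : ('E_P[fun w => (`|F w| ^+ 2)%R] = (ip P F F)%:E)%E.
    rewrite unlock EFin_ip_sqr//; apply: eq_integral => w _.
    by rewrite real_normK// num_real.
  pose a n : R := n`!%:R * ip (power_measure mu n) (f n) (f n).
  have a0 n : 0 <= a n by rewrite mulr_ge0// ip_ge0.
  (* Parseval from degree 0 on, whose term is split off as the squared mean. *)
  rewrite EF; transitivity (\sum_(0 <= n <oo) (a n)%:E)%E.
    apply/esym; apply: cvg_lim => //.
    under eq_fun do rewrite sumEFin big_mkord.
    by apply/cvg_EFinP; exact: expands_norm linI ip_I _ _ Ff.
  rewrite nneseries_recl//; last by move=> n _; rewrite lee_fin.
  congr (_ + _)%E.
    by rewrite /a fact0 mul1r n0E -EFin_expe real_normK// num_real.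
  apply: eq_eseriesr => n _; rewrite Lnorm2_ip ?EFinM//.
  exact: chaos_L2.
Qed.
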